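(* Let $X\subset\mathbb{P}^3_{\mathbb{K}}$ be a smooth quartic and let $\ell\subset X$ be a line of the second kind with ramification type $R=2,1^2$, and let $\mathcal{R}=2P_1+P_2+P_3$ be the ramification divisor of $\pi|_\ell$. (a) The quartic $X$ is given by Segre's construction (with respect to $\ell$) if and only if the line $\ell$ runs through the singular point of a type $IV$ fiber of the fibration $\pi$. (b) If the equivalent conditions of (a) hold, then: (i) the surface $S_8$ defined by $(X,\ell)$ is a septic that consists of the tangent planes $T_{P_1}X$, $T_{P_2}X$, $T_{P_3}X$ and an (irreducible) ruled quartic $S_4$; (ii) the line $\ell$ is met by exactly five triplets of coplanar lines on $X$, that are contained in the plane $T_{P_1}X$ and four other planes $L_1,\dots,L_4$; (iii) the Segre decomposition of $X$ with respect to $\ell$ is unique and coincides with $$\lambda\cdot S_4+L_1\cdot L_2\cdot L_3\cdot L_4=0,\qquad\lambda\in\mathbb{K}^\times;$$ that is, $X$ is given by this equation, and for every Segre decomposition $S+\hat L_1\cdots\hat L_4$ of $X$ one has $S=S_4$ (as surfaces) and $\{\hat L_1,\dots,\hat L_4\}=\{L_1,\dots,L_4\}$; (iv) the fibration $\pi$ is of type $IV\oplus4I_3\oplus4I_1\oplus2II$ (resp. $5\,IV\oplus2II$) if and only if $\operatorname{sing}(S_4)$ is a twisted cubic (resp. a line).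
   Context: $\mathbb{K}$ is an algebraically closed field of characteristic different from $2$ and $3$. The same symbol is used for a homogeneous polynomial and its zero set. Let $X\subset\mathbb{P}^3_{\mathbb{K}}$ be a smooth quartic containing a line $\ell$. The linear system $|\mathcal{O}_X(1)-\ell|$ gives an elliptic fibration $\pi:X\to\mathbb{P}^1$ whose fibers are the plane cubics residual to $\ell$ in $X\cap H$, for planes $H\supset\ell$. For $P\in\ell$, $F_P$ denotes the fiber of $\pi$ containing $P$, so $X\cap T_PX=\ell+F_P$. The line $\ell$ is of the second kind iff it is contained in the (Zariski) closure of the set of inflection points of the smooth fibers of $\pi$. The restriction $\pi|_\ell:\ell\to\mathbb{P}^1$ has degree $3$ and its ramification divisor $\mathcal{R}$ has degree $4$; ramification type $R=2,1^2$ means $\mathcal{R}=2P_1+P_2+P_3$ with distinct $P_i$. The type of the fibration is the complete list of its singular fibers with Kodaira types. Lines meeting $\ell$ are understood to be different from $\ell$. Segre's construction: $X$ is given by Segre's construction with respect to $\ell$ if $X$ is given by an equation $S+\hat L_1\cdots\hat L_4=0$ (a Segre decomposition), where the quartic $S$ is a union of a family of lines, each of which meets $\ell$, and the planes $\hat L_1,\dots,\hat L_4$ meet along $\ell$. The surface $S_8$ defined by $(X,\ell)$ is the (reduced) union of all lines in $$\mathfrak{S}_\ell=\{\tilde\ell\subset\mathbb{P}^3\text{ a line}:\ \exists P\in\ell\text{ with }\tilde\ell\subset T_PX\text{ and }i(\tilde\ell,F_P;P)\ge2\},$$ where $i(\tilde\ell,F_P;P)$ is the intersection multiplicity at $P$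 of $\tilde\ell$ and the cubic $F_P$ inside the plane $T_PX$ (taken to be $\infty$ if $P\in\tilde\ell\subset F_P$); it is a hypersurface in $\mathbb{P}^3$. A ruled surface is a reduced, irreducible surface in $\mathbb{P}^3$ that is a union of a family of lines and is not a cone over a planar curve. *)

(* Defs.v *)
From mathcomp Require Import all_boot all_order all_fingroup all_algebra.
From mathcomp Require Import finmap.
From mathcomp Require Import mpoly.

Set Implicit Arguments.
Unset Strict Implicit.
Unset Printing Implicit Defensive.
Import GRing.Theory.
Local Open Scope ring_scope.

(* Conventions.  A point of P^3 is given by a nonzero vector of homogeneous
   coordinates; two such vectors p, q give the same point iff <[p]> = <[q]>.
   A line is a subspace of K^4 of dimension 2.  A plane is given by the nonzero
   coefficient vector u of its equation, so that u and u' give the same plane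
   iff <[u]> = <[u']>.  A surface is given by a form, up to a scalar. *)

Section ProjectiveGeometry.
Variable K : closedFieldType.
Notation vec := 'rV[K]_4.
Notation form := {mpoly K[4]}.

Definition evalv (g : form) (v : vec) : K := g.@[v ord0].

Definition lform (u : vec) : form := \sum_(i < 4) u ord0 i *: 'X_i.

Definition is_line (m : {vspace vec}) : Prop := \dim m = 2%N.

Definition in_plane (m : {vspace vec}) (u : vec) : Prop :=
  forall v, v \in m -> evalv (lform u) v = 0.

Definition in_surface (m : {vspace vec}) (g : form) : Prop :=
  forall v, v \in m -> evalv g v = 0.

Definition meets (m l : {vspace vec}) : Prop :=
  m <> l /\ (m :&: l)%VS <> 0%VS.

Definition sing_point (g : form) (v : vec) : Prop :=
  [/\ v <> 0, evalv g v = 0 & forall i, evalv (mderiv i g) v = 0].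

Definition smooth_surface (g : form) : Prop := forall v, ~ sing_point g v.

Definition tangent_plane (f : form) (p : vec) : vec :=
  \row_i evalv (mderiv i f) p.

Definition irreducible_form (g : form) : Prop :=
  [/\ g != 0, g \isn't a GRing.unit
    & forall a b, g = a * b -> a \is a GRing.unit \/ b \is a GRing.unit].

(* g is the equation of the reduced hypersurface whose points are those of A *)
Definition reduced_equation (A : vec -> Prop) (g : form) : Prop :=
  [/\ g != 0,
      forall a b, g = a ^+ 2 * b -> a \is a GRing.unit
    & forall v, v <> 0 -> (evalv g v = 0 <-> A v)].

(* v is the vertex, the planar curve is cut out by c in the plane u *)
Definition cone_over_planar_curve (s : form) : Prop :=
  exists (v u : vec) (d : nat) (c : form),
    [/\ evalv (lform u) v <> 0, c \is d.-homog
      & forall x, x <> 0 ->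
          (evalv s x = 0 <->
           exists q, [/\ q <> 0, evalv (lform u) q = 0, evalv c q = 0
                       & x \in (<[v]> + <[q]>)%VS])].

Definition ruled_surface (s : form) : Prop :=
  [/\ irreducible_form s,
      forall v, v <> 0 -> evalv s v = 0 ->
        exists m, [/\ is_line m, v \in m & in_surface m s]
    & ~ cone_over_planar_curve s].

(* g restricted to the affine parametrization p + t q *)
Definition restr (g : form) (p q : vec) : {poly K} :=
  mmap polyC (fun i => (p ord0 i)%:P + q ord0 i *: 'X) g.

(* k <= i(m, {g = 0}; p), the multiplicity being infinite if g vanishes on m
   and p is on m *)
Definition imult_ge (g : form) (m : {vspace vec}) (p : vec) (k : nat) : Prop :=
  (0 < k)%N -> p \in m /\ forall q, q \in m -> ('X^k %| restr g p q)%R.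

Definition is_twisted_cubic (A : vec -> Prop) : Prop :=
  exists2 M : 'M[K]_4, M \in unitmx &
    forall v, v <> 0 ->
      (A v <-> exists a b : K, (a, b) <> (0, 0) /\
         <[v]>%VS = <[(\row_(j < 4) (a ^+ (3 - j) * b ^+ j)) *m M]>%VS).

Definition is_line_set (A : vec -> Prop) : Prop :=
  exists2 m, is_line m & forall v, v <> 0 -> (A v <-> v \in m).

(* Plane cubics: the curve {g = 0} in the plane u; only the class of g modulo
   lform u matters. *)

Definition curve_point (u : vec) (g : form) (v : vec) : Prop :=
  [/\ v <> 0, evalv (lform u) v = 0 & evalv g v = 0].

(* all derivatives of g in directions of the plane vanish at v *)
Definition curve_sing (u : vec) (g : form) (v : vec) : Prop :=
  curve_point u g v /\
  forall w, evalv (lform u) w = 0 ->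
    \sum_(i < 4) w ord0 i * evalv (mderiv i g) v = 0.

Definition inflection_point (u : vec) (g : form) (v : vec) : Prop :=
  curve_point u g v /\
  exists m, [/\ is_line m, in_plane m u & imult_ge g m v 3].

Definition irreducible_plane_curve (d : nat) (u : vec) (g : form) : Prop :=
  forall d1 d2 (a b q : form), (0 < d1)%N -> (0 < d2)%N -> (d1 + d2)%N = d ->
    a \is d1.-homog -> b \is d2.-homog -> g <> a * b + lform u * q.

(* for a double point v: m is a line of the tangent cone of the curve at v *)
Definition tangent_at (u : vec) (g : form) (v : vec) (m : {vspace vec}) : Prop :=
  [/\ is_line m, in_plane m u & imult_ge g m v 3].

Definition three_lines (u : vec) (g : form) (a : 'I_3 -> vec) : Prop :=
  (exists q, g = \prod_(i < 3) lform (a i) + lform u * q) /\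
  forall i j, i != j -> free [:: u; a i; a j].

Definition concurrent (u : vec) (a : 'I_3 -> vec) : Prop :=
  exists v, [/\ v <> 0, evalv (lform u) v = 0
              & forall i, evalv (lform (a i)) v = 0].

Definition line_and_conic (u : vec) (g : form) (a : vec) (b : form) : Prop :=
  [/\ free [:: u; a], b \is 2.-homog, irreducible_plane_curve 2 u b
    & exists q, g = lform a * b + lform u * q].

(* The singular fibers of Kodaira type that are reduced plane cubics; a plane
   section of a smooth quartic is reduced, so no other type can occur. *)
Inductive kodaira := I1 | I2 | I3 | II | III | IV.

Definition kodaira_cubic (T : kodaira) (u : vec) (g : form) : Prop :=
  match T with
  | I1 => irreducible_plane_curve 3 u g /\
          exists v m1 m2, [/\ curve_sing u g v, m1 <> m2
            & forall m, tangent_at u g v m <-> m = m1 \/ m = m2]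
  | II => irreducible_plane_curve 3 u g /\
          exists v m1, curve_sing u g v /\
            forall m, tangent_at u g v m <-> m = m1
  | I2 => exists a b, line_and_conic u g a b /\
          exists v1 v2, [/\ <[v1]>%VS <> <[v2]>%VS,
            curve_point u b v1 /\ evalv (lform a) v1 = 0
            & curve_point u b v2 /\ evalv (lform a) v2 = 0]
  | III => exists a b, line_and_conic u g a b /\
          exists v, [/\ curve_point u b v, evalv (lform a) v = 0
            & forall v', curve_point u b v' -> evalv (lform a) v' = 0 ->
                <[v']>%VS = <[v]>%VS]
  | I3 => exists a, three_lines u g a /\ ~ concurrent u a
  | IV => exists a, three_lines u g a /\ concurrent u a
  end.

Section Fibration.
Variables (f : form) (l : {vspace vec}).

(* the section of f by the plane u through l is l + {g = 0}; a is an equation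
   of l in that plane *)
Definition fiber (u : vec) (g : form) : Prop :=
  [/\ u <> 0, in_plane l u, g \is 3.-homog
    & exists (a : vec) (q : form),
        [/\ in_plane l a, free [:: u; a]
          & f = lform a * g + lform u * q]].

Definition fiber_at (p : vec) (g : form) : Prop := fiber (tangent_plane f p) g.

Definition smooth_fiber_inflection (v : vec) : Prop :=
  exists u g, [/\ fiber u g, forall w, ~ curve_sing u g w
                & inflection_point u g v].

Definition second_kind : Prop :=
  forall (d : nat) (h : form), h \is d.-homog ->
    (forall v, smooth_fiber_inflection v -> evalv h v = 0) -> in_surface l h.

(* The scheme-theoretic fiber of the restriction of the fibration to l through
   p is the intersection of l with F_p, so its ramification index e_p is
   i(l, F_p; p). *)
Definition ramification_index (p : vec) (e : nat) : Prop :=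
  exists g, [/\ fiber_at p g, imult_ge g l p e & ~ imult_ge g l p e.+1].

(* The effective divisor given by the list D of its points is the sum of the
   (e_p - 1) p.  This is the ramification divisor because e_p <= 3 is prime to
   the characteristic (different from 2 and 3): the ramification is tame. *)
Definition ramification_divisor (D : seq vec) : Prop :=
  (forall p, p \in D -> p <> 0 /\ p \in l) /\
  forall p, p <> 0 -> p \in l ->
    ramification_index p (count (fun q => <[q]>%VS == <[p]>%VS) D).+1.

Definition fibration_type (T : seq kodaira) : Prop :=
  exists us : seq vec,
    [/\ size us = size T,
        uniq [seq <[u]>%VS | u <- us],
        forall i, (i < size T)%N ->
          exists g, fiber (nth 0 us i) g /\
                    kodaira_cubic (nth I1 T i) (nth 0 us i) g
      & forall u g, fiber u g -> (exists v, curve_sing u g v) ->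
          <[u]>%VS \in [seq <[u']>%VS | u' <- us]].

Definition through_singular_point_of_IV : Prop :=
  exists u g v, [/\ fiber u g, kodaira_cubic IV u g, curve_sing u g v & v \in l].

(* The equation f of the quartic is determined up to a scalar only, hence c.
   That the planes meet along l means that their intersection is l. *)
Definition segre_decomposition (s : form) (L : 4.-tuple vec) : Prop :=
  [/\ s != 0 /\ s \is 4.-homog,
      forall v, v <> 0 -> evalv s v = 0 ->
        exists m, [/\ is_line m, v \in m, in_surface m s & meets m l],
      forall i, tnth L i <> 0,
      forall v, v \in l <-> forall i, evalv (lform (tnth L i)) v = 0
    & exists2 c : K, c != 0 & f = c *: (s + \prod_(u <- L) lform u)].

Definition segre_construction : Prop := exists s L, segre_decomposition s L.

Definition frakS (m : {vspace vec}) : Prop :=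
  is_line m /\
  exists p g, [/\ p <> 0, p \in l, in_plane m (tangent_plane f p)
                & fiber_at p g /\ imult_ge g m p 2].

Definition S8 (v : vec) : Prop := exists2 m, frakS m & v \in m.

Definition coplanar_triplet (t : {fset {vspace vec}}) : Prop :=
  [/\ #|` t|%fset = 3%N,
      forall m, m \in t -> [/\ is_line m, in_surface m f & meets m l]
    & exists2 u, u <> 0 & forall m, m \in t -> in_plane m u].

End Fibration.
End ProjectiveGeometry.

(* Main.v *)
Require Import Defs.
From mathcomp Require Import all_boot all_order all_fingroup all_algebra.
From mathcomp Require Import finmap.
From mathcomp Require Import mpoly.
From mathcomp Require Import ring.

(** Everything is read off from a normal form of [f].  Choose coordinates in which [l]
    is the line [x2 = x3 = 0] and [P1], [P2], [P3] are (1 : 0), (1 : 1), (-1 : 1).  The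
    restriction of the fibration to [l] is a pencil of binary cubics, and its
    ramification divisor forces the part of [f] that is linear in [x2], [x3] to be
    [x1^3 x2 + (x0^3 - 3 x0 x1^2) x3] ([normal_linear_part]).  At an inflection point
    of a residual cubic the Hessian form vanishes on the tangent vector.  Written in
    the coordinates of the quartic this is the vanishing of a form on all inflection
    points of smooth fibers.  If [l] is of the second kind, then the form vanishes on
    [l] ([second_kind_identity]).  Translating [x0], [x1] by linear forms in [x2],
    [x3], one finds that the parts of [f] of degree 2 and 3 in [x2], [x3] only depend
    on two constants [b] and [e], while the part of degree 4 is arbitrary
    ([normal_form]).

    Both conditions in (a) are equivalent to [b = 0].

    If a type IV fiber has its singular point on [l], then its equation is annihilated
    by the derivative in the direction of this point ([concurrent_invariant]), which
    gives [b = 0].  In a Segre decomposition, [S] agrees with [f] up to the part of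
    degree 4.  A line on [S] that meets [l] in [P] is the tangent of the residual cubic
    at [P].  A general plane through [l] is tangent at three points of [l], and all
    three tangents lie on [S]: the coordinates [x0] of the three points of the cubic
    with given [x1] have the sum 0, which would be violated if only two of the tangents
    were used ([slope_identity]).  So the part of degree 4 is a function of the point of
    contact [rho], and comparing its highest power with that of a binary quartic in
    [s = 3 rho - rho^3] gives [b^3 = 0] ([segre_b0]).

    Conversely, let [b = 0].  The quartic [S4f] with a suitable part of degree 4 is
    swept out by the lines [ruling] ([S4f_cover]), and [f = S4f + G] with a binary
    quartic [G] in [x2], [x3].  Smoothness of [f] makes the roots of [G] simple, so [G]
    is a product of four planes ([segre_exists]), and [slope_identity] determines the
    part of degree 4 of any other decomposition ([segre_unique]).  The residual cubic in
    the tangent plane of [P1] is [(x1 + e z)^3 + G z^3], three lines through [P1].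

    For (b) the residual cubics are now explicit.  The tangent at an unramified point of
    [l] is the line of the ruling; at [P1], [P2], [P3] the residual cubic is singular and
    the whole pencil of lines appears, which gives the septic ([S8_zeros]).  A line of
    the quartic that meets [l] lies on a plane [G = 0] or in the tangent plane of [P1]
    ([line_meeting_l]); these five planes give the triplets.  Singular fibers occur in
    the plane [t = 0] (type IV), for [G = 0] (three lines), in the tangent planes of
    [P2] and [P3] (cusps), and, if [e] is not zero, in four planes with a node
    ([singular_fiber]).  The three lines in a plane [G = 0] are concurrent exactly when
    [e = 0].  On the other hand, the singular points of [S4f] form a twisted cubic if
    [e] is not zero, and the line [x0 = x1 = 0] if [e = 0]. *)

Set Implicit Arguments.
Unset Strict Implicit.
Unset Printing Implicit Defensive.
Import GRing.Theory.
Local Open Scope ring_scope.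

(** * Polynomials as functions over an infinite field *)

Section PolynomialFunctions.
Variable K : closedFieldType.

(** Properties of ring morphisms on polynomials reduce to constants and variables. *)
Lemma mpoly_gen_ind n (P : {mpoly K[n]} -> Prop) :
    (forall c, P c%:MP) -> (forall i, P 'X_i) ->
    (forall p q, P p -> P q -> P (p + q)) ->
    (forall p q, P p -> P q -> P (p * q)) ->
  forall p, P p.
Proof.
move=> PC PX PD PM; elim/mpolyind=> [|c m p _ _ Pp]; first by rewrite -(mpolyC0 n).
apply: (PD) => //; rewrite -mul_mpolyC; apply: (PM) => //.
rewrite mpolyXE_id; apply: (big_ind P) => [||i _]; [exact: PC 1|exact: PM|].
elim: (m i) => [|k IH]; first by rewrite expr0; exact: PC 1.
by rewrite exprS; apply: PM.
Qed.

Lemma poly_fun_eq0 (p : {poly K}) : (forall x, p.[x] = 0) -> p = 0.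
Proof.
move=> p0; apply/eqP; apply: contraT => /closed_nonrootP [x].
by rewrite /root p0 eqxx.
Qed.

Lemma poly_fun_eq (p q : {poly K}) : (forall x, p.[x] = q.[x]) -> p = q.
Proof.
by move=> pq; apply/subr0_eq/poly_fun_eq0 => x; rewrite hornerD hornerN pq subrr.
Qed.

(** Coefficients are compared after an identity has been checked in general points;
    the zeros of the polynomial with coefficients [bs] are the exceptions. *)
Lemma coefs_fun_eq0 (bs cs : seq K) :
    (exists x, horner_rec bs x != 0) ->
    (forall x, horner_rec bs x != 0 -> horner_rec cs x = 0) ->
  forall i, nth 0 cs i = 0.
Proof.
move=> [x0 b0] c0 i.
have hE (s : seq K) x : (Poly s).[x] = horner_rec s x.
  by elim: s => [|a s IH] /=; rewrite ?horner0 // horner_cons IH.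
have: Poly bs * Poly cs = 0.
  apply: poly_fun_eq0 => x; rewrite hornerM !hE.
  by case: (eqVneq (horner_rec bs x) 0) => [->|/c0 ->]; rewrite ?mul0r ?mulr0.
move/eqP; rewrite mulf_eq0 => /orP [] /eqP P0.
  by move: b0; rewrite -hE P0 horner0 eqxx.
by rewrite -coef_Poly P0 coef0.
Qed.

Lemma mpoly_last_var n (p : {mpoly K[n.+1]}) :
  exists q : {poly {mpoly K[n]}}, p = (map_poly (@mwiden n K) q).['X_ord_max].
Proof.
elim/mpoly_gen_ind: p => [c|i|p q [p' ->] [q' ->]|p q [p' ->] [q' ->]].
- by exists c%:MP%:P; rewrite map_polyC hornerC /= mwidenC.
- have [[j ->]|->] : (exists j, i = widen_ord (leqnSn n) j) \/ i = ord_max.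
    have := ltn_ord i; rewrite ltnS leq_eqVlt => /orP [/eqP E|lt].
      by right; apply: val_inj.
    by left; exists (Ordinal lt); apply: val_inj.
  + exists ('X_j)%:P; rewrite map_polyC hornerC /= mwidenX.
    by congr ('X_[_]); rewrite mnmwiden1.
  + by exists 'X; rewrite map_polyX hornerX.
- by exists (p' + q'); rewrite rmorphD /= hornerD.
- by exists (p' * q'); rewrite rmorphM /= hornerM.
Qed.

(** Induction on the number of variables: for fixed values of the others, the
    polynomial in the last variable has infinitely many zeros. *)
Lemma mpoly_fun_eq0 n (p : {mpoly K[n]}) : (forall v, p.@[v] = 0) -> p = 0.
Proof.
elim: n p => [|n IH] p p0.
  have [c Ec] : exists c, p = c%:MP.
    elim/mpoly_gen_ind: {p0} p => [c|[]//|p q [c ->] [d ->]|p q [c ->] [d ->]].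
    - by exists c.
    - by exists (c + d); rewrite mpolyCD.
    - by exists (c * d); rewrite mpolyCM.
  by have := p0 (fun=> 0); rewrite Ec mevalC => ->; rewrite mpolyC0.
have [q Eq] := mpoly_last_var p.
suff q0 : q = 0 by rewrite Eq q0 rmorph0 horner0.
apply/polyP => k; rewrite coef0; apply: IH => v.
have: map_poly (meval v) q = 0.
  apply: poly_fun_eq0 => t.
  pose w i := if unlift ord_max i is Some j then v j else t.
  have wE : forall r : {mpoly K[n]}, (mwiden r).@[w] = r.@[v].
    elim/mpoly_gen_ind => [c|i|a b Ea Eb|a b Ea Eb].
    - by rewrite mwidenC !mevalC.
    - rewrite mwidenX mnmwiden1 !mevalXU /w.
      have -> : widen_ord (leqnSn n) i = lift ord_max i.
        by apply: val_inj; rewrite /= /bump leqNgt ltn_ord.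
      by rewrite liftK.
    - by rewrite mwidenD !mevalD Ea Eb.
    - by rewrite mwidenM !mevalM Ea Eb.
  have <- := p0 w; rewrite Eq -horner_map -map_poly_comp /= mevalXU.
  rewrite {2}/w unlift_none; congr _.[_]; apply: eq_map_poly => r /=.
  by rewrite wE.
by move/(congr1 (fun r : {poly K} => r`_k)); rewrite coef_map coef0.
Qed.

Lemma mpoly_fun_eq n (p q : {mpoly K[n]}) :
  (forall v, p.@[v] = q.@[v]) -> p = q.
Proof.
by move=> pq; apply/subr0_eq/mpoly_fun_eq0 => v; rewrite mevalB pq subrr.
Qed.

End PolynomialFunctions.

(** * Forms on K^4 and their restrictions to lines *)

Section Forms.
Variable K : closedFieldType.
Notation vec := 'rV[K]_4.
Notation form := {mpoly K[4]}.
Implicit Types (g h : form) (u v w p q : vec).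

Lemma evalvD g h v : evalv (g + h) v = evalv g v + evalv h v.
Proof. exact: mevalD. Qed.
Lemma evalvB g h v : evalv (g - h) v = evalv g v - evalv h v.
Proof. exact: mevalB. Qed.
Lemma evalvN g v : evalv (- g) v = - evalv g v.
Proof. exact: mevalN. Qed.
Lemma evalvM g h v : evalv (g * h) v = evalv g v * evalv h v.
Proof. exact: mevalM. Qed.
Lemma evalvC c v : evalv c%:MP v = c :> K.
Proof. exact: mevalC. Qed.
Lemma evalvZ c g v : evalv (c *: g) v = c * evalv g v.
Proof. exact: mevalZ. Qed.
Lemma evalvX g v n : evalv (g ^+ n) v = evalv g v ^+ n.
Proof. exact: rmorphXn. Qed.
Lemma evalv_nat n v : evalv n%:R v = n%:R :> K.
Proof. exact: rmorph_nat. Qed.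
Lemma evalv_prod I (r : seq I) (F : I -> form) v :
  evalv (\prod_(i <- r) F i) v = \prod_(i <- r) evalv (F i) v.
Proof. exact: rmorph_prod. Qed.

Lemma evalv_fun_eq g h : (forall v, evalv g v = evalv h v) -> g = h.
Proof.
move=> gh; apply: mpoly_fun_eq => v.
have := gh (\row_i v i); rewrite /evalv.
by do 2![rewrite (meval_eq (v1 := (\row_i v i) ord0) (v2 := v)); last by move=> i; rewrite mxE].
Qed.

Lemma evalv_lform u v : evalv (lform u) v = \sum_i u ord0 i * v ord0 i.
Proof.
rewrite /evalv /lform raddf_sum; apply: eq_bigr => i _.
by rewrite /= mevalZ mevalXU.
Qed.

Lemma lform_linear a u w : lform (a *: u + w) = a *: lform u + lform w.
Proof.
rewrite /lform scaler_sumr -big_split; apply: eq_bigr => i _.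
by rewrite !mxE scalerDl scalerA.
Qed.
Lemma lformD u w : lform (u + w) = lform u + lform w.
Proof. by have := lform_linear 1 u w; rewrite !scale1r. Qed.
Lemma lform0 : lform (0 : vec) = 0.
Proof. by rewrite /lform big1 // => i _; rewrite mxE scale0r. Qed.
Lemma lformZ a u : lform (a *: u) = a *: lform u.
Proof. by have := lform_linear a u 0; rewrite !addr0 lform0 addr0. Qed.
Lemma lformN u : lform (- u) = - lform u.
Proof. by rewrite -scaleN1r lformZ scaleN1r. Qed.

Lemma lform_sym u v : evalv (lform u) v = evalv (lform v) u.
Proof. by rewrite !evalv_lform; apply: eq_bigr => i _; rewrite mulrC. Qed.
Lemma evalv_lformD u v w :
  evalv (lform u) (v + w) = evalv (lform u) v + evalv (lform u) w.
Proof. by rewrite lform_sym lformD evalvD !(lform_sym u). Qed.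
Lemma evalv_lformZ u a v : evalv (lform u) (a *: v) = a * evalv (lform u) v.
Proof. by rewrite lform_sym lformZ evalvZ lform_sym. Qed.
Lemma evalv_lform0 u : evalv (lform u) 0 = 0.
Proof. by rewrite lform_sym lform0 /evalv meval0. Qed.

Lemma evalv_lform_delta u i : evalv (lform u) (delta_mx ord0 i) = u ord0 i.
Proof.
rewrite evalv_lform (bigD1 i) //= mxE !eqxx mulr1 big1 ?addr0 // => j ji.
by rewrite mxE (negbTE ji) andbF mulr0.
Qed.

Lemma lform_inj u w : (forall v, evalv (lform u) v = evalv (lform w) v) -> u = w.
Proof. by move=> E; apply/rowP => i; rewrite -!evalv_lform_delta E. Qed.

Lemma lform_homog u : lform u \is 1.-homog.
Proof. by apply: rpred_sum => i _; apply: rpredZ; rewrite dhomogX; apply/eqP/mdeg1. Qed.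

Lemma restrD g h p q : restr (g + h) p q = restr g p q + restr h p q.
Proof. exact: mmapD. Qed.
Lemma restrM g h p q : restr (g * h) p q = restr g p q * restr h p q.
Proof. exact: rmorphM. Qed.
Lemma restrC c p q : restr c%:MP p q = c%:P :> {poly K}.
Proof. exact: mmapC. Qed.
Lemma restrXU i p q : restr 'X_i p q = (p ord0 i)%:P + q ord0 i *: 'X.
Proof. by rewrite /restr mmapX mmap1U. Qed.

Lemma restr_horner g p q t : (restr g p q).[t] = evalv g (p + t *: q).
Proof.
elim/mpoly_gen_ind: g => [c|i|g h Eg Eh|g h Eg Eh].
- by rewrite restrC hornerC evalvC.
- rewrite restrXU hornerD hornerC hornerZ hornerX /evalv mevalXU !mxE.
  by rewrite [t * _]mulrC.
- by rewrite restrD hornerD Eg Eh evalvD.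
- by rewrite restrM hornerM Eg Eh evalvM.
Qed.

Lemma restr_fun_eq g p q (P : {poly K}) :
  (forall t, evalv g (p + t *: q) = P.[t]) -> restr g p q = P.
Proof. by move=> E; apply: poly_fun_eq => t; rewrite restr_horner E. Qed.

(** The coefficients along a line are determined by the values, so no polynomial has
    to be expanded. *)
Lemma coef_restr g p q (cs : seq K) :
    (forall t, evalv g (p + t *: q) = horner_rec cs t) ->
  forall i, (restr g p q)`_i = nth 0 cs i.
Proof.
move=> E i; rewrite (@restr_fun_eq _ _ _ (Poly cs)) ?coef_Poly // => t.
by rewrite E; elim: cs {E} => [|a s IH] /=; rewrite ?horner0 // horner_cons IH.
Qed.

Lemma restr_coef0 g p q : (restr g p q)`_0 = evalv g p.
Proof. by rewrite -horner_coef0 restr_horner scale0r addr0. Qed.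

Lemma dvdXn_coef (P : {poly K}) k :
  ('X^k %| P)%R <-> forall i, (i < k)%N -> P`_i = 0.
Proof.
split=> [/dvdpP [Q ->] i ik|P0]; first by rewrite coefMXn ik.
apply/dvdpP; exists (drop_poly k P); rewrite -[LHS](poly_take_drop k).
suff -> : take_poly k P = 0 by rewrite add0r.
by apply/polyP => i; rewrite coef_take_poly coef0; case: ifP => // /P0.
Qed.

(** The directional derivative; read off from the restriction to a line it satisfies
    the Leibniz rule without reference to the partial derivatives. *)
Definition dird g p q : K := (restr g p q)`_1.

Lemma dirdD g h p q : dird (g + h) p q = dird g p q + dird h p q.
Proof. by rewrite /dird restrD coefD. Qed.
Lemma dirdC c p q : dird c%:MP p q = 0.
Proof. by rewrite /dird restrC coefC. Qed.
Lemma dirdM g h p q :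
  dird (g * h) p q = dird g p q * evalv h p + evalv g p * dird h p q.
Proof.
rewrite /dird restrM coefM !big_ord_recl big_ord0 /= !restr_coef0 addr0.
by rewrite addrC.
Qed.
Lemma dird_lform u p q : dird (lform u) p q = evalv (lform u) q.
Proof.
by rewrite /dird (@coef_restr _ _ _ [:: evalv (lform u) p; evalv (lform u) q]) //
  => t /=; rewrite evalv_lformD evalv_lformZ; ring.
Qed.

Lemma dird_mderiv g v w :
  \sum_i w ord0 i * evalv (mderiv i g) v = dird g v w.
Proof.
elim/mpoly_gen_ind: g => [c|j|g h Eg Eh|g h Eg Eh].
- by rewrite dirdC big1 // => i _; rewrite mderivC /evalv meval0 mulr0.
- rewrite /dird restrXU coefD coefC coefZ coefX mulr1 add0r.
  rewrite (bigD1 j) //= big1 ?addr0 => [|i ij].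
    have U0 : (U_(j) - U_(j))%MM = 0%MM by apply/mnmP => k; rewrite mnmBE subnn mnm0E.
    by rewrite mderivX mnmE eqxx scale1r U0 mpolyX0 /evalv meval1 mulr1.
  by rewrite mderivX mnmE eq_sym (negbTE ij) scale0r /evalv meval0 mulr0.
- rewrite dirdD -Eg -Eh -big_split; apply: eq_bigr => i _.
  by rewrite mderivD evalvD mulrDr.
- rewrite dirdM -Eg -Eh mulr_suml mulr_sumr -big_split; apply: eq_bigr => i _ /=.
  by rewrite mderivM evalvD !evalvM; ring.
Qed.

Lemma dird_directionD g v u w : dird g v (u + w) = dird g v u + dird g v w.
Proof.
rewrite -!dird_mderiv -big_split; apply: eq_bigr => i _.
by rewrite mxE mulrDl.
Qed.
Lemma dird_directionZ g v a w : dird g v (a *: w) = a * dird g v w.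
Proof.
rewrite -!dird_mderiv mulr_sumr; apply: eq_bigr => i _.
by rewrite mxE mulrA.
Qed.

Lemma dird_mderiv_delta g v i : dird g v (delta_mx ord0 i) = evalv (mderiv i g) v.
Proof.
rewrite -dird_mderiv (bigD1 i) //= mxE !eqxx mul1r big1 ?addr0 // => j ji.
by rewrite mxE (negbTE ji) andbF mul0r.
Qed.

Lemma sing_pointP g v :
  sing_point g v <-> [/\ v <> 0, evalv g v = 0 & forall w, dird g v w = 0].
Proof.
split=> [[v0 gv dg]|[v0 gv dg]]; split=> // w.
  by rewrite -dird_mderiv big1 // => i _; rewrite dg mulr0.
by rewrite -dird_mderiv_delta.
Qed.

Lemma tangent_planeE g p w : evalv (lform (tangent_plane g p)) w = dird g p w.
Proof.
by rewrite evalv_lform -dird_mderiv; apply: eq_bigr => i _; rewrite mxE mulrC.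
Qed.

(** Substituting a linear projection onto a plane in a form changes it by a multiple
    of the equation of the plane.  Hence this equation is prime and divides the
    forms that vanish on the plane. *)
Lemma plane_projection u : u != 0 ->
  exists s : 4.-tuple form,
    (forall v, evalv (lform u) (\row_i evalv (tnth s i) v) = 0) /\
    (forall g, exists q : form, g = (g \mPo s) + lform u * q).
Proof.
case/rV0Pn => k uk.
pose s := [tuple 'X_i - (if i == k then (u ord0 k)^-1 else 0) *: lform u | i < 4].
exists s; split=> [v|].
  rewrite evalv_lform.
  under eq_bigr => i _ do rewrite mxE tnth_mktuple evalvB evalvZ mulrBr /evalv mevalXU.
  rewrite big_split /= -(evalv_lform u v) (bigD1 k) //= eqxx big1 => [|i /negbTE ->].
    by rewrite addr0 mulrA divff // mul1r subrr.
  by rewrite mul0r mulr0 oppr0.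
elim/mpoly_gen_ind => [c|i|g h [a Ea] [b Eb]|g h [a Ea] [b Eb]].
- by exists 0; rewrite comp_mpolyC mulr0 addr0.
- exists (if i == k then (u ord0 k)^-1 else 0)%:MP.
  by rewrite comp_mpolyXU -tnth_nth tnth_mktuple mulrC mul_mpolyC subrK.
- by exists (a + b); rewrite {1}Ea {1}Eb comp_mpolyD mulrDr; ring.
- exists ((g \mPo s) * b + a * h); rewrite rmorphM /=.
  move: (g \mPo s) (h \mPo s) Ea Eb => g' h' -> ->; ring.
Qed.

Lemma lform_dvd u g : u != 0 ->
  (forall v, evalv (lform u) v = 0 -> evalv g v = 0) -> exists q : form, g = lform u * q.
Proof.
move=> /plane_projection [s [su sg]] g0.
have [q Eq] := sg g; exists q; rewrite {1}Eq.
suff -> : g \mPo s = 0 by rewrite add0r.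
apply: evalv_fun_eq => v; rewrite /evalv comp_mpoly_meval meval0.
rewrite -(g0 _ (su v)) /evalv; apply: meval_eq => i; rewrite mxE.
by apply: meval_eq.
Qed.

Lemma lform_prime u g h (q : form) : u != 0 -> g * h = lform u * q ->
  (exists a, g = lform u * a) \/ (exists a, h = lform u * a).
Proof.
move=> /plane_projection [s [su sg]] E.
have us : lform u \mPo s = 0.
  apply: evalv_fun_eq => v; rewrite /evalv comp_mpoly_meval meval0 -(su v).
  by apply: meval_eq => i; rewrite mxE.
have /eqP : (g \mPo s) * (h \mPo s) = 0 by rewrite -rmorphM E rmorphM /= us mul0r.
rewrite mulf_eq0 => /orP [] /eqP E0; [left; have [a ->] := sg g|right; have [a ->] := sg h];
  by exists a; rewrite E0 add0r.
Qed.

Lemma homog_split d g : g \is d.+1.-homog ->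
  exists2 h : 'I_4 -> form, forall i, h i \is d.-homog & g = \sum_i 'X_i * h i.
Proof.
move=> gh; rewrite [g]mpolyE big_seq.
pose Q x := exists2 h : 'I_4 -> form, forall i, h i \is d.-homog & x = \sum_i 'X_i * h i.
apply: (big_rec Q) => [|m x mg [h hh ->]].
  by exists (fun=> 0) => [i|]; rewrite ?dhomog0 // big1 // => i _; rewrite mulr0.
have md : mdeg m = d.+1 := dhomog_mf gh mg.
have [i mi] : exists i, m i != 0%N.
  apply/existsP; apply: contraT; rewrite negb_exists => /forallP m0.
  move: md; rewrite mdegE big1 // => i _; apply/eqP; have := m0 i; by rewrite negbK.
have mE : m = (U_(i) + (m - U_(i)))%MM.
  apply/mnmP => j; rewrite mnmDE mnmBE mnm1E addnC.
  by case: eqP => [<-|_]; rewrite ?subnK ?lt0n // subn0 addn0.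
exists (fun j => (if j == i then g@_m *: 'X_[m - U_(i)] else 0) + h j) => [j|].
  apply: rpredD => //; case: eqP => _; rewrite ?dhomog0 //.
  by apply: rpredZ; rewrite dhomogX /=; move: md; rewrite {1}mE /= mdegD mdeg1 add1n => -[->].
under [RHS]eq_bigr => j _ do rewrite mulrDr.
rewrite big_split /= [X in _ = X + _](bigD1 i) //= eqxx [X in _ = _ + X + _]big1 ?addr0 => [|j /negbTE ->]; last by rewrite mulr0.
by rewrite -scalerAr -mpolyXD -mE.
Qed.

Lemma homog0_const g : g \is 0.-homog -> exists c, g = c%:MP.
Proof.
move=> /dhomog_mf gh; exists g@_0; apply/mpolyP => m; rewrite mcoeffC.
have [<-|m0] := eqVneq 0%MM m; first by rewrite mulr1.
rewrite mulr0; apply: memN_msupp_eq0; apply: contra m0 => /gh /= /eqP.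
by rewrite mdeg_eq0 eq_sym.
Qed.

End Forms.

(** * Lines and coordinate systems *)

Section Lines.
Variable K : closedFieldType.
Notation vec := 'rV[K]_4.
Implicit Types (p q v : vec) (m l : {vspace vec}).

Lemma mem_span2 p q v :
  (v \in (<[p]> + <[q]>)%VS) <-> exists a b, v = a *: p + b *: q.
Proof.
split=> [/memv_addP [x /vlineP [a ->] [y /vlineP [b ->] ->]]|[a [b ->]]].
  by exists a, b.
by apply: memv_add; apply/vlineP; eexists.
Qed.

Lemma span2_left p q : p \in (<[p]> + <[q]>)%VS.
Proof. by apply/mem_span2; exists 1, 0; rewrite scale1r scale0r addr0. Qed.

Lemma span2_right p q : q \in (<[p]> + <[q]>)%VS.
Proof. by apply/mem_span2; exists 0, 1; rewrite scale1r scale0r add0r. Qed.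

Lemma span2_line p q : p <> 0 -> q \notin <[p]>%VS -> is_line (<[p]> + <[q]>)%VS.
Proof.
move=> /eqP p0 qp; rewrite /is_line dimv_disjoint_sum.
  rewrite !dim_vline p0; suff -> : q != 0 by [].
  by apply: contraNneq qp => ->; rewrite mem0v.
apply/eqP; rewrite -subv0; apply/subvP => v /memv_capP [/vlineP [a ->] /vlineP [b E]].
have [b0|b0] := eqVneq b 0; first by rewrite E b0 scale0r mem0v.
case/negP: qp; apply/vlineP; exists (b^-1 * a).
by rewrite -scalerA E scalerA mulVf // scale1r.
Qed.

Lemma line_eq_span2 m p q : is_line m -> p <> 0 -> q \notin <[p]>%VS ->
  p \in m -> q \in m -> m = (<[p]> + <[q]>)%VS.
Proof.
move=> dm p0 qp pm qm; apply/esym/eqP; rewrite eqEdim; apply/andP; split.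
  by rewrite subv_add -!memvE pm qm.
by rewrite dm (span2_line p0 qp).
Qed.

Lemma line_other_point m p : is_line m -> p \in m -> exists2 q, q \in m & q \notin <[p]>%VS.
Proof.
move=> dm pm; have : ~~ (m <= <[p]>)%VS.
  by apply/negP => /dimvS; rewrite dm dim_vline; case: (p != 0).
by move/subvPn.
Qed.

Lemma line_other_line_point m l : is_line m -> is_line l -> m <> l ->
  exists2 q, q \in m & q \notin l.
Proof.
move=> dm dl ml; have : ~~ (m <= l)%VS.
  by apply/negP => s; apply: ml; apply/eqP; rewrite eqEdim s dm dl.
by move/subvPn.
Qed.

Lemma vline_eqP p q : q <> 0 ->
  (<[p]>%VS = <[q]>%VS) <-> exists2 c, c != 0 & p = c *: q.
Proof.
move=> q0; split=> [E|[c c0 ->]].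
  have /vlineP [c Ec] : p \in <[q]>%VS by rewrite -E memv_line.
  exists c => //; apply: contra_not_neq q0 => c0.
  have /vlineP [k ->] : q \in <[p]>%VS by rewrite E memv_line.
  by rewrite Ec c0 scale0r scaler0.
apply/eqP; rewrite eqEsubv -!memvE; apply/andP; split; apply/vlineP.
  by exists c.
by exists c^-1; rewrite scalerA mulVf // scale1r.
Qed.

Lemma meets_point m l : meets m l -> exists p, [/\ p <> 0, p \in m & p \in l].
Proof.
move=> [_ /eqP ml]; exists (vpick (m :&: l)%VS).
have := memv_pick (m :&: l)%VS; rewrite memv_cap => /andP [-> ->].
by split=> //; apply/eqP; rewrite vpick0.
Qed.

Lemma point_meets m l p : m <> l -> p <> 0 -> p \in m -> p \in l -> meets m l.
Proof.
move=> ml p0 pm pl; split=> // E; apply: p0; apply/eqP.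
by rewrite -memv0 -E memv_cap pm.
Qed.

End Lines.

Section Charts.
Variable K : closedFieldType.
Notation vec := 'rV[K]_4.
Notation form := {mpoly K[4]}.

Definition row4 (x0 x1 x2 x3 : K) : vec := \row_i [:: x0; x1; x2; x3]`_i.

(** The rows of [B] are the basis vectors, so [B] acts on rows of coordinates from
    the right. *)
Definition pt (B : 'M[K]_4) x0 x1 x2 x3 : vec := row4 x0 x1 x2 x3 *m B.

Definition o0 : 'I_4 := Ordinal (isT : (0 < 4)%N).
Definition o1 : 'I_4 := Ordinal (isT : (1 < 4)%N).
Definition o2 : 'I_4 := Ordinal (isT : (2 < 4)%N).
Definition o3 : 'I_4 := Ordinal (isT : (3 < 4)%N).

(** The dual basis, under the identification of planes with their coefficient rows. *)
Definition covec (B : 'M[K]_4) i : vec := (col i (invmx B))^T.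

(** The coordinate functions of the basis. *)
Definition X (B : 'M[K]_4) i : form := lform (covec B i).

Lemma big_ord4 (V : zmodType) (F : 'I_4 -> V) : \sum_i F i = F o0 + F o1 + F o2 + F o3.
Proof.
rewrite !big_ord_recl big_ord0 addr0 !addrA; congr (F _ + F _ + F _ + F _);
  by apply: val_inj.
Qed.

Lemma ord4P (P : 'I_4 -> Prop) : P o0 -> P o1 -> P o2 -> P o3 -> forall i, P i.
Proof.
move=> P0 P1 P2 P3 [[|[|[|[|i]]]] lt] //.
- by rewrite (_ : Ordinal lt = o0) //; apply: val_inj.
- by rewrite (_ : Ordinal lt = o1) //; apply: val_inj.
- by rewrite (_ : Ordinal lt = o2) //; apply: val_inj.
- by rewrite (_ : Ordinal lt = o3) //; apply: val_inj.
Qed.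

Lemma row4_eta (v : vec) : v = row4 (v ord0 o0) (v ord0 o1) (v ord0 o2) (v ord0 o3).
Proof. by apply/rowP; apply: ord4P; rewrite mxE. Qed.

Lemma row4D x0 x1 x2 x3 y0 y1 y2 y3 :
  row4 x0 x1 x2 x3 + row4 y0 y1 y2 y3 = row4 (x0 + y0) (x1 + y1) (x2 + y2) (x3 + y3).
Proof. by apply/rowP; apply: ord4P; rewrite !mxE. Qed.

Lemma row4Z c x0 x1 x2 x3 : c *: row4 x0 x1 x2 x3 = row4 (c * x0) (c * x1) (c * x2) (c * x3).
Proof. by apply/rowP; apply: ord4P; rewrite !mxE. Qed.

Variable B : 'M[K]_4.

Lemma ptD x0 x1 x2 x3 y0 y1 y2 y3 :
  pt B x0 x1 x2 x3 + pt B y0 y1 y2 y3 = pt B (x0 + y0) (x1 + y1) (x2 + y2) (x3 + y3).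
Proof. by rewrite /pt -mulmxDl row4D. Qed.

Lemma ptZ c x0 x1 x2 x3 : c *: pt B x0 x1 x2 x3 = pt B (c * x0) (c * x1) (c * x2) (c * x3).
Proof. by rewrite /pt scalemxAl row4Z. Qed.

Lemma pt0 : pt B 0 0 0 0 = 0.
Proof. by have := ptZ 0 0 0 0 0; rewrite scale0r !mul0r => <-. Qed.

Lemma evalv_X i v : evalv (X B i) v = (v *m invmx B) ord0 i.
Proof.
by rewrite evalv_lform mxE; apply: eq_bigr => j _; rewrite !mxE mulrC.
Qed.

Hypothesis Bu : B \in unitmx.

Lemma X_pt x0 x1 x2 x3 i : evalv (X B i) (pt B x0 x1 x2 x3) = [:: x0; x1; x2; x3]`_i.
Proof. by rewrite evalv_X mulmxK // mxE. Qed.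

Lemma X0_pt x0 x1 x2 x3 : evalv (X B o0) (pt B x0 x1 x2 x3) = x0.
Proof. exact: X_pt. Qed.
Lemma X1_pt x0 x1 x2 x3 : evalv (X B o1) (pt B x0 x1 x2 x3) = x1.
Proof. exact: X_pt. Qed.
Lemma X2_pt x0 x1 x2 x3 : evalv (X B o2) (pt B x0 x1 x2 x3) = x2.
Proof. exact: X_pt. Qed.
Lemma X3_pt x0 x1 x2 x3 : evalv (X B o3) (pt B x0 x1 x2 x3) = x3.
Proof. exact: X_pt. Qed.
Definition Xpt := (X0_pt, X1_pt, X2_pt, X3_pt).

Lemma ptE v : exists x0 x1 x2 x3, v = pt B x0 x1 x2 x3.
Proof.
pose y := v *m invmx B; exists (y ord0 o0), (y ord0 o1), (y ord0 o2), (y ord0 o3).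
by rewrite /pt -row4_eta mulmxKV.
Qed.

Lemma pt_inj x0 x1 x2 x3 y0 y1 y2 y3 :
  pt B x0 x1 x2 x3 = pt B y0 y1 y2 y3 -> [/\ x0 = y0, x1 = y1, x2 = y2 & x3 = y3].
Proof.
move=> E; have H i := congr1 (evalv (X B i)) E.
by have := (H o0, H o1, H o2, H o3); rewrite !Xpt => -[[[-> ->] ->] ->].
Qed.

Lemma pt_eq0 x0 x1 x2 x3 :
  pt B x0 x1 x2 x3 = 0 <-> [/\ x0 = 0, x1 = 0, x2 = 0 & x3 = 0].
Proof.
split=> [|[-> -> -> ->]]; last exact: pt0.
by rewrite -pt0; apply: pt_inj.
Qed.

Lemma covec_decomp u : u = \sum_i evalv (lform u) (row i B) *: covec B i.
Proof.
apply: lform_inj => v; have [x0 [x1 [x2 [x3 ->]]]] := ptE v.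
have E : pt B x0 x1 x2 x3 = \sum_(i < 4) [:: x0; x1; x2; x3]`_i *: row i B.
  by rewrite /pt mulmx_sum_row; apply: eq_bigr => i _; rewrite mxE.
rewrite {1}E lform_sym [RHS]lform_sym [in RHS]lform_sym !big_ord4 !lformD !evalvD !lformZ !evalvZ.
rewrite -!/(X _ _) !Xpt /= !(lform_sym (row _ _)); ring.
Qed.

Lemma row_pt : (row o0 B = pt B 1 0 0 0) * (row o1 B = pt B 0 1 0 0) *
  (row o2 B = pt B 0 0 1 0) * (row o3 B = pt B 0 0 0 1).
Proof.
have E i x0 x1 x2 x3 : (forall j, [:: x0; x1; x2; x3]`_(nat_of_ord j) = (i == j)%:R) ->
    row i B = pt B x0 x1 x2 x3.
  move=> H; rewrite rowE /pt; congr (_ *m _); apply/rowP => j.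
  by rewrite !mxE H eq_sym.
by do !split; apply: E; apply: ord4P.
Qed.

End Charts.

(** * Coordinates adapted to the line *)

Section AdaptedCharts.
Variable K : closedFieldType.
Notation vec := 'rV[K]_4.
Notation form := {mpoly K[4]}.
Implicit Types (l : {vspace vec}) (B : 'M[K]_4).

Definition chart_of l B : Prop :=
  B \in unitmx /\
  forall x0 x1 x2 x3, pt B x0 x1 x2 x3 \in l <-> x2 = 0 /\ x3 = 0.

(** Generating rows suffice, because a surjective square matrix is invertible. *)
Lemma basis_chart (r0 r1 r2 r3 : vec) :
    (forall v, exists x0 x1 x2 x3, v = x0 *: r0 + x1 *: r1 + x2 *: r2 + x3 *: r3) ->
  exists2 B, B \in unitmx &
    forall x0 x1 x2 x3, pt B x0 x1 x2 x3 = x0 *: r0 + x1 *: r1 + x2 *: r2 + x3 *: r3.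
Proof.
move=> surj; pose B : 'M[K]_4 := \matrix_(i < 4) [:: r0; r1; r2; r3]`_i.
have ptB x0 x1 x2 x3 : pt B x0 x1 x2 x3 = x0 *: r0 + x1 *: r1 + x2 *: r2 + x3 *: r3.
  by rewrite /pt mulmx_sum_row big_ord4 !rowK !mxE.
exists B => //; rewrite -row_full_unit -sub1mx; apply/row_subP => i.
have [x0 [x1 [x2 [x3 E]]]] := surj (row i 1%:M).
by rewrite E -ptB submxMl.
Qed.

Lemma chart_of_line l (b0 b1 : vec) : is_line l ->
    b0 <> 0 -> b1 \notin <[b0]>%VS -> b0 \in l -> b1 \in l ->
  exists B, [/\ chart_of l B, pt B 1 0 0 0 = b0 & pt B 0 1 0 0 = b1].
Proof.
move=> dl b00 b10 b0l b1l; have lE := line_eq_span2 dl b00 b10 b0l b1l.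
have dC : is_line (l^C)%VS.
  by rewrite /is_line dimv_compl dimvf /dim /= mul1n dl.
have [c0 [c0C c0n]] : exists c, c \in (l^C)%VS /\ c <> 0.
  exists (vpick (l^C)%VS); split; first exact: memv_pick.
  by apply/eqP; rewrite vpick0 -dimv_eq0 dC.
have [c1 c1C c1n] := line_other_point dC c0C.
have cE := line_eq_span2 dC c0n c1n c0C c1C.
have dec v : exists x0 x1 x2 x3, v = x0 *: b0 + x1 *: b1 + x2 *: c0 + x3 *: c1.
  have : v \in (l + l^C)%VS by rewrite addv_complf memvf.
  case/memv_addP => [v1 v1l [v2 v2l ->]].
  move: v1l v2l; rewrite {1}lE cE => /mem_span2 [x0 [x1 ->]] /mem_span2 [x2 [x3 ->]].
  by exists x0, x1, x2, x3; rewrite !addrA.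
have [B Bu ptB] := basis_chart dec; exists B; split.
- split=> // x0 x1 x2 x3; split=> [|[-> ->]]; last first.
    by rewrite ptB !scale0r !addr0 rpredD // rpredZ.
  rewrite ptB -addrA rpredDl; last by rewrite rpredD // rpredZ.
  move=> xl.
  have : x2 *: c0 + x3 *: c1 \in (l :&: l^C)%VS by rewrite memv_cap xl rpredD // rpredZ.
  rewrite capv_compl memv0 => /eqP E.
  have : pt B 0 0 x2 x3 = 0 by rewrite ptB !scale0r !add0r.
  by case/(pt_eq0 Bu).
- by rewrite ptB !scale0r !addr0 scale1r.
- by rewrite ptB !scale0r !addr0 add0r scale1r.
Qed.

(** The coefficients [k] normalize the pencil of planes through [l]; the others
    translate [x0], [x1] by linear forms in [x2], [x3]. *)
Lemma chart_change l B a2 a3 c2 c3 k22 k23 k32 k33 : chart_of l B ->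
    k22 * k33 - k23 * k32 != 0 ->
  exists2 B', chart_of l B' & forall x0 x1 x2 x3,
    pt B' x0 x1 x2 x3 = pt B (x0 + (a2 * x2 + a3 * x3)) (x1 + (c2 * x2 + c3 * x3))
      (k22 * x2 + k23 * x3) (k32 * x2 + k33 * x3).
Proof.
move=> [Bu lB] d0; set d := _ - _ in d0.
have [|B' B'u ptB'] := @basis_chart (pt B 1 0 0 0) (pt B 0 1 0 0)
    (pt B a2 c2 k22 k32) (pt B a3 c3 k23 k33).
  move=> v; have [x0 [x1 [x2 [x3 ->]]]] := ptE Bu v.
  pose y2 := d^-1 * (k33 * x2 - k23 * x3); pose y3 := d^-1 * (k22 * x3 - k32 * x2).
  exists (x0 - (a2 * y2 + a3 * y3)), (x1 - (c2 * y2 + c3 * y3)), y2, y3.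
  have E2 : x2 = k22 * y2 + k23 * y3 by rewrite /y2 /y3 /d; field; exact: d0.
  have E3 : x3 = k32 * y2 + k33 * y3 by rewrite /y2 /y3 /d; field; exact: d0.
  by rewrite {1}E2 {1}E3 !ptZ !ptD; congr (pt B _ _ _ _); ring.
have E x0 x1 x2 x3 : pt B' x0 x1 x2 x3 =
    pt B (x0 + (a2 * x2 + a3 * x3)) (x1 + (c2 * x2 + c3 * x3))
      (k22 * x2 + k23 * x3) (k32 * x2 + k33 * x3).
  by rewrite ptB' !ptZ !ptD; congr (pt B _ _ _ _); ring.
exists B' => //; split=> // x0 x1 x2 x3; rewrite E lB; split=> [[E2 E3]|[-> ->]].
  have H2 : d * x2 = k33 * (k22 * x2 + k23 * x3) - k23 * (k32 * x2 + k33 * x3).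
    by rewrite /d; ring.
  have H3 : d * x3 = k22 * (k32 * x2 + k33 * x3) - k32 * (k22 * x2 + k23 * x3).
    by rewrite /d; ring.
  move: H2 H3; rewrite E2 E3 !mulr0 subr0 => /eqP H2 /eqP H3.
  by move: H2 H3; rewrite !mulf_eq0 (negbTE d0) /= => /eqP -> /eqP ->.
by rewrite !mulr0 !addr0.
Qed.

Lemma homog_split_chart B d (g : form) : B \in unitmx -> g \is d.+1.-homog ->
  exists2 h : 'I_4 -> form, forall i, h i \is d.-homog &
    forall x0 x1 x2 x3, let v := pt B x0 x1 x2 x3 in
    evalv g v = x0 * evalv (h o0) v + x1 * evalv (h o1) v
              + x2 * evalv (h o2) v + x3 * evalv (h o3) v.
Proof.
move=> Bu /homog_split [h hh ->].
exists (fun j => \sum_i B j i *: h i) => [j|x0 x1 x2 x3 /=].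
  by apply: rpred_sum => i _; exact/rpredZ/hh.
set v := pt _ _ _ _ _.
have vE i : v ord0 i = x0 * B o0 i + x1 * B o1 i + x2 * B o2 i + x3 * B o3 i.
  by rewrite /v /pt mxE big_ord4 !mxE.
rewrite !big_ord4 !evalvD !evalvM !evalvZ.
have XE i : evalv 'X_i v = v ord0 i by rewrite /evalv mevalXU.
by rewrite !XE !vE; ring.
Qed.

Lemma expand0 B (g : form) : g \is 0.-homog ->
  exists c : nat -> K, forall x0 x1 x2 x3, evalv g (pt B x0 x1 x2 x3) = c 0%N.
Proof.
by move=> /homog0_const [c ->]; exists (fun=> c) => x0 x1 x2 x3; rewrite evalvC.
Qed.

Lemma expand1 B (g : form) : B \in unitmx -> g \is 1.-homog ->
  exists c : nat -> K, forall x0 x1 x2 x3, evalv g (pt B x0 x1 x2 x3) =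
    c 0%N * x0 + c 1%N * x1 + c 2%N * x2 + c 3%N * x3.
Proof.
move=> Bu /(homog_split_chart Bu) [h hh Eg].
have H i := expand0 B (hh i).
have [a Ea] := H o0; have [b Eb] := H o1; have [c Ec] := H o2; have [d Ed] := H o3.
exists (nth 0 [:: a 0%N; b 0%N; c 0%N; d 0%N]) => x0 x1 x2 x3 /=.
by rewrite Eg Ea Eb Ec Ed; ring.
Qed.

Lemma expand2 B (g : form) : B \in unitmx -> g \is 2.-homog ->
  exists c : nat -> K, forall x0 x1 x2 x3, evalv g (pt B x0 x1 x2 x3) =
    c 0%N * x0 ^+ 2 + c 1%N * x0 * x1 + c 2%N * x1 ^+ 2
    + (c 3%N * x0 + c 4%N * x1) * x2 + (c 5%N * x0 + c 6%N * x1) * x3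
    + (c 7%N * x2 ^+ 2 + c 8%N * x2 * x3 + c 9%N * x3 ^+ 2).
Proof.
move=> Bu /(homog_split_chart Bu) [h hh Eg].
have H i := expand1 Bu (hh i).
have [a Ea] := H o0; have [b Eb] := H o1; have [c Ec] := H o2; have [d Ed] := H o3.
exists (nth 0 [:: a 0%N; a 1%N + b 0%N; b 1%N; a 2%N + c 0%N; b 2%N + c 1%N;
   a 3%N + d 0%N; b 3%N + d 1%N; c 2%N; c 3%N + d 2%N; d 3%N]) => x0 x1 x2 x3 /=.
by rewrite Eg Ea Eb Ec Ed; ring.
Qed.

Lemma expand3 B (g : form) : B \in unitmx -> g \is 3.-homog ->
  exists c : nat -> K, forall x0 x1 x2 x3, evalv g (pt B x0 x1 x2 x3) =
    c 0%N * x0 ^+ 3 + c 1%N * x0 ^+ 2 * x1 + c 2%N * x0 * x1 ^+ 2 + c 3%N * x1 ^+ 3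
    + (c 4%N * x0 ^+ 2 + c 5%N * x0 * x1 + c 6%N * x1 ^+ 2) * x2
    + (c 7%N * x0 ^+ 2 + c 8%N * x0 * x1 + c 9%N * x1 ^+ 2) * x3
    + (c 10%N * x2 ^+ 2 + c 11%N * x2 * x3 + c 12%N * x3 ^+ 2) * x0
    + (c 13%N * x2 ^+ 2 + c 14%N * x2 * x3 + c 15%N * x3 ^+ 2) * x1
    + (c 16%N * x2 ^+ 3 + c 17%N * x2 ^+ 2 * x3 + c 18%N * x2 * x3 ^+ 2 + c 19%N * x3 ^+ 3).
Proof.
move=> Bu /(homog_split_chart Bu) [h hh Eg].
have H i := expand2 Bu (hh i).
have [a Ea] := H o0; have [b Eb] := H o1; have [c Ec] := H o2; have [d Ed] := H o3.
exists (nth 0 [:: a 0%N; a 1%N + b 0%N; a 2%N + b 1%N; b 2%N;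
   a 3%N + c 0%N; a 4%N + b 3%N + c 1%N; b 4%N + c 2%N;
   a 5%N + d 0%N; a 6%N + b 5%N + d 1%N; b 6%N + d 2%N;
   a 7%N + c 3%N; a 8%N + c 5%N + d 3%N; a 9%N + d 5%N;
   b 7%N + c 4%N; b 8%N + c 6%N + d 4%N; b 9%N + d 6%N;
   c 7%N; c 8%N + d 7%N; c 9%N + d 8%N; d 9%N]) => x0 x1 x2 x3 /=.
by rewrite Eg Ea Eb Ec Ed; ring.
Qed.

(** A quartic containing [l] is the sum of a part linear in [x2], [x3] and of these
    parts of degree 2, 3 and 4 in [s = x2], [t = x3]. *)
Definition qform (R : comNzRingType) (q : nat -> R) s t x0 x1 :=
  (q 0%N * s ^+ 2 + q 1%N * s * t + q 2%N * t ^+ 2) * x0 ^+ 2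
  + (q 3%N * s ^+ 2 + q 4%N * s * t + q 5%N * t ^+ 2) * x0 * x1
  + (q 6%N * s ^+ 2 + q 7%N * s * t + q 8%N * t ^+ 2) * x1 ^+ 2.

Definition rform (R : comNzRingType) (r : nat -> R) s t x0 x1 :=
  (r 0%N * s ^+ 3 + r 1%N * s ^+ 2 * t + r 2%N * s * t ^+ 2 + r 3%N * t ^+ 3) * x0
  + (r 4%N * s ^+ 3 + r 5%N * s ^+ 2 * t + r 6%N * s * t ^+ 2 + r 7%N * t ^+ 3) * x1.

Definition gform (R : comNzRingType) (g : nat -> R) s t :=
  g 0%N * s ^+ 4 + g 1%N * s ^+ 3 * t + g 2%N * s ^+ 2 * t ^+ 2
  + g 3%N * s * t ^+ 3 + g 4%N * t ^+ 4.

Lemma expand4 l B (f : form) : chart_of l B -> f \is 4.-homog -> in_surface l f ->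
  exists a q r g : nat -> K, forall x0 x1 x2 x3, evalv f (pt B x0 x1 x2 x3) =
    (a 0%N * x0 ^+ 3 + a 1%N * x0 ^+ 2 * x1 + a 2%N * x0 * x1 ^+ 2 + a 3%N * x1 ^+ 3) * x2
    + (a 4%N * x0 ^+ 3 + a 5%N * x0 ^+ 2 * x1 + a 6%N * x0 * x1 ^+ 2 + a 7%N * x1 ^+ 3) * x3
    + qform q x2 x3 x0 x1 + rform r x2 x3 x0 x1 + gform g x2 x3.
Proof.
move=> [Bu lB] fh lf; have [h hh Eg] := homog_split_chart Bu fh.
have H i := expand3 Bu (hh i).
have [a Ea] := H o0; have [b Eb] := H o1; have [c Ec] := H o2; have [d Ed] := H o3.
exists (nth 0 [:: a 4%N + c 0%N; a 5%N + b 4%N + c 1%N; a 6%N + b 5%N + c 2%N; b 6%N + c 3%N;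
   a 7%N + d 0%N; a 8%N + b 7%N + d 1%N; a 9%N + b 8%N + d 2%N; b 9%N + d 3%N]).
exists (nth 0 [:: a 10%N + c 4%N; a 11%N + c 7%N + d 4%N; a 12%N + d 7%N;
   a 13%N + b 10%N + c 5%N; a 14%N + b 11%N + c 8%N + d 5%N; a 15%N + b 12%N + d 8%N;
   b 13%N + c 6%N; b 14%N + c 9%N + d 6%N; b 15%N + d 9%N]).
exists (nth 0 [:: a 16%N + c 10%N; a 17%N + c 11%N + d 10%N; a 18%N + c 12%N + d 11%N; a 19%N + d 12%N;
   b 16%N + c 13%N; b 17%N + c 14%N + d 13%N; b 18%N + c 15%N + d 14%N; b 19%N + d 15%N]).
exists (nth 0 [:: c 16%N; c 17%N + d 16%N; c 18%N + d 17%N; c 19%N + d 18%N; d 19%N]).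
move=> x0 x1 x2 x3.
have : evalv f (pt B x0 x1 0 0) = 0 by apply: lf; apply/lB.
rewrite Eg Ea Eb => E0.
rewrite Eg Ea Eb Ec Ed -[RHS]addr0 -[X in _ = _ + X]E0 /qform /rform /gform /=; ring.
Qed.

End AdaptedCharts.

(** * The residual cubics *)

Section Cubics.
Variables (R : comNzRingType) (q r g : nat -> R).

Definition quartic x0 x1 x2 x3 :=
  x1 ^+ 3 * x2 + (x0 ^+ 3 - 3 * x0 * x1 ^+ 2) * x3
  + qform q x2 x3 x0 x1 + rform r x2 x3 x0 x1 + gform g x2 x3.

(** The residual cubic in the plane (s : t), at the point with coordinates
    [(x0, x1, z * s, z * t)]. *)
Definition fibc s t x0 x1 z :=
  s * x1 ^+ 3 + t * (x0 ^+ 3 - 3 * x0 * x1 ^+ 2)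
  + z * qform q s t x0 x1 + z ^+ 2 * rform r s t x0 x1 + z ^+ 3 * gform g s t.

Definition qform0 s t x0 x1 :=
  2 * (q 0%N * s ^+ 2 + q 1%N * s * t + q 2%N * t ^+ 2) * x0
  + (q 3%N * s ^+ 2 + q 4%N * s * t + q 5%N * t ^+ 2) * x1.
Definition qform1 s t x0 x1 :=
  (q 3%N * s ^+ 2 + q 4%N * s * t + q 5%N * t ^+ 2) * x0
  + 2 * (q 6%N * s ^+ 2 + q 7%N * s * t + q 8%N * t ^+ 2) * x1.

Definition fib0 s t x0 x1 z :=
  3 * t * (x0 ^+ 2 - x1 ^+ 2) + z * qform0 s t x0 x1 + z ^+ 2 * rform r s t 1 0.
Definition fib1 s t x0 x1 z :=
  3 * s * x1 ^+ 2 - 6 * t * x0 * x1 + z * qform1 s t x0 x1 + z ^+ 2 * rform r s t 0 1.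
Definition fibz s t x0 x1 z :=
  qform q s t x0 x1 + 2 * z * rform r s t x0 x1 + 3 * z ^+ 2 * gform g s t.
Definition fibd s t x0 x1 z y0 y1 w :=
  fib0 s t x0 x1 z * y0 + fib1 s t x0 x1 z * y1 + fibz s t x0 x1 z * w.

Lemma fibc_taylor s t x0 x1 z y0 y1 w k :
  fibc s t (x0 + k * y0) (x1 + k * y1) (z + k * w) =
  fibc s t x0 x1 z + k * fibd s t x0 x1 z y0 y1 w + k ^+ 2 * fibd s t y0 y1 w x0 x1 z
  + k ^+ 3 * fibc s t y0 y1 w.
Proof.
rewrite /fibd /fib0 /fib1 /fibz /fibc /qform0 /qform1 /qform /rform /gform; ring.
Qed.

Lemma fibd_euler s t x0 x1 z : fibd s t x0 x1 z x0 x1 z = 3 * fibc s t x0 x1 z.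
Proof.
rewrite /fibd /fib0 /fib1 /fibz /fibc /qform0 /qform1 /qform /rform /gform; ring.
Qed.

(** Twice the value of the second derivative of the cubic on the tangent
    vector [(C_z, 0, - C_0)].  The weights [k0], ..., [k3] multiply the four
    parts of the cubic; they allow to clear the denominators that come from
    replacing [z] by [x3 / t]. *)
Definition flexw k0 k1 k2 k3 s t x0 x1 z :=
  let c0 := k0 * (3 * t * (x0 ^+ 2 - x1 ^+ 2)) + k1 * (z * qform0 s t x0 x1)
            + k2 * (z ^+ 2 * rform r s t 1 0) in
  let cz := k1 * qform q s t x0 x1 + k2 * (2 * z * rform r s t x0 x1)
            + k3 * (3 * z ^+ 2 * gform g s t) in
  let c00 := k0 * (6 * t * x0) + k1 * (2 * z * (q 0%N * s ^+ 2 + q 1%N * s * t + q 2%N * t ^+ 2)) in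
  let c0z := k1 * qform0 s t x0 x1 + k2 * (2 * z * rform r s t 1 0) in
  let czz := k2 * (2 * rform r s t x0 x1) + k3 * (6 * z * gform g s t) in
  c00 * cz ^+ 2 - 2 * c0z * c0 * cz + czz * c0 ^+ 2.

Lemma flexw_fibd s t x0 x1 z :
  flexw 1 1 1 1 s t x0 x1 z =
  2 * fibd s t (fibz s t x0 x1 z) 0 (- fib0 s t x0 x1 z) x0 x1 z.
Proof.
rewrite /flexw /fibd /fib0 /fib1 /fibz /qform0 /qform1.
set Q := qform _ _ _ _ _; set G := gform _ _ _.
rewrite /qform /rform; ring.
Qed.

Lemma flexw_scale k s t x0 x1 z :
  flexw ((k * t) ^+ 3) ((k * t) ^+ 2) (k * t) 1 (k * s) (k * t) x0 x1 (t * z) =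
  k ^+ 12 * t ^+ 7 * flexw 1 1 1 1 s t x0 x1 z.
Proof.
have E0 : qform0 (k * s) (k * t) x0 x1 = k ^+ 2 * qform0 s t x0 x1.
  by rewrite /qform0; ring.
have E1 : qform q (k * s) (k * t) x0 x1 = k ^+ 2 * qform q s t x0 x1.
  by rewrite /qform; ring.
have E2 a b : rform r (k * s) (k * t) a b = k ^+ 3 * rform r s t a b.
  by rewrite /rform; ring.
have E3 : gform g (k * s) (k * t) = k ^+ 4 * gform g s t.
  by rewrite /gform; ring.
rewrite /flexw E0 E1 !E2 E3.
move: (qform0 _ _ _ _) (qform _ _ _ _ _) (rform _ _ _ x0 _) (rform _ _ _ 1 _) (gform _ _ _).
by move=> *; ring.
Qed.

(** Cofactors of [x2] and [x3] in the quartic.  At a point of the quartic off [l]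
    they give the plane through [l] and this point; they extend this plane over [l]
    as the tangent plane. *)
Definition quarticA x0 x1 x2 x3 :=
  x1 ^+ 3 + (q 0%N * x2 + q 1%N * x3) * x0 ^+ 2 + (q 3%N * x2 + q 4%N * x3) * x0 * x1
  + (q 6%N * x2 + q 7%N * x3) * x1 ^+ 2
  + (r 0%N * x2 ^+ 2 + r 1%N * x2 * x3 + r 2%N * x3 ^+ 2) * x0
  + (r 4%N * x2 ^+ 2 + r 5%N * x2 * x3 + r 6%N * x3 ^+ 2) * x1
  + (g 0%N * x2 ^+ 3 + g 1%N * x2 ^+ 2 * x3 + g 2%N * x2 * x3 ^+ 2 + g 3%N * x3 ^+ 3).
Definition quarticB x0 x1 x3 :=
  (x0 ^+ 3 - 3 * x0 * x1 ^+ 2) + q 2%N * x3 * x0 ^+ 2 + q 5%N * x3 * x0 * x1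
  + q 8%N * x3 * x1 ^+ 2 + r 3%N * x3 ^+ 2 * x0 + r 7%N * x3 ^+ 2 * x1 + g 4%N * x3 ^+ 3.

Lemma quarticAB x0 x1 x2 x3 :
  quartic x0 x1 x2 x3 = x2 * quarticA x0 x1 x2 x3 + x3 * quarticB x0 x1 x3.
Proof. rewrite /quartic /quarticA /quarticB /qform /rform /gform; ring. Qed.

Lemma fibcAB s t x0 x1 z :
  fibc s t x0 x1 z =
  s * quarticA x0 x1 (z * s) (z * t) + t * quarticB x0 x1 (z * t).
Proof. rewrite /fibc /quarticA /quarticB /qform /rform /gform; ring. Qed.

Lemma quartic_fibc s t x0 x1 z : quartic x0 x1 (z * s) (z * t) = z * fibc s t x0 x1 z.
Proof. rewrite /fibc /quartic /qform /rform /gform; ring. Qed.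

End Cubics.

(** * Functions given by forms *)

Section FormFunctions.
Variable K : closedFieldType.
Notation vec := 'rV[K]_4.
Notation form := {mpoly K[4]}.

(** Forms are constructed by giving their functions; this avoids computations with
    large multivariate polynomials. *)
Definition form_fun d (F : vec -> K) : Prop :=
  exists2 h : form, h \is d.-homog & forall v, evalv h v = F v.

Lemma form_funM d e n F G :
  form_fun d F -> form_fun e G -> (d + e)%N = n -> form_fun n (fun v => F v * G v).
Proof.
move=> [h hh hE] [k kh kE] <-; exists (h * k); first exact: dhomogM.
by move=> v; rewrite evalvM hE kE.
Qed.
Lemma form_funX d k n F : form_fun d F -> (d * k)%N = n -> form_fun n (fun v => F v ^+ k).
Proof.
move=> [h hh hE] <-; exists (h ^+ k); first exact: dhomogMn.
by move=> v; rewrite evalvX hE.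
Qed.
Lemma form_funD d F G : form_fun d F -> form_fun d G -> form_fun d (fun v => F v + G v).
Proof.
move=> [h hh hE] [k kh kE]; exists (h + k); first exact: rpredD.
by move=> v; rewrite evalvD hE kE.
Qed.
Lemma form_funN d F : form_fun d F -> form_fun d (fun v => - F v).
Proof.
move=> [h hh hE]; exists (- h); first by rewrite rpredN.
by move=> v; rewrite evalvN hE.
Qed.
Lemma form_funC (c : K) : form_fun 0 (fun=> c).
Proof.
exists c%:MP; last by move=> v; rewrite evalvC.
by rewrite -[c%:MP]mulr1 mul_mpolyC rpredZ // dhomog1.
Qed.
Lemma form_funX1 B i : form_fun 1 (fun v => evalv (X B i) v).
Proof. by exists (X B i); first exact: lform_homog. Qed.
Lemma form_fun_evalv d (h : form) : h \is d.-homog -> form_fun d (evalv h).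
Proof. by exists h. Qed.
End FormFunctions.

Ltac by_degree_atom :=
  first [exact: form_funX1 | apply: form_fun_evalv; eassumption].

Ltac by_degree :=
  lazymatch goal with
  | |- form_fun _ (fun v => @?F v + @?G v) => apply: form_funD; [by_degree | by_degree]
  | |- form_fun _ (fun v => - @?F v) => apply: form_funN; by_degree
  | |- form_fun _ (fun v => @?F v * @?G v) => eapply form_funM; [by_degree | by_degree | reflexivity]
  | |- form_fun _ (fun v => @?F v ^+ _) => eapply form_funX; [by_degree | reflexivity]
  | |- form_fun _ (evalv _) => by_degree_atom
  | |- form_fun _ (fun v => evalv _ v) => by_degree_atom
  | |- form_fun _ (fun=> _) => exact: form_funC
  end.

(** ** The residual cubics as fibers *)

Section Fibers.
Variable K : closedFieldType.
Notation vec := 'rV[K]_4.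
Notation form := {mpoly K[4]}.
Implicit Types (l : {vspace vec}) (B : 'M[K]_4).

Variables (l : {vspace vec}) (B : 'M[K]_4) (f : form) (q r g : nat -> K).
Hypothesis lB : chart_of l B.
Hypothesis fE : forall x0 x1 x2 x3,
  evalv f (pt B x0 x1 x2 x3) = quartic q r g x0 x1 x2 x3.

Let Bu : B \in unitmx := proj1 lB.

Lemma form_chart_eq (h h' : form) :
  (forall x0 x1 x2 x3, evalv h (pt B x0 x1 x2 x3) = evalv h' (pt B x0 x1 x2 x3)) -> h = h'.
Proof.
move=> E; apply: evalv_fun_eq => v.
by have [x0 [x1 [x2 [x3 ->]]]] := ptE Bu v; apply: E.
Qed.

(** The plane (s : t) through [l], spanned by [l] and [pt B 0 0 s t]. *)
Definition plane s t : vec := t *: covec B o2 - s *: covec B o3.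

Lemma evalv_plane s t x0 x1 x2 x3 :
  evalv (lform (plane s t)) (pt B x0 x1 x2 x3) = t * x2 - s * x3.
Proof. by rewrite lformD lformN !lformZ evalvD evalvN !evalvZ -!/(X _ _) !Xpt. Qed.

Lemma plane_eq0 s t : plane s t = 0 <-> s = 0 /\ t = 0.
Proof.
split=> [E|[-> ->]]; last by rewrite /plane !scale0r subrr.
have H x2 x3 : t * x2 - s * x3 = 0.
  by rewrite -(evalv_plane s t 0 0) E lform0 /evalv meval0.
split; last by have := H 1 0; rewrite mulr1 mulr0 subr0.
by have /eqP := H 0 1; rewrite mulr0 mulr1 sub0r oppr_eq0 => /eqP.
Qed.

Lemma in_plane_l s t : in_plane l (plane s t).
Proof.
move=> v vl; have [x0 [x1 [x2 [x3 E]]]] := ptE Bu v.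
move: vl; rewrite E => /(proj2 lB) [-> ->].
by rewrite evalv_plane !mulr0 subr0.
Qed.

Lemma in_plane_lP (u : vec) : in_plane l u -> exists s t, u = plane s t.
Proof.
move=> ul; rewrite (covec_decomp Bu u) big_ord4.
have [[[E0 E1] E2] E3] := row_pt B.
have U0 : evalv (lform u) (row o0 B) = 0 by apply: ul; rewrite E0; apply/(proj2 lB).
have U1 : evalv (lform u) (row o1 B) = 0 by apply: ul; rewrite E1; apply/(proj2 lB).
rewrite U0 U1 !scale0r !add0r; exists (- evalv (lform u) (row o3 B)), (evalv (lform u) (row o2 B)).
by rewrite /plane scaleNr opprK addrC.
Qed.

Lemma plane_point s t x0 x1 x2 x3 : (s, t) <> (0, 0) ->
  t * x2 - s * x3 = 0 -> exists z, pt B x0 x1 x2 x3 = pt B x0 x1 (z * s) (z * t).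
Proof.
move=> st /eqP; rewrite subr_eq0 => /eqP E.
have [t0|t0] := eqVneq t 0; last first.
  by exists (x3 / t); congr (pt B _ _ _ _); [rewrite mulrAC [x3 * s]mulrC -E|]; field.
have s0 : s != 0 by apply/eqP => s0; apply: st; rewrite s0 t0.
exists (x2 / s); congr (pt B _ _ _ _); first by field.
move: E => /eqP; rewrite t0 mul0r eq_sym mulf_eq0 (negbTE s0) => /eqP ->.
by rewrite mulr0.
Qed.

Lemma in_planeE v s t : (s, t) <> (0, 0) -> evalv (lform (plane s t)) v = 0 ->
  exists x0 x1 z, v = pt B x0 x1 (z * s) (z * t).
Proof.
move=> st; have [x0 [x1 [x2 [x3 ->]]]] := ptE Bu v.
by rewrite evalv_plane => /(plane_point x0 x1 st) [z ->]; exists x0, x1, z.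
Qed.

Lemma plane_pt_inj s t x0 x1 z y0 y1 w : (s, t) <> (0, 0) ->
  pt B x0 x1 (z * s) (z * t) = pt B y0 y1 (w * s) (w * t) -> [/\ x0 = y0, x1 = y1 & z = w].
Proof.
move=> st /(pt_inj Bu) [-> -> Es Et]; split=> //.
have [t0|t0] := eqVneq t 0; last exact: mulIf Et.
by apply: (mulIf (x := s)) => //; apply/eqP => s0; apply: st; rewrite s0 t0.
Qed.

Lemma plane_pt_eq0 s t x0 x1 z : (s, t) <> (0, 0) ->
  pt B x0 x1 (z * s) (z * t) = 0 <-> (x0, x1, z) = (0, 0, 0).
Proof.
move=> st; split=> [|[-> -> ->]]; last by rewrite !mul0r pt0.
by have := @plane_pt_inj s t x0 x1 z 0 0 0 st; rewrite !mul0r pt0 => H /H [-> -> ->].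
Qed.

Lemma free_planes s t s' t' : (s, t) <> (0, 0) ->
  free [:: plane s t; plane s' t'] -> t' * s - s' * t != 0.
Proof.
move=> st; apply: contraTneq => k0; rewrite free_cons negb_and negbK.
have [[-> ->]|st'] : (s' = 0 /\ t' = 0) \/ (s', t') <> (0, 0).
  have [->|s'0] := eqVneq s' 0; last by right=> -[s0]; rewrite s0 eqxx in s'0.
  by have [->|t'0] := eqVneq t' 0; [left | right=> -[t0]; rewrite t0 eqxx in t'0].
- rewrite (proj2 (plane_eq0 0 0)) //; apply/orP; right; apply/negP => /freeP.
  by move=> /(_ (fun=> 1)); rewrite big_ord1 /= scaler0 => /(_ erefl ord0) /eqP; rewrite oner_eq0.
apply/orP; left; rewrite span_seq1.
have [z [Es Et]] : exists z, s = z * s' /\ t = z * t'.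
  move/eqP: k0; rewrite subr_eq0 => /eqP k0.
  have [t'0|t'0] := eqVneq t' 0.
    have s'0 : s' != 0 by apply/eqP => s0; apply: st'; rewrite s0 t'0.
    exists (s / s'); split; first by field.
    by move/eqP: k0; rewrite t'0 mul0r eq_sym mulf_eq0 (negbTE s'0) => /eqP ->; rewrite mulr0.
  exists (t / t'); split; last by field.
  by apply: (mulfI t'0); rewrite k0; field.
by apply/vlineP; exists z; rewrite /plane scalerBr !scalerA -Es -Et.
Qed.

(** Off [l] the residual cubic is the quartic divided by [z], up to a scalar; the
    quotient extends over [l] as a polynomial in [z]. *)
Lemma fiber_elim (u : vec) (c : form) : fiber f l u c ->
  exists s t k, [/\ (s, t) <> (0, 0), k != 0, u = plane s t
    & forall x0 x1 z, evalv c (pt B x0 x1 (z * s) (z * t)) = k * fibc q r g s t x0 x1 z].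
Proof.
move=> [u0 ul _ [a [h [al au E]]]].
have [s [t Eu]] := in_plane_lP ul; have [s' [t' Ea]] := in_plane_lP al.
have st : (s, t) <> (0, 0).
  by case=> s0 t0; apply: u0; rewrite Eu; apply/plane_eq0.
pose k := t' * s - s' * t.
have k0 : k != 0 by apply: free_planes; rewrite // -Eu -Ea.
exists s, t, k^-1; split=> //; first by rewrite invr_eq0.
move=> x0 x1 z; apply: (mulfI k0); rewrite mulrA divff // mul1r.
pose c0 := pt B x0 x1 0 0; pose c1 := pt B 0 0 s t.
have lin z' : c0 + z' *: c1 = pt B x0 x1 (z' * s) (z' * t).
  by rewrite ptZ ptD !mulr0 !addr0 !add0r.
pose P := k *: restr c c0 c1.
pose Q := Poly [:: fibc q r g s t x0 x1 0; qform q s t x0 x1; rform r s t x0 x1; gform g s t].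
have QE z' : Q.[z'] = fibc q r g s t x0 x1 z'.
  by rewrite /Q /= !horner_cons horner0 /fibc; ring.
suff PQ : P = Q.
  by rewrite -QE -PQ /P hornerZ restr_horner lin.
have X0 : 'X != 0 :> {poly K} by rewrite polyX_eq0.
apply: (mulfI X0); apply: poly_fun_eq => z'.
rewrite !hornerM !hornerX QE -quartic_fibc -fE hornerZ restr_horner lin E evalvD !evalvM Ea Eu.
by rewrite !evalv_plane /k; ring.
Qed.

(** As the equation of [l] in the plane serves a linear form that takes the value 1
    at [pt B 0 0 s t]. *)
Lemma fiber_exists (u : vec) s t : u = plane s t -> (s, t) <> (0, 0) ->
  exists c, fiber f l u c.
Proof.
move=> -> st.
have [A Ah AE] : form_fun 3 (fun v => quarticA q r g (evalv (X B o0) v)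
    (evalv (X B o1) v) (evalv (X B o2) v) (evalv (X B o3) v)).
  by rewrite /quarticA; by_degree.
have [C Ch CE] : form_fun 3 (fun v => quarticB q r g (evalv (X B o0) v)
    (evalv (X B o1) v) (evalv (X B o3) v)).
  by rewrite /quarticB; by_degree.
have [a2 [a3 Ea]] : exists a2 a3, a2 * s + a3 * t = 1.
  have [t0|t0] := eqVneq t 0; last by exists 0, t^-1; rewrite mul0r add0r mulVf.
  have s0 : s != 0 by apply/eqP => s0; apply: st; rewrite s0 t0.
  by exists s^-1, 0; rewrite mul0r addr0 mulVf.
exists (s *: A + t *: C); split.
- by move/plane_eq0 => [s0 t0]; apply: st; rewrite s0 t0.
- exact: in_plane_l.
- by rewrite rpredD // rpredZ.
exists (plane (- a3) a2), (a3 *: A - a2 *: C); split; first exact: in_plane_l.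
  have uw v : evalv (lform (plane (- a3) a2)) (pt B 0 0 (v * s) (v * t)) = v.
    by rewrite evalv_plane -[RHS]mulr1 -Ea; ring.
  have pw v : evalv (lform (plane s t)) (pt B 0 0 (v * s) (v * t)) = 0.
    by rewrite evalv_plane; ring.
  rewrite free_cons span_seq1; apply/andP; split.
    apply/negP => /vlineP [k Ek]; have := pw 1; rewrite Ek lformZ evalvZ uw mulr1 => k0.
    by move: Ek; rewrite k0 scale0r => /plane_eq0 [s0 t0]; apply: st; rewrite s0 t0.
  rewrite free_cons span_nil memv0 nil_free andbT; apply/eqP => E0.
  by have := uw 1; rewrite E0 lform0 /evalv meval0 => /eqP; rewrite eq_sym oner_eq0.
apply: form_chart_eq => x0 x1 x2 x3; rewrite fE quarticAB.
rewrite evalvD !evalvM !evalvD !evalv_plane evalvN !evalvZ.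
rewrite AE CE !(Xpt Bu).
move: (quarticA _ _ _ _ _ _ _) (quarticB _ _ _ _ _ _) => a b.
transitivity ((a2 * s + a3 * t) * (x2 * a + x3 * b)); first by rewrite Ea mul1r.
ring.
Qed.

End Fibers.

(** * Lines of the second kind *)

Section SecondKind.
Variable K : closedFieldType.
Notation vec := 'rV[K]_4.
Notation form := {mpoly K[4]}.
Hypotheses (char2 : 2%:R != 0 :> K) (char3 : 3%:R != 0 :> K).
Variables (l : {vspace vec}) (B : 'M[K]_4) (f : form) (q r g : nat -> K).
Hypothesis lB : chart_of l B.
Hypothesis fE : forall x0 x1 x2 x3,
  evalv f (pt B x0 x1 x2 x3) = quartic q r g x0 x1 x2 x3.

Let Bu : B \in unitmx := proj1 lB.

Lemma fiber_restr (c : form) s t k :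
    (forall x0 x1 z, evalv c (pt B x0 x1 (z * s) (z * t)) = k * fibc q r g s t x0 x1 z) ->
  forall x0 x1 z y0 y1 w i,
  (restr c (pt B x0 x1 (z * s) (z * t)) (pt B y0 y1 (w * s) (w * t)))`_i =
  k * nth 0 [:: fibc q r g s t x0 x1 z; fibd q r g s t x0 x1 z y0 y1 w;
             fibd q r g s t y0 y1 w x0 x1 z; fibc q r g s t y0 y1 w] i.
Proof.
move=> cE x0 x1 z y0 y1 w i.
rewrite (@coef_restr _ _ _ _ [:: k * fibc q r g s t x0 x1 z; k * fibd q r g s t x0 x1 z y0 y1 w;
    k * fibd q r g s t y0 y1 w x0 x1 z; k * fibc q r g s t y0 y1 w]).
  by move: i => [|[|[|[|i]]]] //=; rewrite !nth_nil mulr0.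
move=> a; rewrite ptZ ptD.
have -> : z * s + a * (w * s) = (z + a * w) * s by ring.
have -> : z * t + a * (w * t) = (z + a * w) * t by ring.
by rewrite cE fibc_taylor /=; ring.
Qed.

(** The form used here is the second derivative of the residual cubic along a
    tangent vector.  At an inflection point the Hessian vanishes on the
    inflection tangent, because by Euler's relation it vanishes on the pairs
    containing the point itself. *)
Lemma inflection_flexw (u : vec) (c : form) (v : vec) :
    fiber f l u c -> inflection_point u c v ->
  exists s t x0 x1 z, [/\ (s, t) <> (0, 0), v = pt B x0 x1 (z * s) (z * t),
    fibc q r g s t x0 x1 z = 0 & flexw q r g 1 1 1 1 s t x0 x1 z = 0].
Proof.
move=> /(fiber_elim lB fE) [s [t [k [st k0 -> cE]]]] [[v0 vu _] [m [dm mu im]]].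
have [//|vm {}im] := im.
have [x0 [x1 [z Ev]]] := in_planeE lB st vu.
have [q' q'm q'v] := line_other_point dm vm.
have [y0 [y1 [w Eq]]] := in_planeE lB st (mu _ q'm).
have /dvdXn_coef im3 := im _ q'm.
have co i : (i < 3)%N -> nth 0 [:: fibc q r g s t x0 x1 z; fibd q r g s t x0 x1 z y0 y1 w;
             fibd q r g s t y0 y1 w x0 x1 z; fibc q r g s t y0 y1 w] i = 0.
  move=> i3; apply: (mulfI k0); rewrite mulr0 -(fiber_restr cE) -Ev -Eq.
  exact: im3.
have C0 := co 0%N isT; have D0 := co 1%N isT; have Q0 := co 2%N isT.
move: C0 D0 Q0 => /= C0 D0 Q0 {co}.
exists s, t, x0, x1, z; split=> //.
set F := flexw _ _ _ _ _ _ _ _ _ _ _ _.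
pose c0 := fib0 q r s t x0 x1 z; pose c1 := fib1 q r s t x0 x1 z.
pose cz := fibz q r g s t x0 x1 z.
have E0 : fibd q r g s t x0 x1 z x0 x1 z = 0 by rewrite fibd_euler C0 mulr0.
move: (D0) (E0); rewrite /fibd -/c0 -/c1 -/cz => D0' E0'.
(* The gradient is proportional to the vector product [(n0, n1, nz)] of the
   point with a second point of the tangent. *)
pose n0 := x1 * w - z * y1; pose n1 := z * y0 - x0 * w; pose nz := x0 * y1 - x1 * y0.
have P01 : n0 * c1 = n1 * c0.
  apply: subr0_eq.
  transitivity (w * (c0 * x0 + c1 * x1 + cz * z) - z * (c0 * y0 + c1 * y1 + cz * w)).
    by rewrite /n0 /n1; ring.
  by rewrite D0' E0' !mulr0 subr0.
have P0z : n0 * cz = nz * c0.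
  apply: subr0_eq.
  transitivity (x1 * (c0 * y0 + c1 * y1 + cz * w) - y1 * (c0 * x0 + c1 * x1 + cz * z)).
    by rewrite /n0 /nz; ring.
  by rewrite D0' E0' !mulr0 subr0.
have P1z : n1 * cz = nz * c1.
  apply: subr0_eq.
  transitivity (y0 * (c0 * x0 + c1 * x1 + cz * z) - x0 * (c0 * y0 + c1 * y1 + cz * w)).
    by rewrite /n1 /nz; ring.
  by rewrite D0' E0' !mulr0 subr0.
have quad a b0 b1 bz :
  fibd q r g s t (a * b0) (a * b1) (a * bz) x0 x1 z = a ^+ 2 * fibd q r g s t b0 b1 bz x0 x1 z.
  by rewrite /fibd /fib0 /fib1 /fibz /qform0 /qform1 /qform /rform /gform; ring.
have tang a b : fibd q r g s t (a * x0 + b * y0) (a * x1 + b * y1) (a * z + b * w) x0 x1 z = 0.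
  transitivity (a ^+ 2 * fibd q r g s t x0 x1 z x0 x1 z
     + 2 * a * b * fibd q r g s t x0 x1 z y0 y1 w + b ^+ 2 * fibd q r g s t y0 y1 w x0 x1 z).
    by rewrite /fibd /fib0 /fib1 /fibz /qform0 /qform1 /qform /rform /gform; ring.
  by rewrite E0 D0 Q0 !mulr0 !addr0.
have key n d : n * cz = d * nz -> n * c0 = d * n0 -> n ^+ 2 * F = 0.
  move=> Ez Ec; rewrite /F flexw_fibd -/c0 -/cz mulrCA -quad mulr0 mulrN Ez Ec.
  have := tang (d * y1) (- (d * x1)).
  have -> : d * y1 * x0 + - (d * x1) * y0 = d * nz by rewrite /nz; ring.
  have -> : d * y1 * x1 + - (d * x1) * y1 = 0 by ring.
  have -> : d * y1 * z + - (d * x1) * w = - (d * n0) by rewrite /n0; ring.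
  by move=> ->; rewrite mulr0.
have F0 n : n ^+ 2 * F = 0 -> n != 0 -> F = 0.
  by move=> /eqP; rewrite mulf_eq0 expf_eq0 /= => /orP [/eqP -> /eqP|/eqP ->].
have [n00|/(F0 n0)] := eqVneq n0 0; last first.
  by apply; apply: (key _ c0); [rewrite P0z mulrC | exact: mulrC].
have [n10|/(F0 n1)] := eqVneq n1 0; last first.
  by apply; apply: (key _ c1); [rewrite P1z mulrC | rewrite -P01 mulrC].
have [nz0|/(F0 nz)] := eqVneq nz 0; last first.
  by apply; apply: (key _ cz); [exact: mulrC | rewrite -P0z mulrC].
case/negP: q'v; rewrite Eq Ev.
have prop a b : b != 0 -> b * y0 = a * x0 -> b * y1 = a * x1 -> b * w = a * z ->
    pt B y0 y1 (w * s) (w * t) \in <[pt B x0 x1 (z * s) (z * t)]>%VS.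
  move=> b0 H0 H1 H2; apply/vlineP; exists (a / b).
  rewrite ptZ; congr (pt B _ _ _ _); apply: (mulfI b0).
  - by rewrite H0; field.
  - by rewrite H1; field.
  - by transitivity (b * w * s); [ring | rewrite H2; field].
  - by transitivity (b * w * t); [ring | rewrite H2; field].
have [x00|x00] := eqVneq x0 0; last first.
  apply: (prop y0 x0) => //; first by rewrite mulrC.
    by apply/eqP; rewrite -subr_eq0 -nz0 /nz [y0 * _]mulrC.
  by apply/eqP; rewrite eq_sym -subr_eq0 -n10 /n1 [y0 * _]mulrC.
have [x10|x10] := eqVneq x1 0; last first.
  apply: (prop y1 x1) => //; last 1 first.
  - by apply/eqP; rewrite -subr_eq0 -n00 /n0 [y1 * _]mulrC.
  - by apply/eqP; rewrite eq_sym -subr_eq0 -nz0 /nz [y1 * _]mulrC.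
  - by rewrite mulrC.
have z0 : z != 0.
  by apply/eqP => z0; apply: v0; rewrite Ev x00 x10 z0 !mul0r pt0.
apply: (prop w z) => //; last by rewrite mulrC.
  by apply/eqP; rewrite -subr_eq0 -n10 /n1 [w * _]mulrC.
by apply/eqP; rewrite eq_sym -subr_eq0 -n00 /n0 [w * _]mulrC.
Qed.

Hypothesis l2 : second_kind f l.

(** The tangent plane at the point [(x0, x1)] of [l] is the plane (s : t) with
    [s = - (x0^3 - 3 x0 x1^2)] and [t = x1^3]; in that plane [(x0, x1)] is an
    inflection point.  Near [l] the plane through a point of the quartic is given
    by the forms [- quarticB] and [quarticA], which extend over [l]. *)
Lemma second_kind_identity x0 x1 :
  let s := - (x0 ^+ 3 - 3 * x0 * x1 ^+ 2) in let t := x1 ^+ 3 in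
  x0 * qform q s t x0 x1 ^+ 2
  - (x0 ^+ 2 - x1 ^+ 2) * qform q s t x0 x1 * qform0 q s t x0 x1
  + 3 * t * (x0 ^+ 2 - x1 ^+ 2) ^+ 2 * rform r s t x0 x1 = 0.
Proof.
have [A Ah AE] : form_fun 3 (fun v => quarticA q r g (evalv (X B o0) v)
    (evalv (X B o1) v) (evalv (X B o2) v) (evalv (X B o3) v)).
  by rewrite /quarticA; by_degree.
have [C Ch CE] : form_fun 3 (fun v => quarticB q r g (evalv (X B o0) v)
    (evalv (X B o1) v) (evalv (X B o3) v)).
  by rewrite /quarticB; by_degree.
have [h hh hE] : form_fun 41 (fun v => flexw q r g (evalv A v ^+ 3) (evalv A v ^+ 2) (evalv A v) 1
   (- evalv C v) (evalv A v) (evalv (X B o0) v) (evalv (X B o1) v) (evalv (X B o3) v)).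
  by rewrite /flexw /qform /qform0 /rform /gform; cbv zeta; by_degree.
have hl : in_surface l h.
  apply: (l2 hh) => v [u [c [ufc _ infl]]].
  have [s [t [y0 [y1 [z [st -> C0 F0]]]]]] := inflection_flexw ufc infl.
  rewrite hE AE CE !(Xpt Bu).
  move: C0; rewrite fibcAB.
  set a := quarticA _ _ _ _ _ _ _; set b := quarticB _ _ _ _ _ _ => C0.
  have [k [Ea Eb]] : exists k, a = k * t /\ - b = k * s.
    have [t0|t0] := eqVneq t 0; last first.
      exists (a / t); split; first by field.
      apply: (mulfI t0); transitivity (s * a - (s * a + t * b)); first by ring.
      by rewrite C0; field.
    have s0 : s != 0 by apply/eqP => s0; apply: st; rewrite s0 t0.
    exists (- b / s); split; last by field.
    apply: (mulfI s0); move: C0; rewrite t0 mul0r addr0 => ->; rewrite !mulr0 //.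
  by rewrite Ea Eb [z * t]mulrC flexw_scale F0 !mulr0.
pose E (s t y0 y1 : K) := y0 * qform q s t y0 y1 ^+ 2
  - (y0 ^+ 2 - y1 ^+ 2) * qform q s t y0 y1 * qform0 q s t y0 y1
  + 3 * t * (y0 ^+ 2 - y1 ^+ 2) ^+ 2 * rform r s t y0 y1.
pose S y0 y1 : K := - (y0 ^+ 3 - 3 * y0 * y1 ^+ 2).
have E0 y0 y1 : y1 ^+ 24 * E (S y0 y1) (y1 ^+ 3) y0 y1 = 0.
  have : evalv h (pt B y0 y1 0 0) = 0 by apply: hl; apply/(proj2 lB).
  rewrite hE AE CE !(Xpt Bu).
  have -> : quarticA q r g y0 y1 0 0 = y1 ^+ 3 by rewrite /quarticA; ring.
  have -> : - quarticB q r g y0 y1 0 = S y0 y1 by rewrite /quarticB /S; ring.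
  move: (S y0 y1) => s h0; apply: (mulfI (mulf_neq0 char2 char3)).
  rewrite mulr0 -h0 /flexw /E.
  move: (qform _ _ _ _ _) (qform0 _ _ _ _ _) (rform _ _ _ y0 _) (rform _ _ _ 1 _) (gform _ _ _).
  by move=> a b c d e; ring.
move=> s t; rewrite -/(E s t x0 x1) -/(S x0 x1).
have [P PE] : exists P : {poly K}, forall y, P.[y] = E (S x0 y) (y ^+ 3) x0 y.
  have [h' _ h'E] : form_fun 17 (fun v => E (S (evalv (X B o0) v) (evalv (X B o1) v))
      (evalv (X B o1) v ^+ 3) (evalv (X B o0) v) (evalv (X B o1) v)).
    by rewrite /E /S /qform /qform0 /rform; by_degree.
  exists (restr h' (pt B x0 0 0 0) (pt B 0 1 0 0)) => y.
  rewrite restr_horner h'E ptZ ptD !(Xpt Bu).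
  by rewrite mulr0 mulr1 addr0 add0r.
rewrite -PE; suff -> : P = 0 by rewrite horner0.
have X0 : 'X^24 != 0 :> {poly K} by rewrite -size_poly_eq0 size_polyXn.
apply: (mulfI X0); rewrite mulr0; apply: poly_fun_eq0 => y.
by rewrite hornerM hornerXn PE E0.
Qed.

End SecondKind.

(** * The normal form *)

Section NormalForm.
Variable K : closedFieldType.
Notation vec := 'rV[K]_4.
Notation form := {mpoly K[4]}.
Hypotheses (char2 : 2%:R != 0 :> K) (char3 : 3%:R != 0 :> K).
Variables (f : form) (l : {vspace vec}).
Hypotheses (fhomog : f \is 4.-homog) (lline : is_line l) (lX : in_surface l f).

(** The two cubic binary forms that give the tangent planes along [l]. *)
Definition lin2 B x0 x1 : K := dird f (pt B x0 x1 0 0) (pt B 0 0 1 0).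
Definition lin3 B x0 x1 : K := dird f (pt B x0 x1 0 0) (pt B 0 0 0 1).

Lemma dird_lin B x0 x1 y0 y1 s t : chart_of l B ->
  dird f (pt B x0 x1 0 0) (pt B y0 y1 s t) = s * lin2 B x0 x1 + t * lin3 B x0 x1.
Proof.
move=> [Bu lB].
have -> : pt B y0 y1 s t = pt B y0 y1 0 0 + (s *: pt B 0 0 1 0 + t *: pt B 0 0 0 1).
  by rewrite !ptZ !ptD !mulr0 !mulr1 !addr0 !add0r.
rewrite !dird_directionD !dird_directionZ {1}/dird.
rewrite (@coef_restr _ _ _ _ [::]) ?nth_nil ?add0r // => k.
by rewrite ptZ ptD lX //; apply/lB; rewrite !mulr0 addr0.
Qed.

Lemma chart_expansion B : chart_of l B -> exists (a q r g : nat -> K),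
  (forall x0 x1, lin2 B x0 x1 = a 0%N * x0 ^+ 3 + a 1%N * x0 ^+ 2 * x1 + a 2%N * x0 * x1 ^+ 2
                                + a 3%N * x1 ^+ 3) /\
  (forall x0 x1, lin3 B x0 x1 = a 4%N * x0 ^+ 3 + a 5%N * x0 ^+ 2 * x1 + a 6%N * x0 * x1 ^+ 2
                                + a 7%N * x1 ^+ 3) /\
  (forall x0 x1 x2 x3, evalv f (pt B x0 x1 x2 x3) = lin2 B x0 x1 * x2 + lin3 B x0 x1 * x3
    + qform q x2 x3 x0 x1 + rform r x2 x3 x0 x1 + gform g x2 x3).
Proof.
move=> lB; have [a [q [r [g E]]]] := expand4 lB fhomog lX.
exists a, q, r, g.
have E2 x0 x1 : lin2 B x0 x1 = a 0%N * x0 ^+ 3 + a 1%N * x0 ^+ 2 * x1 + a 2%N * x0 * x1 ^+ 2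
                                + a 3%N * x1 ^+ 3.
  rewrite /lin2 /dird (@coef_restr _ _ _ _ [:: 0; a 0%N * x0 ^+ 3 + a 1%N * x0 ^+ 2 * x1
    + a 2%N * x0 * x1 ^+ 2 + a 3%N * x1 ^+ 3; qform q 1 0 x0 x1; rform r 1 0 x0 x1; gform g 1 0]) //.
  by move=> k; rewrite ptZ ptD E /qform /rform /gform /=; ring.
have E3 x0 x1 : lin3 B x0 x1 = a 4%N * x0 ^+ 3 + a 5%N * x0 ^+ 2 * x1 + a 6%N * x0 * x1 ^+ 2
                                + a 7%N * x1 ^+ 3.
  rewrite /lin3 /dird (@coef_restr _ _ _ _ [:: 0; a 4%N * x0 ^+ 3 + a 5%N * x0 ^+ 2 * x1
    + a 6%N * x0 * x1 ^+ 2 + a 7%N * x1 ^+ 3; qform q 0 1 x0 x1; rform r 0 1 x0 x1; gform g 0 1]) //.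
  by move=> k; rewrite ptZ ptD E /qform /rform /gform /=; ring.
by do !split=> // *; rewrite E E2 E3.
Qed.

Lemma fiber_on_line B u c s t : chart_of l B -> fiber f l u c ->
    (s, t) <> (0, 0) -> evalv (lform u) (pt B 0 0 s t) = 0 ->
  exists2 k, k != 0 & forall x0 x1,
    evalv c (pt B x0 x1 0 0) = k * (s * lin2 B x0 x1 + t * lin3 B x0 x1).
Proof.
move=> lB [u0 ul _ [a [h [al au E]]]] st ust.
have inl x0 x1 : pt B x0 x1 0 0 \in l by apply/(proj2 lB).
pose k := evalv (lform a) (pt B 0 0 s t).
have kE x0 x1 : s * lin2 B x0 x1 + t * lin3 B x0 x1 = k * evalv c (pt B x0 x1 0 0).
  rewrite -(dird_lin x0 x1 0 0 s t lB) E dirdD !dirdM !dird_lform ust -/k.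
  by rewrite (al _ (inl _ _)) (ul _ (inl _ _)); ring.
have k0 : k != 0.
  have [s1 [t1 Eu]] := in_plane_lP lB ul; have [s2 [t2 Ea]] := in_plane_lP lB al.
  have st1 : (s1, t1) <> (0, 0).
    by case=> s0 t0; apply: u0; rewrite Eu; apply/(plane_eq0 lB).
  move: ust; rewrite Eu (evalv_plane lB) => E1.
  have := free_planes lB st1; move: au; rewrite Eu Ea => au /(_ _ _ au).
  apply: contraNneq; rewrite /k Ea (evalv_plane lB) => E2.
  have Hs : s * (t2 * s1 - s2 * t1) = 0.
    transitivity (s1 * (t2 * s - s2 * t) - s2 * (t1 * s - s1 * t)); first by ring.
    by rewrite E1 E2 !mulr0 subr0.
  have Ht : t * (t2 * s1 - s2 * t1) = 0.
    transitivity (t1 * (t2 * s - s2 * t) - t2 * (t1 * s - s1 * t)); first by ring.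
    by rewrite E1 E2 !mulr0 subr0.
  have [t0|t0] := eqVneq t 0; last by move/eqP: Ht; rewrite mulf_eq0 (negbTE t0).
  have s0 : s != 0 by apply/eqP => s0; apply: st; rewrite s0 t0.
  by move/eqP: Hs; rewrite mulf_eq0 (negbTE s0).
exists k^-1 => [|x0 x1]; first by rewrite invr_eq0.
by rewrite kE mulrA mulVf // mul1r.
Qed.

(** On [l] the fiber through [p] is the member of the pencil of cubics spanned by
    [lin2] and [lin3] that vanishes at [p]; the ramification index is the order of
    this zero. *)
Lemma ramification_at p B x0 x1 e (c : form) : chart_of l B -> pt B x0 x1 0 0 = p ->
    fiber_at f l p c -> imult_ge c l p e ->
  exists2 k, k != 0 & exists2 h : form,
    forall y0 y1, evalv h (pt B y0 y1 0 0) =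
      k * (lin2 B x0 x1 * lin3 B y0 y1 - lin3 B x0 x1 * lin2 B y0 y1) &
    forall w0 w1, (0 < e)%N -> ('X^e %| restr h p (pt B w0 w1 0 0))%R.
Proof.
move=> lB <- fc im.
have T s t : evalv (lform (tangent_plane f (pt B x0 x1 0 0))) (pt B 0 0 s t)
     = s * lin2 B x0 x1 + t * lin3 B x0 x1.
  by rewrite tangent_planeE (dird_lin _ _ _ _ _ _ lB).
have st : (- lin3 B x0 x1, lin2 B x0 x1) <> (0, 0).
  case=> /eqP; rewrite oppr_eq0 => /eqP E3 E2; case: (fc) => u0 ul _ _; apply: u0.
  have [s [t E]] := in_plane_lP lB ul; rewrite E; apply/(plane_eq0 lB).
  have H a b : t * a - s * b = 0.
    by have := T a b; rewrite E (evalv_plane lB) E2 E3 !mulr0 addr0.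
  by split; [have /eqP := H 0 1; rewrite mulr0 mulr1 sub0r oppr_eq0 => /eqP
            | have := H 1 0; rewrite mulr1 mulr0 subr0].
have [|k k0 E] := fiber_on_line lB fc st; first by rewrite T; ring.
exists k => //; exists c => [y0 y1|w0 w1 e0]; first by rewrite E; ring.
by case: (im e0) => _; apply; apply/(proj2 lB).
Qed.

(** [P1] is a combination of [P2] and [P3]; the sum and the difference of the two
    summands are the first vectors of the basis. *)
Lemma three_points_basis (P1 P2 P3 : vec) :
    P1 <> 0 -> P2 <> 0 -> P3 <> 0 -> P1 \in l -> P2 \in l -> P3 \in l ->
    uniq [:: <[P1]>%VS; <[P2]>%VS; <[P3]>%VS] ->
  exists B k2 k3, [/\ chart_of l B, pt B 1 0 0 0 = P1, k2 != 0 /\ k3 != 0,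
    pt B 1 1 0 0 = k2 *: P2 & pt B (-1) 1 0 0 = k3 *: P3].
Proof.
move=> P10 P20 P30 P1l P2l P3l /=; rewrite !inE negb_or andbT => /andP [/andP [P12 P13] P23].
have P3n : P3 \notin <[P2]>%VS.
  apply/negP => /vlineP [k E]; case/negP: P23; apply/eqP/esym.
  apply/(vline_eqP _ P20); exists k => //; apply/eqP => k0; apply: P30.
  by rewrite E k0 scale0r.
have lE := line_eq_span2 lline P20 P3n P2l P3l.
have /mem_span2 [x [y E]] : P1 \in (<[P2]> + <[P3]>)%VS by rewrite -lE.
have x0 : x != 0.
  apply/eqP => x0; case/negP: P13; apply/eqP/(vline_eqP _ P30); exists y.
    by apply/eqP => y0; apply: P10; rewrite E x0 y0 !scale0r addr0.
  by rewrite E x0 scale0r add0r.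
have y0 : y != 0.
  apply/eqP => y0; case/negP: P12; apply/eqP/(vline_eqP _ P20); exists x => //.
  by rewrite E y0 scale0r addr0.
pose b1 := x *: P2 - y *: P3.
have b1n : b1 \notin <[P1]>%VS.
  apply/negP => /vlineP [k Ek].
  have : (x - k * x) *: P2 = (y + k * y) *: P3.
    apply: subr0_eq; move: Ek; rewrite /b1 E => Ek.
    have -> : (x - k * x) *: P2 - (y + k * y) *: P3 =
      (x *: P2 - y *: P3) - k *: (x *: P2 + y *: P3).
      rewrite scalerBl scalerDl scalerDr !scalerA opprD opprD !addrA.
      by rewrite -!addrA; congr (_ + _); rewrite addrCA.
    by rewrite Ek subrr.
  have [k1|k1] := eqVneq (y + k * y) 0.
    rewrite k1 scale0r => /eqP; rewrite scaler_eq0 (introF eqP P20) orbF => /eqP k2.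
    have : 2%:R * (x * y) = 0.
      by transitivity (y * (x - k * x) + x * (y + k * y)); [ring | rewrite k1 k2 !mulr0 addr0].
    by move/eqP; rewrite !mulf_eq0 (negbTE char2) (negbTE x0) (negbTE y0).
  move=> E23; case/negP: P3n; apply/vlineP; exists ((y + k * y)^-1 * (x - k * x)).
  by rewrite -scalerA E23 scalerA mulVf // scale1r.
have b1l : b1 \in l by rewrite /b1 rpredB ?rpredZ.
have [B [lB B0 B1]] := chart_of_line lline P10 b1n P1l b1l.
exists B, (2 * x), (- (2 * y)); split=> //.
- by rewrite oppr_eq0 !mulf_eq0 (negbTE char2) (negbTE x0) (negbTE y0).
- have -> : pt B 1 1 0 0 = pt B 1 0 0 0 + pt B 0 1 0 0 by rewrite ptD !addr0 add0r.
  rewrite B0 B1 E /b1 addrACA subrr addr0 -scalerDl; congr (_ *: _); ring.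
- have -> : pt B (-1) 1 0 0 = pt B 0 1 0 0 - pt B 1 0 0 0.
    by rewrite -scaleN1r ptZ ptD !mulr0 !addr0 add0r mulr1.
  rewrite B0 B1 E /b1 opprD addrACA subrr add0r -opprD -scalerDl scaleNr; congr (- (_ *: _)); ring.
Qed.

Variables (P1 P2 P3 : vec).
Hypothesis Pdistinct : uniq [:: <[P1]>%VS; <[P2]>%VS; <[P3]>%VS].
Hypothesis ramif : ramification_divisor f l [:: P1; P1; P2; P3].

(** Total ramification at (1 : 0) makes [x1^3] a member of the pencil of cubics on
    [l].  A second member without [x1^3] has a derivative with respect to [x0] that
    vanishes at (1 : 1) and (-1 : 1), so it is a multiple of [x0^3 - 3 x0 x1^2]. *)
Lemma normal_linear_part : exists B k1 k2 k3 (q r g : nat -> K),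
  [/\ chart_of l B, [/\ k1 != 0, k2 != 0 & k3 != 0],
      [/\ P1 = k1 *: pt B 1 0 0 0, P2 = k2 *: pt B 1 1 0 0 & P3 = k3 *: pt B (-1) 1 0 0]
    & forall x0 x1 x2 x3, evalv f (pt B x0 x1 x2 x3) = quartic q r g x0 x1 x2 x3].
Proof.
have [Dl Dr] := ramif.
have inD p : p \in [:: P1; P2; P3] -> p <> 0 /\ p \in l.
  by move=> pD; apply: Dl; move: pD; rewrite !inE => /or3P [] ->; rewrite ?orbT.
have [P10 P1l] := inD P1 (mem_head _ _).
have [P20 P2l] : P2 <> 0 /\ P2 \in l by apply: inD; rewrite !inE eqxx orbT.
have [P30 P3l] : P3 <> 0 /\ P3 \in l by apply: inD; rewrite !inE eqxx !orbT.
have [B0 [k2 [k3 [lB0 E1 [k20 k30] E2 E3]]]] := three_points_basis P10 P20 P30 P1l P2l P3l Pdistinct.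
have ram p (e : nat) : p <> 0 -> p \in l ->
    e = (count (fun q => <[q]>%VS == <[p]>%VS) [:: P1; P1; P2; P3]).+1 ->
    ramification_index f l p e by move=> p0 pl ->; apply: Dr.
move: (Pdistinct) => /=; rewrite !inE negb_or andbT => /andP [/andP [P12 P13] P23].
have R1 : ramification_index f l P1 3.
  by apply: ram => //=; rewrite eqxx ![_ == <[P1]>%VS]eq_sym (negbTE P12) (negbTE P13).
have R2 : ramification_index f l P2 2.
  by apply: ram => //=; rewrite eqxx (negbTE P12) ![<[P3]>%VS == _]eq_sym (negbTE P23).
have R3 : ramification_index f l P3 2.
  by apply: ram => //=; rewrite eqxx (negbTE P13) (negbTE P23).
(* The first basis vector of a complement is chosen in the tangent plane at [P1]. *)
have [B1 lB1 [E1' E2' E3' L0]] : exists2 B, chart_of l B &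
  [/\ pt B 1 0 0 0 = P1, pt B 1 1 0 0 = k2 *: P2, pt B (-1) 1 0 0 = k3 *: P3
    & lin2 B 1 0 = 0].
  pose s := lin3 B0 1 0; pose t := - lin2 B0 1 0.
  have [k [k' kk]] : exists k k', s * k' - k * t != 0.
    have [s0|s0] := eqVneq s 0; last by exists 0, 1; rewrite mulr1 mul0r subr0.
    exists 1, 0; rewrite mulr0 mul1r sub0r oppr_eq0; apply/eqP => t0.
    have [c [[u0 ul _ _] _ _]] := R1; apply: u0.
    have [s' [t' E]] := in_plane_lP lB0 ul; rewrite E; apply/(plane_eq0 lB0).
    have H a b : t' * a - s' * b = 0.
      rewrite -(evalv_plane lB0 s' t' 0 0) -E tangent_planeE -E1 (dird_lin _ _ _ _ _ _ lB0).
      by rewrite -/s s0; move/eqP: t0; rewrite oppr_eq0 => /eqP ->; rewrite !mulr0 addr0.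
    by split; [have /eqP := H 0 1; rewrite mulr0 mulr1 sub0r oppr_eq0 => /eqP
            | have := H 1 0; rewrite mulr1 mulr0 subr0].
  have [B lB ptB] := chart_change 0 0 0 0 lB0 kk.
  exists B => //; split.
  - by rewrite ptB !mulr0 !addr0.
  - by rewrite ptB !mulr0 !addr0.
  - by rewrite ptB !mulr0 !addr0.
  - rewrite /lin2 !ptB !mulr0 !addr0 !mulr1 ?mul0r ?addr0 (dird_lin _ _ _ _ _ _ lB0) /t /s; ring.
have [a [q [r [g [A2 [A3 AE]]]]]] := chart_expansion lB1.
have a0 : a 0%N = 0 by move: L0; rewrite A2 !expr0n /= expr1n; rewrite !mulr0 !addr0 mulr1.
have [c1 [fc1 im1 nim1]] := R1.
have [k k0 [h hE hd]] := ramification_at lB1 E1' fc1 im1.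
have a40 : a 4%N != 0.
  apply/eqP => a4; case: (fc1) => u0 ul _ _; apply: u0.
  have [s' [t' E]] := in_plane_lP lB1 ul; rewrite E; apply/(plane_eq0 lB1).
  have H x y : t' * x - s' * y = 0.
    rewrite -(evalv_plane lB1 s' t' 0 0) -E tangent_planeE -E1' (dird_lin _ _ _ _ _ _ lB1).
    by rewrite A2 A3 a0 a4; ring.
  by split; [have /eqP := H 0 1; rewrite mulr0 mulr1 sub0r oppr_eq0 => /eqP
            | have := H 1 0; rewrite mulr1 mulr0 subr0].
have hc i : (restr h P1 (pt B1 0 1 0 0))`_i = nth 0 [:: 0; - (k * a 4%N) * a 1%N;
    - (k * a 4%N) * a 2%N; - (k * a 4%N) * a 3%N] i.
  apply: coef_restr => z; rewrite -E1' ptZ ptD !mulr0 !addr0 add0r mulr1 hE !A2 !A3 a0 /=; ring.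
have ka : - (k * a 4%N) != 0 by rewrite oppr_eq0 mulf_neq0.
have /dvdXn_coef h3 := hd 0 1 isT.
have a1 : a 1%N = 0 by have /eqP := h3 1%N isT; rewrite hc /= mulf_eq0 (negbTE ka) => /eqP.
have a2 : a 2%N = 0 by have /eqP := h3 2%N isT; rewrite hc /= mulf_eq0 (negbTE ka) => /eqP.
have a30 : a 3%N != 0.
  apply/eqP => a3; apply: nim1 => _; split=> // x xl; apply/dvdXn_coef => i _.
  have [x0 [x1 [x2 [x3 Ex]]]] := ptE (proj1 lB1) x.
  move: xl; rewrite Ex => /(proj2 lB1) [-> ->].
  have [||k' _ Ec] := fiber_on_line (s := 1) (t := 0) lB1 fc1.
  - by case=> /eqP; rewrite oner_eq0.
  - by rewrite tangent_planeE -E1' (dird_lin _ _ _ _ _ _ lB1) L0; ring.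
  rewrite (@coef_restr _ _ _ _ [::]) ?nth_nil // => z.
  by rewrite -E1' ptZ ptD !mulr0 !addr0 Ec A2 a0 a1 a2 a3 /=; ring.
have tang (p : vec) kp x0 : kp != 0 -> pt B1 x0 1 0 0 = kp *: p -> ramification_index f l p 2 ->
    3%:R * a 4%N * x0 ^+ 2 + 2%:R * a 5%N * x0 + a 6%N = 0.
  move=> kp0 Ep [c [fc im _]].
  have Ep' : pt B1 (kp^-1 * x0) kp^-1 0 0 = p.
    by rewrite -[RHS]scale1r -(mulVf kp0) -scalerA -Ep ptZ !mulr0 mulr1.
  have [k' k'0 [h' hE' hd']] := ramification_at lB1 Ep' fc im.
  have /dvdXn_coef /(_ 1%N isT) := hd' 1 0 isT.
  have D y : evalv h' (p + y *: pt B1 1 0 0 0) = k' * (lin2 B1 (kp^-1 * x0) kp^-1 *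
     lin3 B1 (kp^-1 * x0 + y) kp^-1 - lin3 B1 (kp^-1 * x0) kp^-1 * lin2 B1 (kp^-1 * x0 + y) kp^-1).
    by rewrite -Ep' ptZ ptD !mulr0 !addr0 mulr1 hE'.
  set z := kp^-1 in D.
  have z0 : z != 0 by rewrite invr_eq0.
  rewrite (@coef_restr _ _ _ _ [:: 0; k' * a 3%N * z ^+ 5 * (3%:R * a 4%N * x0 ^+ 2
     + 2%:R * a 5%N * x0 + a 6%N); k' * a 3%N * z ^+ 4 * (3%:R * a 4%N * x0 + a 5%N);
     k' * a 3%N * z ^+ 3 * a 4%N]); last by move=> y; rewrite D !A2 !A3 a0 a1 a2 /=; ring.
  by move=> /= /eqP; rewrite mulf_eq0 (negbTE (mulf_neq0 (mulf_neq0 k'0 a30) (expf_neq0 5 z0))) => /eqP.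
have T2 := tang _ _ _ k20 E2' R2; have T3 := tang _ _ _ k30 E3' R3.
have a5 : a 5%N = 0.
  apply: (mulfI char2); apply: (mulfI char2); rewrite !mulr0.
  by rewrite -[RHS](subrr 0) -{1}T2 -T3; ring.
have a6 : a 6%N = - (3%:R * a 4%N).
  by apply/eqP; rewrite -addr_eq0; apply/eqP; rewrite -T2 a5; ring.
have kk : (a 3%N)^-1 * (a 4%N)^-1 - (- (a 7%N / (a 3%N * a 4%N))) * 0 != 0.
  by rewrite mulr0 subr0 mulf_neq0 // invr_eq0.
have [B lB ptB] := chart_change 0 0 0 0 lB1 kk.
have [_ [q' [r' [g' [_ [_ E]]]]]] := chart_expansion lB.
have M2 x0 x1 : lin2 B x0 x1 = x1 ^+ 3.
  rewrite /lin2 !ptB !mulr0 !addr0 !mulr1 ?mul0r ?addr0 (dird_lin _ _ _ _ _ _ lB1).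
  by rewrite A2 a0 a1 a2; field.
have M3 x0 x1 : lin3 B x0 x1 = x0 ^+ 3 - 3%:R * x0 * x1 ^+ 2.
  rewrite /lin3 !ptB !mulr0 !addr0 !mulr1 ?mul0r ?add0r (dird_lin _ _ _ _ _ _ lB1).
  by rewrite A2 A3 a0 a1 a2 a5 a6; field; rewrite a30 a40.
exists B, 1, k2^-1, k3^-1, q', r', g'; split=> //.
- by rewrite oner_eq0 !invr_eq0.
- by rewrite !ptB !mulr0 !addr0 E1' E2' E3' !scalerA !mulVf // !scale1r.
- by move=> x0 x1 x2 x3; rewrite E M2 M3 /quartic.
Qed.

End NormalForm.

Section NormalFormOfSecondKind.
Variable K : closedFieldType.
Notation vec := 'rV[K]_4.
Notation form := {mpoly K[4]}.
Hypotheses (char2 : 2%:R != 0 :> K) (char3 : 3%:R != 0 :> K).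

(** The coefficients of the parts of degree 2 and 3 in [x2], [x3] for a line of the
    second kind.  Segre's construction is the case [b = 0], and then [e] decides on
    the type of the fibration. *)
Definition nq (b e : K) : nat -> K :=
  nth 0 [:: 0; 0; 0; 3 * b; 0; 0; 3 * e; - (6 * b); - (12 * e)].
Definition nr (b e : K) : nat -> K :=
  nth 0 [:: 3 * b * e; 3 * e ^+ 2 - 3 * b ^+ 2; - (12 * b * e); - (12 * e ^+ 2);
            3 * b ^+ 2 + 3 * e ^+ 2; 0; - (12 * e ^+ 2); 0].

(** A translation of [x0], [x1] by linear forms in [x2], [x3] moves the part of
    degree 2 by the polar of the cubic. *)
Lemma translation_qform l (f : form) B B' a2 a3 c2 c3 (q r g q' r' g' : nat -> K) :
    chart_of l B ->
    (forall x0 x1 x2 x3, pt B' x0 x1 x2 x3 =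
       pt B (x0 + (a2 * x2 + a3 * x3)) (x1 + (c2 * x2 + c3 * x3)) x2 x3) ->
    (forall x0 x1 x2 x3, evalv f (pt B x0 x1 x2 x3) = quartic q r g x0 x1 x2 x3) ->
    (forall x0 x1 x2 x3, evalv f (pt B' x0 x1 x2 x3) = quartic q' r' g' x0 x1 x2 x3) ->
  forall s t x0 x1, qform q' s t x0 x1 = qform q s t x0 x1
    + 3 * t * (x0 ^+ 2 - x1 ^+ 2) * (a2 * s + a3 * t)
    + (3 * s * x1 ^+ 2 - 6 * t * x0 * x1) * (c2 * s + c3 * t).
Proof.
move=> lB ptB fE fE' s t x0 x1.
set u := a2 * s + a3 * t; set v := c2 * s + c3 * t.
pose cs := [:: 0; qform q s t x0 x1 + 3 * t * (x0 ^+ 2 - x1 ^+ 2) * u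
    + (3 * s * x1 ^+ 2 - 6 * t * x0 * x1) * v - qform q' s t x0 x1;
  fibd q r g s t u v 1 x0 x1 0 - rform r' s t x0 x1; fibc q r g s t u v 1 - gform g' s t].
suff /(_ 1%N) /eqP : forall i, nth 0 cs i = 0 by rewrite /= subr_eq0 => /eqP.
apply: (@coefs_fun_eq0 _ [:: 0; 1]) => [|k]; first by exists 1; rewrite /= !mul0r add0r mulr1 addr0 oner_eq0.
rewrite /= mul0r add0r mul1r addr0 => k0; apply: (mulfI k0).
have := fE' x0 x1 (k * s) (k * t); rewrite ptB fE !quartic_fibc.
have -> : x0 + (a2 * (k * s) + a3 * (k * t)) = x0 + k * u by rewrite /u; ring.
have -> : x1 + (c2 * (k * s) + c3 * (k * t)) = x1 + k * v by rewrite /v; ring.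
have := fibc_taylor q r g s t x0 x1 0 u v 1 k; rewrite add0r mulr1 => -> E.
move/eqP: E; rewrite -subr_eq0 => /eqP E; rewrite mulr0 -[RHS]E.
set F := fibd _ _ _ _ _ u v 1 _ _ _; set G := fibc _ _ _ _ _ u v 1.
rewrite /fibd /fib0 /fib1 /fibz /fibc.
move: F G (qform0 _ _ _ _ _) (qform1 _ _ _ _ _) (qform q' _ _ _ _) (rform r' _ _ _ _).
by move: (gform _ _ _) (qform q _ _ _ _) => *; ring.
Qed.

Variables (f : form) (l : {vspace vec}).
Hypotheses (fhomog : f \is 4.-homog) (lline : is_line l) (lX : in_surface l f).
Hypothesis l2 : second_kind f l.
Variables (P1 P2 P3 : vec).
Hypothesis Pdistinct : uniq [:: <[P1]>%VS; <[P2]>%VS; <[P3]>%VS].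
Hypothesis ramif : ramification_divisor f l [:: P1; P1; P2; P3].

(** At the ramification points [second_kind_identity] reduces to the vanishing of
    [q]; together with a translation of [x0], [x1] this leaves two parameters.  In
    the other points the identity then determines [r]. *)
Theorem normal_form : exists B k1 k2 k3 b e (g : nat -> K),
  [/\ chart_of l B, [/\ k1 != 0, k2 != 0 & k3 != 0],
      [/\ P1 = k1 *: pt B 1 0 0 0, P2 = k2 *: pt B 1 1 0 0 & P3 = k3 *: pt B (-1) 1 0 0]
    & forall x0 x1 x2 x3,
        evalv f (pt B x0 x1 x2 x3) = quartic (nq b e) (nr b e) g x0 x1 x2 x3].
Proof.
have [B0 [k1 [k2 [k3 [q [r [g [lB0 k123 PE fE]]]]]]]] :=
  normal_linear_part char2 fhomog lline lX Pdistinct ramif.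
have I0 := second_kind_identity char2 char3 lB0 fE l2.
have six : 6%:R != 0 :> K by rewrite (natrM _ 2 3) mulf_neq0.
have sq0 (x : K) : x ^+ 2 = 0 -> x = 0 by move/eqP; rewrite expf_eq0 /= => /eqP.
(* The identity is now used at the three ramification points. *)
have q0 : q 0%N = 0.
  have := I0 1 0; rewrite /qform /qform0 /= => E.
  by apply: sq0; apply: oppr_inj; rewrite oppr0 -[RHS]E; ring.
have q2 : qform q 2%:R 1 1 1 = 0.
  by have /= E := I0 1 1; apply: sq0; rewrite -[RHS]E /qform; ring.
have q3 : qform q (- 2%:R) 1 (-1) 1 = 0.
  have /= E := I0 (-1) 1; apply: sq0; apply: oppr_inj.
  by rewrite oppr0 -[RHS]E /qform; ring.
pose a2 := - (q 1%N / 3%:R); pose a3 := - (q 2%N / 3%:R).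
pose c2 := q 4%N / 6%:R; pose c3 := q 5%N / 6%:R.
have [|B lB ptB] := @chart_change _ l B0 a2 a3 c2 c3 1 0 0 1 lB0.
  by rewrite mulr1 mulr0 subr0 oner_eq0.
have {}ptB x0 x1 x2 x3 : pt B x0 x1 x2 x3 =
    pt B0 (x0 + (a2 * x2 + a3 * x3)) (x1 + (c2 * x2 + c3 * x3)) x2 x3.
  by rewrite ptB !mul1r !mul0r addr0 add0r.
have [_ [q' [r' [g' [_ [_ E]]]]]] := chart_expansion fhomog lX lB.
have M2 x0 x1 : lin2 f B x0 x1 = x1 ^+ 3.
  rewrite /lin2 !ptB !mulr0 !addr0 (dird_lin lX _ _ _ _ _ _ lB0).
  rewrite mul1r mul0r addr0 /lin2 /dird (@coef_restr _ _ _ _ [:: 0; x1 ^+ 3;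
     qform q 1 0 x0 x1; rform r 1 0 x0 x1; gform g 1 0]) // => k.
  by rewrite ptZ ptD fE /quartic /qform /rform /gform /=; ring.
have M3 x0 x1 : lin3 f B x0 x1 = x0 ^+ 3 - 3%:R * x0 * x1 ^+ 2.
  rewrite /lin3 !ptB !mulr0 !addr0 (dird_lin lX _ _ _ _ _ _ lB0).
  rewrite mul1r mul0r add0r /lin3 /dird (@coef_restr _ _ _ _ [:: 0; x0 ^+ 3 - 3%:R * x0 * x1 ^+ 2;
     qform q 0 1 x0 x1; rform r 0 1 x0 x1; gform g 0 1]) // => k.
  by rewrite ptZ ptD fE /quartic /qform /rform /gform /=; ring.
have {}E x0 x1 x2 x3 : evalv f (pt B x0 x1 x2 x3) = quartic q' r' g' x0 x1 x2 x3.
  by rewrite E M2 M3.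
pose b := q 3%N / 3%:R; pose e := (q 6%N + q 4%N / 2%:R) / 3%:R.
have Q s t x0 x1 : qform q' s t x0 x1 = qform (nq b e) s t x0 x1.
  rewrite (translation_qform lB0 ptB fE E).
  have D7 : q 7%N = - (2%:R * q 3%N) - q 1%N - q 5%N / 2%:R.
    apply: subr0_eq; apply: (mulfI (mulf_neq0 char2 char2)).
    rewrite mulr0 -[RHS](subrr 0) -{1}q2 -q3 /qform; field; exact: char2.
  have D8 : q 8%N = - (4%:R * q 6%N + 2%:R * q 4%N) - q 2%N.
    apply: subr0_eq; apply: (mulfI char2).
    rewrite mulr0 -[RHS](addr0 0) -{1}q2 -q3 /qform q0; ring.
  rewrite /qform /nq /= /a2 /a3 /c2 /c3 /b /e q0 D7 D8; field; rewrite ?char2 ?char3 ?six //.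
have I1 := second_kind_identity char2 char3 lB E l2.
have Rd x : (x ^+ 2 - 1) ^+ 2 * (rform r' (3%:R * x - x ^+ 3) 1 x 1
     - rform (nr b e) (3%:R * x - x ^+ 3) 1 x 1) = 0.
  apply: (mulfI char3); rewrite mulr0.
  have q0E s t x0 x1 : qform0 q' s t x0 x1 = 3%:R * b * s ^+ 2 * x1.
    have := Q s t 1 0; have := Q s t 1 1; have := Q s t 0 1.
    rewrite /qform /qform0 /nq /= => E1 E2 E3.
    set u := q' 0%N * s ^+ 2 + q' 1%N * s * t + q' 2%N * t ^+ 2 in E1 E2 E3 *.
    set v := q' 3%N * s ^+ 2 + q' 4%N * s * t + q' 5%N * t ^+ 2 in E1 E2 E3 *.
    set w := q' 6%N * s ^+ 2 + q' 7%N * s * t + q' 8%N * t ^+ 2 in E1 E2 E3 *.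
    have u0 : u = 0 by transitivity (u * 1 ^+ 2 + v * 1 * 0 + w * 0 ^+ 2); [ring | rewrite E3; ring].
    have vE : v = 3%:R * b * s ^+ 2.
      transitivity ((u * 1 ^+ 2 + v * 1 * 1 + w * 1 ^+ 2)
        - (u * 0 ^+ 2 + v * 0 * 1 + w * 1 ^+ 2) - u); first by ring.
      by rewrite E1 E2 u0; ring.
    by rewrite u0 vE; ring.
  have := I1 x 1; cbv zeta; rewrite q0E Q.
  have -> : - (x ^+ 3 - 3%:R * x * 1 ^+ 2) = 3%:R * x - x ^+ 3 by ring.
  rewrite !expr1n => I; rewrite -[RHS]I.
  rewrite [rform (nr _ _) _ _ _ _]/rform /qform /nq /nr /=; ring.
pose d i := r' i - nr b e i.
pose cs := [:: d 7%N; d 3%N + 3 * d 6%N; 3 * d 2%N + 9 * d 5%N;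
   9 * d 1%N + 27 * d 4%N - d 6%N; 27 * d 0%N - d 2%N - 6 * d 5%N;
   - (6 * d 1%N) - 27 * d 4%N; - (27 * d 0%N) + d 5%N; d 1%N + 9 * d 4%N; 9 * d 0%N;
   - d 4%N; - d 0%N].
have cs0 : forall i, nth 0 cs i = 0.
  apply: (@coefs_fun_eq0 _ [:: 1; 0; - 2%:R; 0; 1]) => [|x x0].
    by exists 0; rewrite /= !mulr0 !add0r oner_eq0.
  have /eqP := Rd x; rewrite mulf_eq0 (_ : (x ^+ 2 - 1) ^+ 2 = horner_rec [:: 1; 0; - 2%:R; 0; 1] x); last first.
    by rewrite /=; ring.
  by rewrite (negbTE x0) /= => /eqP E0; rewrite -[RHS]E0 /rform /d; ring.
have d0 : d 0%N = 0 by have /eqP := cs0 10%N; rewrite oppr_eq0 => /eqP.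
have d4 : d 4%N = 0 by have /eqP := cs0 9%N; rewrite oppr_eq0 => /eqP.
have d5 : d 5%N = 0 by have := cs0 6%N; rewrite /= d0 mulr0 oppr0 add0r.
have d1 : d 1%N = 0 by have := cs0 7%N; rewrite /= d4 mulr0 addr0.
have d2 : d 2%N = 0 by have /eqP := cs0 4%N; rewrite /= d0 d5 !mulr0 subr0 sub0r oppr_eq0 => /eqP.
have d6 : d 6%N = 0 by have /eqP := cs0 3%N; rewrite /= d1 d4 !mulr0 addr0 sub0r oppr_eq0 => /eqP.
have d3 : d 3%N = 0 by have := cs0 1%N; rewrite /= d6 mulr0 addr0.
have d7 : d 7%N = 0 by exact: cs0 0%N.
have r'E i : d i = 0 -> r' i = nr b e i by move/eqP; rewrite subr_eq0 => /eqP.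
exists B, k1, k2, k3, b, e, g'; split=> //.
  by rewrite !ptB !mulr0 !addr0.
move=> x0 x1 x2 x3; rewrite E /quartic Q; congr (_ + _ + _).
by rewrite /rform !r'E.
Qed.

End NormalFormOfSecondKind.

(** * Segre decompositions and fibers of type IV *)

Section ClosedFieldTools.
Variable K : closedFieldType.

Lemma exists_notin (s : seq K) : exists x, x \notin s.
Proof.
have : \prod_(a <- s) ('X - a%:P) != 0 :> {poly K}.
  by rewrite monic_neq0 // monic_prod_XsubC.
by case/closed_nonrootP => x; rewrite root_prod_XsubC; exists x.
Qed.

Lemma exists_horner_root (cs : seq K) :
  (1 < size (Poly cs))%N -> exists x, horner_rec cs x = 0.
Proof.
move=> sz; have /closed_rootP [x /rootP xr] : size (Poly cs) != 1%N by rewrite neq_ltn sz orbT.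
exists x; rewrite -xr; elim: cs {sz xr} => [|a s IH] /=; rewrite ?horner0 //.
by rewrite horner_cons -IH.
Qed.

Lemma exists_monic_root (a b c : K) :
  (exists x, x ^+ 2 + b * x + c = 0) /\ (exists x, x ^+ 3 + a * x ^+ 2 + b * x + c = 0).
Proof.
have sz (cs : seq K) : cs != [::] -> (1 < size (Poly (rcons cs (1%R : K))))%N.
  have E : Poly (rcons cs (1%R : K)) = rcons cs (1%R : K) :> seq K.
    by rewrite (PolyK (c := 0)) // last_rcons oner_eq0.
  by rewrite E size_rcons ltnS lt0n size_eq0.
split; [have [|x E] := @exists_horner_root [:: c; b; 1] | have [|x E] := @exists_horner_root [:: c; b; a; 1]].
- exact: (sz [:: c; b]).
- by exists x; rewrite -[RHS]E /=; ring.
- exact: (sz [:: c; b; a]).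
- by exists x; rewrite -[RHS]E /=; ring.
Qed.

Lemma depressed_cubic_split (p q : K) : exists a1 a2 a3, [/\ a1 + a2 + a3 = 0,
  a1 ^+ 3 + p * a1 + q = 0, a2 ^+ 3 + p * a2 + q = 0, a3 ^+ 3 + p * a3 + q = 0
  & forall x, x ^+ 3 + p * x + q = (x - a1) * (x - a2) * (x - a3)].
Proof.
have [_ [a1 E1]] := exists_monic_root 0 p q.
have {}E1 : a1 ^+ 3 + p * a1 + q = 0 by rewrite -[RHS]E1; ring.
have [[a2 E2] _] := exists_monic_root 0 a1 (a1 ^+ 2 + p).
pose a3 := - (a1 + a2).
have F x : x ^+ 3 + p * x + q = (x - a1) * (x - a2) * (x - a3).
  transitivity ((x - a1) * (x ^+ 2 + a1 * x + (a1 ^+ 2 + p)) + (a1 ^+ 3 + p * a1 + q)); first by ring.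
  rewrite E1 addr0 -mulrA; congr (_ * _).
  transitivity ((x - a2) * (x - a3) + (a2 ^+ 2 + a1 * a2 + (a1 ^+ 2 + p))); first by rewrite /a3; ring.
  by rewrite E2 addr0.
exists a1, a2, a3; split=> //; first by rewrite /a3; ring.
  by rewrite F subrr mulr0 mul0r.
by rewrite F subrr mulr0.
Qed.

End ClosedFieldTools.

Section SegreAnalysis.
Variable K : closedFieldType.
Notation vec := 'rV[K]_4.
Notation form := {mpoly K[4]}.
Hypotheses (char2 : 2%:R != 0 :> K) (char3 : 3%:R != 0 :> K).
Variables (l : {vspace vec}) (B : 'M[K]_4) (f : form) (b e : K) (g : nat -> K).
Hypothesis lB : chart_of l B.
Hypothesis fE : forall x0 x1 x2 x3,
  evalv f (pt B x0 x1 x2 x3) = quartic (nq b e) (nr b e) g x0 x1 x2 x3.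

Let Bu : B \in unitmx := proj1 lB.

Lemma plane_witness (u a : vec) : u != 0 -> a \notin <[u]>%VS ->
  exists2 w, evalv (lform u) w = 0 & evalv (lform a) w != 0.
Proof.
case/rV0Pn => k uk au.
pose w i : vec := u ord0 k *: delta_mx ord0 i - u ord0 i *: delta_mx ord0 k.
have wE (x : vec) i : evalv (lform x) (w i) = u ord0 k * x ord0 i - u ord0 i * x ord0 k.
  by rewrite evalv_lformD -scaleNr !evalv_lformZ !evalv_lform_delta mulNr.
have [i ai] : exists i, evalv (lform a) (w i) != 0.
  apply/existsP; apply: contraT; rewrite negb_exists => /forallP aw0.
  case/negP: au; apply/vlineP; exists ((u ord0 k)^-1 * a ord0 k); apply/rowP => i.
  rewrite !mxE; apply: (mulfI uk).
  have := aw0 i; rewrite negbK wE subr_eq0 => /eqP ->; field; exact: uk.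
by exists (w i) => //; rewrite wE mulrC subrr.
Qed.

(** The planes through a line form a space of dimension two. *)
Lemma free3_not_on_line m (u a d : vec) : is_line m -> in_plane m u -> in_plane m a ->
  in_plane m d -> ~ free [:: u; a; d].
Proof.
move=> dm um am dm' fr.
have [p [p0 pm]] : exists p, p <> 0 /\ p \in m.
  exists (vpick m); split; last exact: memv_pick.
  by apply/eqP; rewrite vpick0 -dimv_eq0 dm.
have [q qm qp] := line_other_point dm pm.
have [B' [lB' _ _]] := chart_of_line dm p0 qp pm qm.
have sub w : in_plane m w -> w \in (<[covec B' o2]> + <[covec B' o3]>)%VS.
  by move=> /(in_plane_lP lB') [s [t ->]]; apply/mem_span2; exists t, (- s); rewrite scaleNr.
have : (<<[:: u; a; d]>> <= <[covec B' o2]> + <[covec B' o3]>)%VS.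
  by apply/span_subvP => w; rewrite !inE => /or3P [] /eqP ->; apply: sub.
move=> /dimvS; rewrite (eqnP fr) /= => le3.
have := leq_trans le3 (dimv_add_leqif _ _).1; rewrite !dim_vline.
by case: (_ != 0); case: (_ != 0).
Qed.

(** The equations of concurrent lines are annihilated by the derivative in the
    direction of the vertex.  A singular point of the cubic lies on two of the
    lines, and these only meet in the vertex. *)
Lemma concurrent_invariant (u : vec) (c : form) s t k :
    (s, t) <> (0, 0) -> k != 0 -> u = plane B s t ->
    (forall x0 x1 z, evalv c (pt B x0 x1 (z * s) (z * t)) = k * fibc (nq b e) (nr b e) g s t x0 x1 z) ->
    kodaira_cubic IV u c ->
  exists n0 n1 nz, [/\ (n0, n1, nz) <> (0, 0, 0),
      forall v, curve_sing u c v -> v \in <[pt B n0 n1 (nz * s) (nz * t)]>%VS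
    & forall x0 x1 z, fibd (nq b e) (nr b e) g s t x0 x1 z n0 n1 nz = 0].
Proof.
move=> st k0 -> cE [a [[[h Eh] fr] [v0 [v00 uv0 av0]]]].
have [n0 [n1 [nz Ev0]]] := in_planeE lB st uv0.
exists n0, n1, nz; split=> [[E0 E1 Ez]|v [[_ uv cv] dv]|x0 x1 z].
- by apply: v00; rewrite Ev0 E0 E1 Ez !mul0r pt0.
- rewrite -Ev0; apply/negPn/negP => vv0.
  have dm : is_line (<[v0]> + <[v]>)%VS by apply: span2_line.
  have inm (w : vec) : evalv (lform w) v0 = 0 -> evalv (lform w) v = 0 ->
      in_plane (<[v0]> + <[v]>)%VS w.
    move=> w0 wv x /mem_span2 [y [y' ->]].
    by rewrite evalv_lformD !evalv_lformZ w0 wv !mulr0 addr0.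
  have um := inm _ uv0 uv.
  (* A singular point of the union of the three lines lies on two of them. *)
  have two i j : i != j -> evalv (lform (a i)) v * evalv (lform (a j)) v = 0 ->
      evalv (lform (a i)) v != 0 \/ evalv (lform (a j)) v != 0.
    move=> ij _; case: (eqVneq (evalv (lform (a i)) v) 0) => [ai|]; last by left.
    case: (eqVneq (evalv (lform (a j)) v) 0) => [aj|]; last by right.
    by case: (free3_not_on_line dm um (inm _ (av0 i) ai) (inm _ (av0 j) aj)); apply: fr.
  have dv' w : evalv (lform (plane B s t)) w = 0 -> dird (\prod_(i < 3) lform (a i)) v w = 0.
    move=> uw; have := dv w uw; rewrite dird_mderiv Eh dirdD [X in _ + X]dirdM dird_lform uw uv.
    by rewrite mul0r mul0r !addr0.
  have un0 : plane B s t != 0.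
    by apply/eqP => /(plane_eq0 lB) [s0 t0]; apply: st; rewrite s0 t0.
  have wit i j : i != j -> exists2 w, evalv (lform (plane B s t)) w = 0 & evalv (lform (a i)) w != 0.
    move=> ij; apply: (plane_witness un0).
    have := fr _ _ ij; rewrite -(perm_free (_ : perm_eq [:: a i; plane B s t; a j] _)).
      rewrite free_cons => /andP [ai _]; apply: contra ai => /vlineP [y ->].
      by apply/rpredZ/memv_span/mem_head.
    by rewrite -[[:: _; _; _]]/([:: a i] ++ [:: plane B s t] ++ [:: a j]) perm_catCA.
  pose i0 : 'I_3 := ord0; pose i1 : 'I_3 := lift ord0 ord0.
  pose i2 : 'I_3 := lift ord0 (lift ord0 ord0).
  have prodE : \prod_(i < 3) lform (a i) = lform (a i0) * (lform (a i1) * lform (a i2)).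
    by rewrite !big_ord_recl big_ord0 mulr1.
  have cv0 : evalv (lform (a i0)) v * (evalv (lform (a i1)) v * evalv (lform (a i2)) v) = 0.
    move: cv; rewrite Eh evalvD [X in _ + X]evalvM uv mul0r addr0 prodE !evalvM => ->.
    by [].
  have dvE w : evalv (lform (plane B s t)) w = 0 ->
      evalv (lform (a i0)) w * (evalv (lform (a i1)) v * evalv (lform (a i2)) v)
    + evalv (lform (a i0)) v * (evalv (lform (a i1)) w * evalv (lform (a i2)) v
        + evalv (lform (a i1)) v * evalv (lform (a i2)) w) = 0.
    by move=> /dv'; rewrite prodE !dirdM !dird_lform !evalvM.
  have [n01 n02 n12] : [/\ i0 != i1, i0 != i2 & i1 != i2] by [].
  have t01 := two _ _ n01; have t02 := two _ _ n02; have t12 := two _ _ n12.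
  have [w0 uw0 aw0] := wit _ _ n01; have [w1 uw1 aw1] := wit _ _ n12.
  have [w2 uw2 aw2] : exists2 w, evalv (lform (plane B s t)) w = 0 & evalv (lform (a i2)) w != 0.
    by apply: (wit i2 i0); rewrite eq_sym.
  have := dvE _ uw0; have := dvE _ uw1; have := dvE _ uw2; move: cv0 t01 t02 t12.
  case: (eqVneq (evalv (lform (a i0)) v) 0) => [-> _|A0].
    rewrite !mul0r => /(_ erefl) [//|A1] /(_ erefl) [//|A2] _ _ _ /eqP.
    by rewrite addr0 !mulf_eq0 (negbTE aw0) (negbTE A1) (negbTE A2).
  case: (eqVneq (evalv (lform (a i1)) v) 0) => [-> _|A1].
    rewrite !mul0r !mulr0 => _ _ /(_ erefl) [//|A2] _ /eqP + _.
    by rewrite add0r addr0 !mulf_eq0 (negbTE A0) (negbTE aw1) (negbTE A2).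
  case: (eqVneq (evalv (lform (a i2)) v) 0) => [-> _|A2].
    rewrite !mulr0 => _ _ _ /eqP + _ _.
    by rewrite !add0r !mulf_eq0 (negbTE A0) (negbTE A1) (negbTE aw2).
  by move/eqP; rewrite !mulf_eq0 (negbTE A0) (negbTE A1) (negbTE A2).
- apply: (mulfI k0); have := fiber_restr cE x0 x1 z n0 n1 nz 1; rewrite /= -Ev0 mulr0 => <-.
  set p := pt B _ _ _ _.
  have up : evalv (lform (plane B s t)) p = 0 by rewrite (evalv_plane lB); ring.
  rewrite (@coef_restr _ _ _ _ [:: evalv c p]) //= => y.
  rewrite mul0r add0r Eh !evalvD !evalvM !evalv_prod evalv_lformD evalv_lformZ uv0 up mulr0 addr0 !mul0r.
  by congr (_ + _); apply: eq_bigr => i _; rewrite evalv_lformD evalv_lformZ av0 mulr0 addr0.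
Qed.

Lemma curve_singE s t k (c : form) x0 x1 z : (s, t) <> (0, 0) -> k != 0 ->
    (forall x0 x1 z, evalv c (pt B x0 x1 (z * s) (z * t)) = k * fibc (nq b e) (nr b e) g s t x0 x1 z) ->
  curve_sing (plane B s t) c (pt B x0 x1 (z * s) (z * t)) <->
  [/\ (x0, x1, z) <> (0, 0, 0), fibc (nq b e) (nr b e) g s t x0 x1 z = 0,
      fib0 (nq b e) (nr b e) s t x0 x1 z = 0, fib1 (nq b e) (nr b e) s t x0 x1 z = 0
    & fibz (nq b e) (nr b e) g s t x0 x1 z = 0].
Proof.
move=> st k0 cE; set v := pt B _ _ _ _.
have inpl y0 y1 w : evalv (lform (plane B s t)) (pt B y0 y1 (w * s) (w * t)) = 0.
  by rewrite (evalv_plane lB); ring.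
have D y0 y1 w : \sum_(i < 4) (pt B y0 y1 (w * s) (w * t)) ord0 i * evalv (mderiv i c) v
    = k * fibd (nq b e) (nr b e) g s t x0 x1 z y0 y1 w.
  by rewrite dird_mderiv /dird (fiber_restr cE).
have v0E := plane_pt_eq0 lB x0 x1 z st.
split=> [[[v0 _ cv] dc]|[x00 C0 F0 F1 Fz]].
  have dc0 y0 y1 w : fibd (nq b e) (nr b e) g s t x0 x1 z y0 y1 w = 0.
    by apply: (mulfI k0); rewrite mulr0 -D; apply: dc.
  split; first by move/v0E.
  - by apply: (mulfI k0); rewrite mulr0 -cE.
  - by rewrite -[RHS](dc0 1 0 0) /fibd; ring.
  - by rewrite -[RHS](dc0 0 1 0) /fibd; ring.
  - by rewrite -[RHS](dc0 0 0 1) /fibd; ring.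
split; first by split; [by move/v0E | exact: inpl | rewrite cE C0 mulr0].
move=> w /(in_planeE lB st) [y0 [y1 [z' ->]]].
by rewrite D /fibd F0 F1 Fz; ring.
Qed.

(** The vertex [n] is on [l]; comparing coefficients in the identity of
    [concurrent_invariant] yields [t = 0] and [b = 0]. *)
Lemma IV_on_line_b0 : through_singular_point_of_IV f l -> b = 0.
Proof.
move=> [u [c [v [fc IVc cs vl]]]].
have [s [t [k [st k0 Eu cE]]]] := fiber_elim lB fE fc.
have [n0 [n1 [nz [n00 sing inv]]]] := concurrent_invariant st k0 Eu cE IVc.
have v0 : v <> 0 by case: cs => [[]].
(* The vertex is the singular point on the line. *)
have nz0 : nz = 0.
  have [y Ey] := vlineP _ _ (sing _ cs); move: vl v0; rewrite Ey ptZ => /(proj2 lB) [Es Et] v0.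
  have y0 : y != 0 by apply/eqP => y0; apply: v0; rewrite y0 !mul0r pt0.
  move/eqP: Es; move/eqP: Et; rewrite !mulf_eq0 (negbTE y0) /=.
  case: (eqVneq nz 0) => //= _ /eqP t0 /eqP s0; by case: st; rewrite s0 t0.
have H10 := inv 1 0 0; have H01 := inv 0 1 0; have H11 := inv 1 1 0.
have I01 := inv 0 1 1; have H00 := inv 0 0 1.
have [t0|t0] := eqVneq t 0.
  have s0 : s != 0 by apply/eqP => s0; apply: st; rewrite s0 t0.
  have n10 : n1 = 0.
    apply: (mulfI (mulf_neq0 char3 s0)); rewrite mulr0 -[RHS]H01 nz0 t0.
    by rewrite /fibd /fib0 /fib1 /fibz /qform0 /qform1 /qform /rform /nq /nr /=; ring.
  have n0n : n0 != 0 by apply/eqP => n0E; apply: n00; rewrite n0E n10 nz0.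
  apply: (mulfI (mulf_neq0 (mulf_neq0 char3 (expf_neq0 2 s0)) n0n)); rewrite mulr0.
  rewrite -[RHS](subrr 0) -[X in X - _]I01 -[X in _ - X]H00 nz0 n10 t0.
  by rewrite /fibd /fib0 /fib1 /fibz /qform0 /qform1 /qform /rform /nq /nr /=; ring.
have n0E : n0 = 0.
  apply: (mulfI (mulf_neq0 char3 t0)); rewrite mulr0 -[RHS]H10 nz0.
  by rewrite /fibd /fib0 /fib1 /fibz /qform0 /qform1 /qform /rform /nq /nr /=; ring.
have n1E : n1 = 0.
  apply: (mulfI (mulf_neq0 (mulf_neq0 char2 char3) t0)); rewrite mulr0 -[RHS](subrr 0) -[X in X - _]H01 -[X in _ - X]H11 n0E nz0.
  by rewrite /fibd /fib0 /fib1 /fibz /qform0 /qform1 /qform /rform /nq /nr /=; ring.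
by case: n00; rewrite n0E n1E nz0.
Qed.

Lemma prod4_tuple (L : 4.-tuple vec) v : evalv (\prod_(u <- L) lform u) v =
  evalv (lform (tnth L o0)) v * evalv (lform (tnth L o1)) v *
  evalv (lform (tnth L o2)) v * evalv (lform (tnth L o3)) v.
Proof.
rewrite big_tuple !big_ord_recl big_ord0 !evalvM {5}/evalv meval1 mulr1 !mulrA.
by congr (_ * _ * _ * _); congr (evalv (lform (tnth L _)) v); apply: val_inj.
Qed.

Lemma segre_planes s (L : 4.-tuple vec) : segre_decomposition f l s L ->
  exists a d : 'I_4 -> K, forall i, tnth L i = plane B (a i) (d i).
Proof.
move=> [_ _ _ lL _].
have H i : exists x : K * K, tnth L i = plane B x.1 x.2.
  have [|x [y E]] := in_plane_lP lB (u := tnth L i); last by exists (x, y).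
  by move=> v /lL.
have [x xE] := fin_all_exists H.
by exists (fun i => (x i).1), (fun i => (x i).2).
Qed.

(** Products of planes through [l] only change the part of degree 4 in [x2], [x3]. *)
Lemma segre_quartic S (L : 4.-tuple vec) : segre_decomposition f l S L ->
  exists c (h : nat -> K), [/\ c != 0,
    forall x0 x1 x2 x3, c * evalv S (pt B x0 x1 x2 x3) =
      quartic (nq b e) (nr b e) (fun i => g i - h i) x0 x1 x2 x3
  & forall x0 x1 x2 x3, c * evalv (\prod_(u <- L) lform u) (pt B x0 x1 x2 x3) = gform h x2 x3].
Proof.
move=> dec; have [a [d LE]] := segre_planes dec.
have [_ _ _ _ [c c0 fc]] := dec.
pose a0 := a o0; pose a1 := a o1; pose a2 := a o2; pose a3 := a o3.
pose d0 := d o0; pose d1 := d o1; pose d2 := d o2; pose d3 := d o3.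
pose h := nth 0 [:: c * (d0 * d1 * d2 * d3);
  - (c * (a0 * d1 * d2 * d3 + d0 * a1 * d2 * d3 + d0 * d1 * a2 * d3 + d0 * d1 * d2 * a3));
  c * (a0 * a1 * d2 * d3 + a0 * d1 * a2 * d3 + a0 * d1 * d2 * a3 + d0 * a1 * a2 * d3
       + d0 * a1 * d2 * a3 + d0 * d1 * a2 * a3);
  - (c * (a0 * a1 * a2 * d3 + a0 * a1 * d2 * a3 + a0 * d1 * a2 * a3 + d0 * a1 * a2 * a3));
  c * (a0 * a1 * a2 * a3)].
have hE x0 x1 x2 x3 : c * evalv (\prod_(u <- L) lform u) (pt B x0 x1 x2 x3) = gform h x2 x3.
  rewrite prod4_tuple !LE !(evalv_plane lB) /gform /h /=.
  by rewrite -/a0 -/a1 -/a2 -/a3 -/d0 -/d1 -/d2 -/d3; ring.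
exists c, h; split=> // x0 x1 x2 x3.
have := congr1 (fun p : form => evalv p (pt B x0 x1 x2 x3)) fc.
rewrite fE evalvZ evalvD mulrDr hE => E.
apply/eqP; rewrite -(inj_eq (addIr (gform h x2 x3))) -E; apply/eqP.
by rewrite /quartic /gform; ring.
Qed.

Variables (S : form) (c : K) (h : nat -> K).
Hypothesis c0 : c != 0.
Hypothesis SE : forall x0 x1 x2 x3, c * evalv S (pt B x0 x1 x2 x3) =
  quartic (nq b e) (nr b e) h x0 x1 x2 x3.
Hypothesis Slines : forall v, v <> 0 -> evalv S v = 0 ->
  exists m, [/\ is_line m, v \in m, in_surface m S & meets m l].

(** The value of [k] for which the line [x0 = rho x1 - k z] touches the cubic
    at its point [(rho, 1, 0)]. *)
Definition slope rho : K := b * rho * (rho ^+ 2 - 3) * (rho ^+ 2 - 2)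
   + e * (rho ^+ 2 - 1) * (rho ^+ 2 - 4).

(** The value of the residual cubic at the point [x0 = - k], [x1 = 0] of that line. *)
Definition slope_poly s k : K := gform h s 1 - k ^+ 3 - rform (nr b e) s 1 1 0 * k.

(** A line on [S] through a point of the residual cubic meets [l] in a root
    [rho] of the cubic; as it stays on [S], it is tangent there. *)
Lemma line_through_root s y0 y1 : s ^+ 2 != 4 ->
    fibc (nq b e) (nr b e) h s 1 y0 y1 1 = 0 ->
  exists rho, [/\ rho ^+ 3 - 3 * rho + s = 0, y0 = rho * y1 - slope rho
                & slope_poly s (slope rho) = 0].
Proof.
move=> s4 F0; set v := pt B y0 y1 (1 * s) (1 * 1).
have v0 : v <> 0 by move=> /(pt_eq0 Bu) [_ _ _] /eqP; rewrite mul1r oner_eq0.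
have Sv : evalv S v = 0 by apply: (mulfI c0); rewrite SE quartic_fibc F0 !mulr0.
have [m [dm vm mS ml]] := Slines v0 Sv.
have [p [p0 pm pl]] := meets_point ml.
have [a [d [a2 [a3 Ep]]]] := ptE Bu p.
move: pl p0 pm; rewrite Ep => /(proj2 lB) [-> ->] p0 pm.
have Fline k : k != 0 ->
    fibc (nq b e) (nr b e) h s 1 (a + k * y0) (d + k * y1) (0 + k * 1) = 0.
  move=> k0; apply: (mulfI k0); rewrite mulr0 add0r mulr1 -quartic_fibc -SE.
  suff -> : pt B (a + k * y0) (d + k * y1) (k * s) (k * 1) = pt B a d 0 0 + k *: v.
    by rewrite mS ?mulr0 // rpredD // rpredZ.
  by rewrite /v ptZ ptD !add0r !mul1r.
have H : forall i, nth 0 [:: fibc (nq b e) (nr b e) h s 1 a d 0;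
    fibd (nq b e) (nr b e) h s 1 a d 0 y0 y1 1; fibd (nq b e) (nr b e) h s 1 y0 y1 1 a d 0;
    fibc (nq b e) (nr b e) h s 1 y0 y1 1] i = 0.
  apply: (@coefs_fun_eq0 _ [:: 0; 1]) => [|k]; first by exists 1; rewrite /= !mul0r add0r mulr1 addr0 oner_eq0.
  rewrite /= mul0r add0r mul1r addr0 => /Fline; rewrite fibc_taylor => E.
  by rewrite -[RHS]E; ring.
have H0 : a ^+ 3 - 3 * a * d ^+ 2 + s * d ^+ 3 = 0.
  by rewrite -[RHS](H 0%N) /= /fibc; ring.
have d0 : d != 0.
  apply/eqP => d0; apply: p0; move/eqP: H0; rewrite d0 (_ : _ + _ = a ^+ 3); last by ring.
  by rewrite expf_eq0 /= => /eqP ->; rewrite pt0.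
pose rho := a / d; have aE : a = rho * d by rewrite /rho divfK.
have Hr : rho ^+ 3 - 3 * rho + s = 0.
  by apply: (mulfI (expf_neq0 3 d0)); rewrite mulr0 -[RHS]H0 aE; ring.
have sE : s = 3 * rho - rho ^+ 3 by apply: subr0_eq; rewrite -[RHS]Hr; ring.
have r1 : rho ^+ 2 - 1 != 0.
  apply: contraNneq s4 => r1; rewrite -subr_eq0.
  by apply/eqP; transitivity ((rho ^+ 2 - 1) ^+ 2 * (rho ^+ 2 - 4)); [rewrite sE; ring | rewrite r1; ring].
have y0E : y0 = rho * y1 - slope rho.
  apply: subr0_eq; apply: (mulfI (mulf_neq0 (mulf_neq0 char3 r1) (expf_neq0 2 d0))).
  rewrite mulr0 -[RHS](H 1%N) /= aE.
  rewrite /fibd /fib0 /fib1 /fibz /qform0 /qform1 /qform /rform /nq /nr /slope /= sE; ring.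
exists rho; split=> //.
have [y1d|y1d] := eqVneq y1 0.
  have := F0; rewrite y0E y1d /slope_poly => E.
  rewrite -[RHS]E /fibc /qform /rform /nq /= sE; ring.
have k0 : - (d / y1) != 0 by rewrite oppr_eq0 mulf_neq0 // invr_eq0.
have F1 := Fline _ k0.
have E1 : fibc (nq b e) (nr b e) h s 1 (- (d / y1) * (- slope rho)) 0 (- (d / y1)) = 0.
  rewrite -[RHS]F1; congr (fibc _ _ _ _ _ _ _ _); [rewrite aE y0E; field; exact: y1d
    | by field | ring].
apply: (mulfI (expf_neq0 3 k0)); rewrite mulr0 -[RHS]E1 /slope_poly /fibc /qform /nq /rform /=; ring.
Qed.

(** If the tangent line at one of the roots were not contained in [S], then for
    every [x1] the sum of the three roots [x0] of the residual cubic would be a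
    combination of the two other tangent lines; but the three roots have sum 0. *)
Lemma slope_identity rho : rho * (rho ^+ 2 - 3) * (rho ^+ 2 - 1) * (rho ^+ 2 - 4) != 0 ->
  slope_poly (3 * rho - rho ^+ 3) (slope rho) = 0.
Proof.
rewrite !mulf_eq0 !negb_or => /andP [/andP [/andP [r0 r3] r1] r4].
set s := 3 * rho - rho ^+ 3.
have s4 : s ^+ 2 != 4.
  rewrite -subr_eq0 (_ : s ^+ 2 - 4 = (rho ^+ 2 - 1) ^+ 2 * (rho ^+ 2 - 4)); last by rewrite /s; ring.
  by rewrite mulf_neq0 // expf_neq0.
have s0 : s != 0.
  by rewrite (_ : s = - (rho * (rho ^+ 2 - 3))) ?oppr_eq0 ?mulf_neq0 // /s; ring.
have [//|N] := eqVneq (slope_poly s (slope rho)) 0.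
have [[r2 E2] _] := exists_monic_root 0 rho (rho ^+ 2 - 3).
pose r2' := - (rho + r2).
have split x : x ^+ 3 - 3 * x + s = (x - rho) * (x - r2) * (x - r2').
  transitivity ((x - rho) * (x - r2) * (x - r2') + (x - rho) * (r2 ^+ 2 + rho * r2 + (rho ^+ 2 - 3))).
    by rewrite /s /r2'; ring.
  by rewrite E2 mulr0 addr0.
have root_nz x : x ^+ 3 - 3 * x + s = 0 -> x != 0 /\ x != rho \/ x = rho.
  have [->|xr] := eqVneq x rho; [by right | move=> E; left; split=> //].
  by apply: contraNneq s0 => x0; rewrite -E x0; apply/eqP; ring.
have r2r : r2 ^+ 3 - 3 * r2 + s = 0 by rewrite split; ring.
have r2'r : r2' ^+ 3 - 3 * r2' + s = 0 by rewrite split; ring.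
have rho_simple x : x ^+ 2 + rho * x + (rho ^+ 2 - 3) = 0 -> x != rho.
  move=> E; apply: contraNneq r1 => xr; apply/eqP; apply: (mulfI char3).
  by rewrite mulr0 -[RHS]E xr; ring.
have r2n : r2 != rho by apply: rho_simple.
have r2'n : r2' != rho by apply: rho_simple; rewrite -[RHS]E2 /r2'; ring.
have nz x : x ^+ 3 - 3 * x + s = 0 -> x != 0.
  by move=> E; apply: contraNneq s0 => x0; rewrite -[X in _ == X]E x0; apply/eqP; ring.
have r20 := nz _ r2r; have r2'0 := nz _ r2'r.
pose k2 := slope r2; pose k3 := slope r2'.
have n1 : r2 *+ 2 + r2' != 0.
  by rewrite (_ : _ + _ = r2 - rho) ?subr_eq0 // /r2'; ring.
have n2 : r2 + r2' *+ 2 != 0.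
  by rewrite (_ : _ + _ = r2' - rho) ?subr_eq0 // /r2'; ring.
have n0 : r2 *+ 3 != 0 by rewrite -mulr_natl mulf_neq0.
have n3 : r2' *+ 3 != 0 by rewrite -mulr_natl mulf_neq0.
have [y1 yn] := exists_notin [:: (k2 *+ 3) / (r2 *+ 3); (k2 *+ 2 + k3) / (r2 *+ 2 + r2');
   (k2 + k3 *+ 2) / (r2 + r2' *+ 2); (k3 *+ 3) / (r2' *+ 3)].
move: yn; rewrite !inE !negb_or => /and4P [y_0 y_1 y_2 y_3].
have avoid x k : x != 0 -> y1 != k / x -> x * y1 != k.
  by move=> x0; apply: contraNneq => <-; rewrite mulrAC mulfV // mul1r.
pose p := - (3 * y1 ^+ 2) + 3 * b * s ^+ 2 * y1 + rform (nr b e) s 1 1 0.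
pose q := fibc (nq b e) (nr b e) h s 1 0 y1 1.
have FE x : fibc (nq b e) (nr b e) h s 1 x y1 1 = x ^+ 3 + p * x + q.
  by rewrite /q /p /fibc /qform /rform /nq /=; ring.
have [a1 [a2 [a3 [asum A1 A2 A3 _]]]] := depressed_cubic_split p q.
have two x : x ^+ 3 + p * x + q = 0 -> x = r2 * y1 - k2 \/ x = r2' * y1 - k3.
  rewrite -FE => /(line_through_root s4) [r [rr -> rp]].
  have := rr; rewrite split => /eqP; rewrite !mulf_eq0 !subr_eq0 => /orP [/orP [] /eqP E|/eqP ->].
  - by move: N; rewrite -E rp eqxx.
  - by left; rewrite E.
  - by right.
exfalso; move: asum.
have [->|->] := two _ A1; have [->|->] := two _ A2; have [->|->] := two _ A3 => asum.
- by have /eqP := avoid _ _ n0 y_0; apply; rewrite -[RHS]addr0 -[X in _ = _ + X]asum; ring.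
- by have /eqP := avoid _ _ n1 y_1; apply; rewrite -[RHS]addr0 -[X in _ = _ + X]asum; ring.
- by have /eqP := avoid _ _ n1 y_1; apply; rewrite -[RHS]addr0 -[X in _ = _ + X]asum; ring.
- by have /eqP := avoid _ _ n2 y_2; apply; rewrite -[RHS]addr0 -[X in _ = _ + X]asum; ring.
- by have /eqP := avoid _ _ n1 y_1; apply; rewrite -[RHS]addr0 -[X in _ = _ + X]asum; ring.
- by have /eqP := avoid _ _ n2 y_2; apply; rewrite -[RHS]addr0 -[X in _ = _ + X]asum; ring.
- by have /eqP := avoid _ _ n2 y_2; apply; rewrite -[RHS]addr0 -[X in _ = _ + X]asum; ring.
- by have /eqP := avoid _ _ n3 y_3; apply; rewrite -[RHS]addr0 -[X in _ = _ + X]asum; ring.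
Qed.

(** The exceptional values of [rho]. *)
Let bad : seq K := [:: 0; - (12 : K); 0; 19; 0; - (8 : K); 0; 1].
Let badE rho : rho * (rho ^+ 2 - 3) * (rho ^+ 2 - 1) * (rho ^+ 2 - 4) = horner_rec bad rho.
Proof. by rewrite /bad /=; ring. Qed.
Let bad_ex : exists rho, horner_rec bad rho != 0.
Proof.
have [[x E3] _] := exists_monic_root (0 : K) 0 (- 3).
have [r] := exists_notin [:: 0 : K; 1; - 1; 2; - 2; x; - x].
rewrite !inE !negb_or => /and5P [r0 r1 r1' r2 /and3P [r2' rx rx']].
exists r; rewrite -badE.
have -> : r ^+ 2 - 3 = (r - x) * (r + x).
  by rewrite -[RHS]addr0 -[X in _ = _ + X]E3; ring.
rewrite (_ : r ^+ 2 - 1 = (r - 1) * (r + 1)); last by ring.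
rewrite (_ : r ^+ 2 - 4 = (r - 2) * (r + 2)); last by ring.
by rewrite !mulf_neq0 ?subr_eq0 ?addr_eq0.
Qed.

(** With [s = 3 rho - rho^3], [slope_identity] is an equation between polynomials
    in [rho]; its leading coefficient is [- b^3]. *)
Lemma segre_b0 : b = 0.
Proof.
pose g' := h.
have /(_ 15%N) /eqP : forall i, nth 0 [:: g' 4%N - 16 * e ^+ 3; 3 * g' 3%N - 72 * b * e ^+ 2;
    9 * g' 2%N + 72 * e ^+ 3 - 108 * b ^+ 2 * e;
    - (g' 3%N) + 27 * g' 1%N + 186 * b * e ^+ 2 - 54 * b ^+ 3;
    - (6 * g' 2%N) + 81 * g' 0%N - 129 * e ^+ 3 + 315 * b ^+ 2 * e;
    - (27 * g' 1%N) - 162 * b * e ^+ 2 + 297 * b ^+ 3;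
    g' 2%N - 108 * g' 0%N + 116 * e ^+ 3 - 336 * b ^+ 2 * e;
    9 * g' 1%N + 54 * b * e ^+ 2 - 423 * b ^+ 3;
    54 * g' 0%N - 54 * e ^+ 3 + 162 * b ^+ 2 * e;
    - (g' 1%N) - 6 * b * e ^+ 2 + 272 * b ^+ 3;
    - (12 * g' 0%N) + 12 * e ^+ 3 - 36 * b ^+ 2 * e; - (90 * b ^+ 3);
    g' 0%N - e ^+ 3 + 3 * b ^+ 2 * e; 15 * b ^+ 3; 0; - (b ^+ 3)] i = 0.
  apply: (coefs_fun_eq0 bad_ex) => rho; rewrite -badE => /slope_identity E.
  by rewrite -[RHS]E /slope_poly /slope /gform /rform /nr /g' /=; ring.
by rewrite /= oppr_eq0 expf_eq0 /= => /eqP.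
Qed.

(** For [b = 0] the identity [slope_identity] is one between polynomials in [s]. *)
Lemma segre_unique x2 x3 : gform h x2 x3 = e ^+ 3 * (x2 ^+ 2 - 4 * x3 ^+ 2) ^+ 2.
Proof.
have b0 := segre_b0.
have cs0 : forall i, nth 0 [:: h 4%N - 16 * e ^+ 3; h 3%N; h 2%N + 8 * e ^+ 3; h 1%N;
    h 0%N - e ^+ 3] i = 0.
  apply: (@coefs_fun_eq0 _ [:: 0; - (4 : K); 0; 1]) => [|s].
    have [s] := exists_notin [:: 0 : K; 2; - 2].
    rewrite !inE !negb_or => /and3P [s0 s2 s2']; exists s.
    rewrite (_ : horner_rec _ _ = s * (s - 2) * (s + 2)); last by rewrite /=; ring.
    by rewrite !mulf_neq0 ?subr_eq0 ?addr_eq0.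
  rewrite (_ : horner_rec _ s = s * (s ^+ 2 - 4)); last by rewrite /=; ring.
  rewrite mulf_eq0 negb_or => /andP [s0 s4].
  have [_ [rho Er]] := exists_monic_root (0 : K) (- 3) s.
  have sE : s = 3 * rho - rho ^+ 3.
    by apply: subr0_eq; rewrite -[RHS]Er; ring.
  have s4E : s ^+ 2 - 4 = (rho ^+ 2 - 1) ^+ 2 * (rho ^+ 2 - 4) by rewrite sE; ring.
  move: s4; rewrite s4E mulf_eq0 negb_or => /andP [r1 r4].
  have r1' : rho ^+ 2 - 1 != 0 by apply: contraNneq r1 => ->; rewrite expr0n.
  have r0 : rho * (rho ^+ 2 - 3) != 0.
    by rewrite -oppr_eq0 (_ : - _ = s) // sE; ring.
  have E := slope_identity (mulf_neq0 (mulf_neq0 r0 r1') r4).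
  by rewrite -[RHS]E /slope_poly /slope /gform /rform /nr b0 /= sE; ring.
have h0 : h 0%N = e ^+ 3 by apply/subr0_eq/(cs0 4%N).
have h1 : h 1%N = 0 := cs0 3%N.
have h2 : h 2%N = - (8 * e ^+ 3) by apply/eqP; rewrite -addr_eq0; apply/eqP/(cs0 2%N).
have h3 : h 3%N = 0 := cs0 1%N.
have h4 : h 4%N = 16 * e ^+ 3 by apply/subr0_eq/(cs0 0%N).
by rewrite /gform h0 h1 h2 h3 h4; ring.
Qed.

End SegreAnalysis.



(** * The ruled quartic *)

Section RuledQuartic.
Variable K : closedFieldType.
Notation vec := 'rV[K]_4.
Notation form := {mpoly K[4]}.
Hypotheses (char2 : 2%:R != 0 :> K) (char3 : 3%:R != 0 :> K).
Variable e : K.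

(** For [b = 0] this is the normal form with its part of degree 4 chosen such that
    the surface is swept out by lines. *)
Definition S4f x0 x1 x2 x3 : K :=
  x1 ^+ 3 * x2 + x3 * (x0 ^+ 3 - 3 * x0 * x1 ^+ 2)
  + 3 * e * (x2 ^+ 2 - 4 * x3 ^+ 2) * x1 ^+ 2
  + 3 * e ^+ 2 * (x2 ^+ 2 - 4 * x3 ^+ 2) * (x3 * x0 + x2 * x1)
  + e ^+ 3 * (x2 ^+ 2 - 4 * x3 ^+ 2) ^+ 2.

Lemma quartic_S4f (g : nat -> K) x0 x1 x2 x3 :
  quartic (nq 0 e) (nr 0 e) g x0 x1 x2 x3 =
  S4f x0 x1 x2 x3 + (gform g x2 x3 - e ^+ 3 * (x2 ^+ 2 - 4 * x3 ^+ 2) ^+ 2).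
Proof. rewrite /quartic /S4f /qform /rform /nq /nr /=; ring. Qed.

(** The partial derivatives of [S4f] and of a binary quartic. *)
Definition S4f0 x0 x1 x2 x3 : K :=
  3 * x3 * (x0 ^+ 2 - x1 ^+ 2 + e ^+ 2 * (x2 ^+ 2 - 4 * x3 ^+ 2)).
Definition S4f1 x0 x1 x2 x3 : K :=
  3 * x1 ^+ 2 * x2 - 6 * x0 * x1 * x3 + 6 * e * (x2 ^+ 2 - 4 * x3 ^+ 2) * x1
  + 3 * e ^+ 2 * (x2 ^+ 2 - 4 * x3 ^+ 2) * x2.
Definition S4f2 x0 x1 x2 x3 : K :=
  x1 ^+ 3 + 6 * e * x2 * x1 ^+ 2 + 6 * e ^+ 2 * x2 * (x3 * x0 + x2 * x1)
  + 3 * e ^+ 2 * (x2 ^+ 2 - 4 * x3 ^+ 2) * x1 + 4 * e ^+ 3 * (x2 ^+ 2 - 4 * x3 ^+ 2) * x2.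
Definition S4f3 x0 x1 x2 x3 : K :=
  x0 ^+ 3 - 3 * x0 * x1 ^+ 2 - 24 * e * x3 * x1 ^+ 2 - 24 * e ^+ 2 * x3 * (x3 * x0 + x2 * x1)
  + 3 * e ^+ 2 * (x2 ^+ 2 - 4 * x3 ^+ 2) * x0 - 16 * e ^+ 3 * (x2 ^+ 2 - 4 * x3 ^+ 2) * x3.
Definition gform2 (g : nat -> K) s t : K :=
  4 * g 0%N * s ^+ 3 + 3 * g 1%N * s ^+ 2 * t + 2 * g 2%N * s * t ^+ 2 + g 3%N * t ^+ 3.
Definition gform3 (g : nat -> K) s t : K :=
  g 1%N * s ^+ 3 + 2 * g 2%N * s ^+ 2 * t + 3 * g 3%N * s * t ^+ 2 + 4 * g 4%N * t ^+ 3.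

Section Derivatives.
Variables (B : 'M[K]_4) (S : form) (g : nat -> K).
Hypothesis Bu : B \in unitmx.
Hypothesis SE : forall x0 x1 x2 x3,
  evalv S (pt B x0 x1 x2 x3) = S4f x0 x1 x2 x3 + gform g x2 x3.

Lemma dird_S4f x0 x1 x2 x3 y0 y1 y2 y3 :
  dird S (pt B x0 x1 x2 x3) (pt B y0 y1 y2 y3) =
  S4f0 x0 x1 x2 x3 * y0 + S4f1 x0 x1 x2 x3 * y1
  + (S4f2 x0 x1 x2 x3 + gform2 g x2 x3) * y2 + (S4f3 x0 x1 x2 x3 + gform3 g x2 x3) * y3.
Proof.
pose d u0 u1 u2 u3 v0 v1 v2 v3 := S4f0 u0 u1 u2 u3 * v0 + S4f1 u0 u1 u2 u3 * v1
  + (S4f2 u0 u1 u2 u3 + gform2 g u2 u3) * v2 + (S4f3 u0 u1 u2 u3 + gform3 g u2 u3) * v3.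
pose F u0 u1 u2 u3 := S4f u0 u1 u2 u3 + gform g u2 u3.
rewrite /dird (@coef_restr _ _ _ _ [:: F x0 x1 x2 x3; d x0 x1 x2 x3 y0 y1 y2 y3;
  F (x0 + y0) (x1 + y1) (x2 + y2) (x3 + y3) - F x0 x1 x2 x3 - d x0 x1 x2 x3 y0 y1 y2 y3
   - d y0 y1 y2 y3 x0 x1 x2 x3 - F y0 y1 y2 y3; d y0 y1 y2 y3 x0 x1 x2 x3; F y0 y1 y2 y3]) //.
move=> k; rewrite ptZ ptD SE /= /d /F /S4f /S4f0 /S4f1 /S4f2 /S4f3 /gform2 /gform3 /gform; ring.
Qed.

Lemma sing_S4f x0 x1 x2 x3 : sing_point S (pt B x0 x1 x2 x3) <->
  [/\ (x0, x1, x2, x3) <> (0, 0, 0, 0), S4f x0 x1 x2 x3 + gform g x2 x3 = 0 &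
   [/\ S4f0 x0 x1 x2 x3 = 0, S4f1 x0 x1 x2 x3 = 0, S4f2 x0 x1 x2 x3 + gform2 g x2 x3 = 0
     & S4f3 x0 x1 x2 x3 + gform3 g x2 x3 = 0]].
Proof.
have v0E : pt B x0 x1 x2 x3 <> 0 <-> (x0, x1, x2, x3) <> (0, 0, 0, 0).
  split=> H E; apply: H; first by case: E => -> -> -> ->; rewrite pt0.
  by case/(pt_eq0 Bu): E => -> -> -> ->.
split=> [/sing_pointP [v0 Sv dS]|[x0n S0 [F0 F1 F2 F3]]].
  split; [exact/v0E | by rewrite -SE | split].
  - by have := dS (pt B 1 0 0 0); rewrite dird_S4f !mulr0 !addr0 mulr1.
  - by have := dS (pt B 0 1 0 0); rewrite dird_S4f !mulr0 !addr0 add0r mulr1.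
  - by have := dS (pt B 0 0 1 0); rewrite dird_S4f !mulr0 !addr0 !add0r mulr1.
  - by have := dS (pt B 0 0 0 1); rewrite dird_S4f !mulr0 !add0r mulr1.
apply/sing_pointP; split; [exact/v0E | by rewrite SE | move=> w].
have [y0 [y1 [y2 [y3 ->]]]] := ptE Bu w.
by rewrite dird_S4f F0 F1 F2 F3 !mul0r !addr0.
Qed.

Hypothesis Ssmooth : smooth_surface S.

Let smoothE x0 x1 x2 x3 : (x0, x1, x2, x3) <> (0, 0, 0, 0) ->
  S4f x0 x1 x2 x3 + gform g x2 x3 = 0 ->
  S4f0 x0 x1 x2 x3 = 0 -> S4f1 x0 x1 x2 x3 = 0 -> S4f2 x0 x1 x2 x3 + gform2 g x2 x3 = 0 ->
  S4f3 x0 x1 x2 x3 + gform3 g x2 x3 = 0 -> False.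
Proof. by move=> *; apply: (@Ssmooth (pt B x0 x1 x2 x3)); apply/sing_S4f. Qed.

(** If [g 0] were zero, then on the line [x1 = - e x2] of the plane [x3 = 0] only the
    derivative with respect to [x3] could be nonzero; it is a cubic polynomial and
    has a zero. *)
Lemma smooth_g0 : g 0%N != 0.
Proof.
apply/eqP => g0; have [_ [y Ey]] := exists_monic_root 0 0 (g 1%N).
apply: (@smoothE y (- e) 1 0).
- by case=> _ _ /eqP; rewrite oner_eq0.
- by rewrite /S4f /gform g0; ring.
- by rewrite /S4f0; ring.
- by rewrite /S4f1; ring.
- by rewrite /S4f2 /gform2 g0; ring.
- by rewrite /S4f3 /gform3 -[RHS]Ey; ring.
Qed.

(** If [g] vanished in the tangent plane of a simple ramification point, then this
    plane would cut the quartic twice in the line [x0 = eps x1].  Along it two of the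
    derivatives vanish and a third one has a zero; the last one then vanishes by
    Euler's relation. *)
Lemma smooth_ramified eps : eps ^+ 2 = 1 -> gform g (2 * eps) 1 != 0.
Proof.
move=> e2; apply/eqP => g0.
have [_ [y Ey]] := exists_monic_root (12 * e * eps) (36 * e ^+ 2) (gform2 g (2 * eps) 1).
have D0 : (2 * eps) ^+ 2 - 4 * 1 ^+ 2 = 0 by rewrite exprMn e2; ring.
have F2 : S4f2 (eps * y) y (2 * eps) 1 + gform2 g (2 * eps) 1 = 0.
  rewrite -[RHS]Ey /S4f2 D0; transitivity (y ^+ 3 + 12 * e * eps * y ^+ 2 + 36 * e ^+ 2 * (eps ^+ 2 * y)
     + gform2 g (2 * eps) 1); first by ring.
  by rewrite e2 mul1r.
have F1 : S4f1 (eps * y) y (2 * eps) 1 = 0 by rewrite /S4f1 D0; ring.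
have F0 : S4f0 (eps * y) y (2 * eps) 1 = 0 by rewrite /S4f0 D0 exprMn e2; ring.
have F : S4f (eps * y) y (2 * eps) 1 = 0.
  rewrite /S4f D0; transitivity ((eps ^+ 2 - 1) * eps * y ^+ 3); first by ring.
  by rewrite e2; ring.
apply: (@smoothE (eps * y) y (2 * eps) 1); rewrite ?F ?g0 ?addr0 //.
  by case=> _ _ _ /eqP; rewrite oner_eq0.
have euler : (eps * y) * S4f0 (eps * y) y (2 * eps) 1 + y * S4f1 (eps * y) y (2 * eps) 1
  + 2 * eps * (S4f2 (eps * y) y (2 * eps) 1 + gform2 g (2 * eps) 1)
  + (S4f3 (eps * y) y (2 * eps) 1 + gform3 g (2 * eps) 1)
  = 4 * (S4f (eps * y) y (2 * eps) 1 + gform g (2 * eps) 1).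
  by rewrite /S4f /S4f0 /S4f1 /S4f2 /S4f3 /gform /gform2 /gform3; ring.
by move: euler; rewrite F0 F1 F2 F g0 !mulr0 !add0r mulr0.
Qed.

(** At a double root of [g] the quartic would be singular where its plane meets the
    double curve of the ruled quartic. *)
Lemma smooth_simple_root s : gform g s 1 = 0 -> gform2 g s 1 != 0.
Proof.
move=> g0; apply/eqP => g2; have [_ [y Ey]] := exists_monic_root 0 (- 3) s.
have sE : s = 3 * y - y ^+ 3 by apply: subr0_eq; rewrite -[RHS]Ey; ring.
have g3 : gform3 g s 1 = 0.
  transitivity (4 * gform g s 1 - s * gform2 g s 1); last by rewrite g0 g2; ring.
  by rewrite /gform /gform2 /gform3; ring.
apply: (@smoothE (2 * e * (1 - y ^+ 2)) (e * (y ^+ 3 - y)) s 1); rewrite ?g0 ?g2 ?g3 ?addr0 {g0 g2 g3}.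
- by case=> _ _ _ /eqP; rewrite oner_eq0.
- by rewrite /S4f sE; ring.
- by rewrite /S4f0 sE; ring.
- by rewrite /S4f1 sE; ring.
- by rewrite /S4f2 sE; ring.
- by rewrite /S4f3 sE; ring.
Qed.

(** The restriction of [S] to the line [x0 = - 2 e x3], [x1 = - e x2], along which
    the derivatives with respect to [x0] and [x1] vanish. *)
Definition nodal (i : nat) : K := g i - nth 0 [:: 0; 0; 8 * e ^+ 3; 0; - (32 * e ^+ 3)] i.

Lemma smooth_nodal_simple_root s : gform nodal s 1 = 0 -> gform2 nodal s 1 != 0.
Proof.
move=> h0; apply/eqP => h2.
have h3 : gform3 nodal s 1 = 0.
  transitivity (4 * gform nodal s 1 - s * gform2 nodal s 1); last by rewrite h0 h2; ring.
  by rewrite /gform /gform2 /gform3; ring.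
apply: (@smoothE (- (2 * e)) (- (e * s)) s 1).
- by case=> _ _ _ /eqP; rewrite oner_eq0.
- by rewrite -[RHS]h0 /S4f /gform /nodal /=; ring.
- by rewrite /S4f0; ring.
- by rewrite /S4f1; ring.
- by rewrite -[RHS]h2 /S4f2 /gform2 /nodal /=; ring.
- by rewrite -[RHS]h3 /S4f3 /gform3 /nodal /=; ring.
Qed.

End Derivatives.

(** The derivative at a root is, up to [g 0], the product of the differences to the
    other roots. *)
Lemma gform_roots (g : nat -> K) : g 0%N != 0 ->
    (forall s, gform g s 1 = 0 -> gform2 g s 1 != 0) ->
  exists r : seq K, [/\ size r = 4%N, uniq r
    & forall s t, gform g s t = g 0%N * \prod_(x <- r) (s - x * t)].
Proof.
move=> g0 simple; pose p : {poly K} := Poly [:: g 4%N; g 3%N; g 2%N; g 1%N; g 0%N].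
have pE : polyseq p = [:: g 4%N; g 3%N; g 2%N; g 1%N; g 0%N] by rewrite (PolyK (c := 0)).
have [r Er] := closed_field_poly_normal p.
have lead : lead_coef p = g 0%N by rewrite lead_coefE pE.
have sr : size r = 4%N.
  have := congr1 (fun q : {poly K} => size q) Er.
  by rewrite lead size_scale // size_prod_XsubC pE => -[].
have gE s : gform g s 1 = g 0%N * \prod_(x <- r) (s - x).
  transitivity p.[s].
    by rewrite horner_coef pE !big_ord_recl big_ord0 /= /bump /= /gform; ring.
  rewrite Er lead hornerZ horner_prod; congr (_ * _); apply: eq_bigr => x _.
  by rewrite hornerXsubC.
case: r sr gE {Er} => [//|r0 [//|r1 [//|r2 [//|r3 [|//]]]]] _ gE.
have cs0 : forall i, nth 0 [:: g 4%N - g 0%N * (r0 * r1 * r2 * r3);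
   g 3%N + g 0%N * (r0 * r1 * r2 + r0 * r1 * r3 + r0 * r2 * r3 + r1 * r2 * r3);
   g 2%N - g 0%N * (r0 * r1 + r0 * r2 + r0 * r3 + r1 * r2 + r1 * r3 + r2 * r3);
   g 1%N + g 0%N * (r0 + r1 + r2 + r3)] i = 0.
  apply: (@coefs_fun_eq0 _ [:: 1]) => [|s _]; first by exists 0; rewrite /= mulr0 add0r oner_eq0.
  have := gE s; rewrite !big_cons big_nil => /eqP; rewrite -subr_eq0 => /eqP E.
  by rewrite -[RHS]E /gform /=; ring.
have g1 : g 1%N = - (g 0%N * (r0 + r1 + r2 + r3)).
  by apply/eqP; rewrite -addr_eq0; apply/eqP/(cs0 3%N).
have g2 : g 2%N = g 0%N * (r0 * r1 + r0 * r2 + r0 * r3 + r1 * r2 + r1 * r3 + r2 * r3).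
  by apply/subr0_eq/(cs0 2%N).
have g3 : g 3%N = - (g 0%N * (r0 * r1 * r2 + r0 * r1 * r3 + r0 * r2 * r3 + r1 * r2 * r3)).
  by apply/eqP; rewrite -addr_eq0; apply/eqP/(cs0 1%N).
have g4 : g 4%N = g 0%N * (r0 * r1 * r2 * r3).
  by apply/subr0_eq/(cs0 0%N).
exists [:: r0; r1; r2; r3]; split=> // [|s t]; last first.
  by rewrite !big_cons big_nil /gform g1 g2 g3 g4; ring.
have D0 : gform2 g r0 1 = g 0%N * ((r0 - r1) * (r0 - r2) * (r0 - r3)).
  by rewrite /gform2 g1 g2 g3; ring.
have D1 : gform2 g r1 1 = g 0%N * ((r1 - r0) * (r1 - r2) * (r1 - r3)).
  by rewrite /gform2 g1 g2 g3; ring.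
have D2 : gform2 g r2 1 = g 0%N * ((r2 - r0) * (r2 - r1) * (r2 - r3)).
  by rewrite /gform2 g1 g2 g3; ring.
have := simple r2; have := simple r1; have := simple r0.
rewrite !gE !big_cons big_nil D0 D1 D2 !subrr !(mul0r, mulr0) => /(_ erefl) + /(_ erefl) + /(_ erefl).
rewrite !mulf_eq0 !negb_or !subr_eq0 /= !inE !negb_or andbT.
by case/andP=> _ /andP [/andP [-> ->] ->] /andP [_ /andP [/andP [_ ->] ->]] /andP [_ /andP [_ ->]].
Qed.

End RuledQuartic.

(** ** The lines of the ruled quartic *)

Section RuledQuarticGeometry.
Variable K : closedFieldType.
Notation vec := 'rV[K]_4.
Notation form := {mpoly K[4]}.
Hypotheses (char2 : 2%:R != 0 :> K) (char3 : 3%:R != 0 :> K).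
Variable e : K.

(** The third root of [x^3 - 3 x + s] is [- (r1 + r2)]. *)
Lemma cubic_roots (s : K) : exists r1 r2, r1 ^+ 2 + r1 * r2 + r2 ^+ 2 = 3 /\ s = r1 * r2 * (r1 + r2).
Proof.
have [_ [r1 E1]] := exists_monic_root 0 (- 3) s.
have [[r2 E2] _] := exists_monic_root 0 r1 (r1 ^+ 2 - 3).
exists r1, r2; split; first by apply: subr0_eq; rewrite -[RHS]E2; ring.
apply: subr0_eq.
transitivity ((r1 ^+ 3 + 0 * r1 ^+ 2 + -3 * r1 + s) - r1 * (r2 ^+ 2 + r1 * r2 + (r1 ^+ 2 - 3))).
  by ring.
by rewrite E1 E2 mulr0 subrr.
Qed.

Lemma cubic_factor (r1 r2 x : K) : r1 ^+ 2 + r1 * r2 + r2 ^+ 2 = 3 ->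
  x ^+ 3 - 3 * x + r1 * r2 * (r1 + r2) = (x - r1) * (x - r2) * (x + (r1 + r2)).
Proof. by move=> <-; ring. Qed.

(** With the relation between the roots of [x^3 - 3 x + s] the plane sections
    of the ruled quartic split; [3] has to be replaced by a free variable to
    make this an identity between polynomials in the roots. *)
Lemma S4f_factor (r1 r2 x0 x1 : K) : r1 ^+ 2 + r1 * r2 + r2 ^+ 2 = 3 ->
  S4f e x0 x1 (r1 * r2 * (r1 + r2)) 1 =
  (x0 - r1 * x1 + e * (r1 ^+ 2 - 1) * (r1 ^+ 2 - 4)) *
  (x0 - r2 * x1 + e * (r2 ^+ 2 - 1) * (r2 ^+ 2 - 4)) *
  (x0 + (r1 + r2) * x1 + e * ((r1 + r2) ^+ 2 - 1) * ((r1 + r2) ^+ 2 - 4)).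
Proof.
move=> R; pose n := (r1 ^+ 2 + r1 * r2 + r2 ^+ 2) / 3.
have n1 : n = 1 by rewrite /n R divff.
pose s := r1 * r2 * (r1 + r2).
transitivity (x1 ^+ 3 * s + (x0 ^+ 3 - 3 * n * x0 * x1 ^+ 2)
  + 3 * e * (s ^+ 2 - 4 * n ^+ 3) * x1 ^+ 2 + 3 * e ^+ 2 * (s ^+ 2 - 4 * n ^+ 3) * (n * x0 + s * x1)
  + e ^+ 3 * (s ^+ 2 - 4 * n ^+ 3) ^+ 2).
  by rewrite n1 /S4f -/s; ring.
transitivity ((x0 - r1 * x1 + e * (r1 ^+ 2 - n) * (r1 ^+ 2 - 4 * n)) *
  (x0 - r2 * x1 + e * (r2 ^+ 2 - n) * (r2 ^+ 2 - 4 * n)) *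
  (x0 + (r1 + r2) * x1 + e * ((r1 + r2) ^+ 2 - n) * ((r1 + r2) ^+ 2 - 4 * n))).
  by rewrite /s /n; field.
by rewrite n1 !mulr1.
Qed.

Lemma S4f_scale k x0 x1 x2 x3 :
  S4f e (k * x0) (k * x1) (k * x2) (k * x3) = k ^+ 4 * S4f e x0 x1 x2 x3.
Proof. rewrite /S4f; ring. Qed.

Variable B : 'M[K]_4.
Hypothesis Bu : B \in unitmx.

(** The second point of the line of the ruled quartic through [(a, d)]. *)
Definition second_point a d : vec :=
  pt B (- (4 * e * d ^+ 3)) (e * (a ^+ 3 - 5 * a * d ^+ 2)) (- (a ^+ 3 - 3 * a * d ^+ 2)) (d ^+ 3).

Definition ruling a d : {vspace vec} := (<[pt B a d 0 0]> + <[second_point a d]>)%VS.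

Lemma rulingE a d k m : k *: pt B a d 0 0 + m *: second_point a d =
  pt B (k * a - m * (4 * e * d ^+ 3)) (k * d + m * (e * (a ^+ 3 - 5 * a * d ^+ 2)))
     (- (m * (a ^+ 3 - 3 * a * d ^+ 2))) (m * d ^+ 3).
Proof. by rewrite !ptZ ptD; congr (pt B _ _ _ _); ring. Qed.

Lemma S4f_ruling a d k m :
  S4f e (k * a - m * (4 * e * d ^+ 3)) (k * d + m * (e * (a ^+ 3 - 5 * a * d ^+ 2)))
     (- (m * (a ^+ 3 - 3 * a * d ^+ 2))) (m * d ^+ 3) = 0.
Proof. rewrite /S4f; ring. Qed.

(** The plane through [l] and the point cuts the ruled quartic in [l] and three
    lines of the ruling, by [S4f_factor]. *)
Lemma S4f_cover x0 x1 x2 x3 : (x0, x1, x2, x3) <> (0, 0, 0, 0) -> S4f e x0 x1 x2 x3 = 0 ->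
  exists a d k m, (a, d) <> (0, 0) /\
    pt B x0 x1 x2 x3 = k *: pt B a d 0 0 + m *: second_point a d.
Proof.
move=> xn F0; have [x30|x30] := eqVneq x3 0.
  have [x20|x20] := eqVneq x2 0.
    exists x0, x1, 1, 0; rewrite scale0r addr0 scale1r x20 x30; split=> //.
    by case=> E0 E1; apply: xn; rewrite E0 E1 x20 x30.
  have x1E : x1 = - (e * x2).
    have : x2 * (x1 + e * x2) ^+ 3 = 0 by rewrite -[RHS]F0 /S4f x30; ring.
    by move/eqP; rewrite mulf_eq0 (negbTE x20) expf_eq0 /= addr_eq0 => /eqP.
  exists 1, 0, x0, (- x2); split; first by case=> /eqP; rewrite oner_eq0.
  by rewrite rulingE x1E x30; congr (pt B _ _ _ _); ring.
have [r1 [r2 [R sE]]] := cubic_roots (x2 / x3).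
have x2E : x2 = x3 * (r1 * r2 * (r1 + r2)) by rewrite -sE mulrC divfK.
have := S4f_factor (x0 / x3) (x1 / x3) R; rewrite -sE.
have -> : S4f e (x0 / x3) (x1 / x3) (x2 / x3) 1 = 0.
  apply: (mulfI (expf_neq0 4 x30)); rewrite mulr0 -S4f_scale -[RHS]F0.
  by rewrite mulr1 ![x3 * _]mulrC !divfK.
have line r : r ^+ 3 - 3 * r + x2 / x3 = 0 ->
    x0 / x3 - r * (x1 / x3) + e * (r ^+ 2 - 1) * (r ^+ 2 - 4) = 0 ->
    exists a d k m, (a, d) <> (0, 0) /\
    pt B x0 x1 x2 x3 = k *: pt B a d 0 0 + m *: second_point a d.
  move=> cr E; exists r, 1, (x1 - x3 * (e * (r ^+ 3 - 5 * r))), x3; split.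
    by case=> _ /eqP; rewrite oner_eq0.
  rewrite rulingE; congr (pt B _ _ _ _); last by ring.
  - apply: subr0_eq.
    transitivity (x3 * (x0 / x3 - r * (x1 / x3) + e * (r ^+ 2 - 1) * (r ^+ 2 - 4))); first by field.
    by rewrite E mulr0.
  - by ring.
  - apply: subr0_eq.
    transitivity (x3 * (r ^+ 3 - 3 * r + x2 / x3)); first by field.
    by rewrite cr mulr0.
move=> /esym /eqP; rewrite !mulf_eq0 => /orP [/orP []|] /eqP E.
- by apply: (line r1); rewrite // sE (cubic_factor _ R); ring.
- by apply: (line r2); rewrite // sE (cubic_factor _ R); ring.
- apply: (line (- (r1 + r2))); first by rewrite sE (cubic_factor _ R); ring.
  by rewrite -[RHS]E; ring.
Qed.

Variable S : form.
Hypothesis SE : forall x0 x1 x2 x3, evalv S (pt B x0 x1 x2 x3) = S4f e x0 x1 x2 x3.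

Let SE0 x0 x1 x2 x3 : evalv S (pt B x0 x1 x2 x3) = S4f e x0 x1 x2 x3 + gform (fun=> 0) x2 x3.
Proof. by rewrite SE /gform; ring. Qed.

Lemma second_point_neq a d : (a, d) <> (0, 0) -> second_point a d \notin <[pt B a d 0 0]>%VS.
Proof.
move=> ad; apply/negP => /vlineP [k]; rewrite ptZ => /(pt_inj Bu) [_ _].
rewrite !mulr0 => /eqP E2 /eqP; rewrite expf_eq0 /= => /eqP d0; apply: ad; rewrite d0.
move: E2; rewrite d0 oppr_eq0 expr0n /= !mulr0 subr0 expf_eq0 /= => /eqP ->.
by [].
Qed.

Lemma pt_ad_neq0 a d : (a, d) <> (0, 0) -> pt B a d 0 0 <> 0.
Proof. by move=> ad /(pt_eq0 Bu) [a0 d0 _ _]; apply: ad; rewrite a0 d0. Qed.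

Lemma ruling_line a d : (a, d) <> (0, 0) -> is_line (ruling a d).
Proof. by move=> ad; apply: span2_line; [exact: pt_ad_neq0 | exact: second_point_neq]. Qed.

Lemma ruling_in_surface a d : in_surface (ruling a d) S.
Proof. by move=> v /mem_span2 [k [m ->]]; rewrite rulingE SE S4f_ruling. Qed.

Lemma S4_cover v : v <> 0 -> evalv S v = 0 ->
  exists a d, (a, d) <> (0, 0) /\ v \in ruling a d.
Proof.
have [x0 [x1 [x2 [x3 ->]]]] := ptE Bu v; rewrite SE => v0 /S4f_cover.
have xn : (x0, x1, x2, x3) <> (0, 0, 0, 0) by case=> E0 E1 E2 E3; apply: v0; rewrite E0 E1 E2 E3 pt0.
move=> /(_ xn) [a [d [k [m [ad ->]]]]]; exists a, d; split=> //.
by apply/mem_span2; exists k, m.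
Qed.

(** ** The singular points *)

(** In the plane of the pencil through [second_point a d], the intersection of the
    lines of the ruling through the two other points of [l] with the same tangent
    plane. *)
Definition double_point a d : vec :=
  pt B (2 * e * (d ^+ 3 - a ^+ 2 * d)) (e * (a ^+ 3 - a * d ^+ 2))
     (- (a ^+ 3 - 3 * a * d ^+ 2)) (d ^+ 3).

Let g0E s t : (gform2 (fun=> 0) s t = 0 :> K) * (gform3 (fun=> 0) s t = 0 :> K)
  * (gform (fun=> 0) s t = 0 :> K).
Proof. by rewrite /gform /gform2 /gform3; do !split; ring. Qed.

Lemma sing_S4 x0 x1 x2 x3 : sing_point S (pt B x0 x1 x2 x3) <->
  [/\ (x0, x1, x2, x3) <> (0, 0, 0, 0), S4f e x0 x1 x2 x3 = 0 &
   [/\ S4f0 e x0 x1 x2 x3 = 0, S4f1 e x0 x1 x2 x3 = 0, S4f2 e x0 x1 x2 x3 = 0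
     & S4f3 e x0 x1 x2 x3 = 0]].
Proof.
by have := sing_S4f Bu SE0 x0 x1 x2 x3; rewrite !g0E !addr0.
Qed.

Lemma double_point_sing k a d : k != 0 -> (a, d) <> (0, 0) ->
  sing_point S (k *: double_point a d).
Proof.
move=> k0 ad; rewrite /double_point ptZ; apply/sing_S4; split; last split.
- case=> E0 E1 E2 /eqP; rewrite mulf_eq0 (negbTE k0) expf_eq0 /= => /eqP d0.
  move/eqP: E2; rewrite mulf_eq0 (negbTE k0) oppr_eq0 d0 expr0n /= !mulr0 subr0 expf_eq0 /= => /eqP a0.
  by apply: ad; rewrite a0 d0.
- by rewrite /S4f; ring.
- by rewrite /S4f0; ring.
- by rewrite /S4f1; ring.
- by rewrite /S4f2; ring.
- by rewrite /S4f3; ring.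
Qed.

(** A singular point is on a line of the ruling, say through [r]; on this line the
    vanishing of the derivatives is a quadratic equation for the parameter [sg] of
    the double point, the one satisfied by the two other roots. *)
Lemma sing_is_double_point x0 x1 x2 x3 : e != 0 ->
    sing_point S (pt B x0 x1 x2 x3) ->
  exists a d k, [/\ (a, d) <> (0, 0), k != 0 & pt B x0 x1 x2 x3 = k *: double_point a d].
Proof.
move=> e0 /sing_S4 [xn F [F0 F1 F2 F3]].
have [x30|x30] := eqVneq x3 0.
  have [x20|x20] := eqVneq x2 0.
    have x10 : x1 = 0.
      move/eqP: F2; rewrite /S4f2 x20 x30 [X in X == 0](_ : _ = x1 ^+ 3); last by ring.
      by rewrite expf_eq0 /= => /eqP.
    have x00 : x0 = 0.
      move/eqP: F3; rewrite /S4f3 x20 x30 x10 [X in X == 0](_ : _ = x0 ^+ 3); last by ring.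
      by rewrite expf_eq0 /= => /eqP.
    by case: xn; rewrite x00 x10 x20 x30.
  have x1E : x1 = - (e * x2).
    have : x2 * (x1 + e * x2) ^+ 3 = 0 by rewrite -[RHS]F /S4f x30; ring.
    by move/eqP; rewrite mulf_eq0 (negbTE x20) expf_eq0 /= addr_eq0 => /eqP.
  have x00 : x0 = 0.
    move/eqP: F3; rewrite /S4f3 x30 x1E [X in X == 0](_ : _ = x0 ^+ 3); last by ring.
    by rewrite expf_eq0 /= => /eqP.
  exists 1, 0, (- x2); split; [by case=> /eqP; rewrite oner_eq0 | by rewrite oppr_eq0 |].
  by rewrite /double_point ptZ x1E x00 x30; congr (pt B _ _ _ _); ring.
pose y0 := x0 / x3; pose y1 := x1 / x3; pose s := x2 / x3.
have [E0 E1 E2] : [/\ x0 = x3 * y0, x1 = x3 * y1 & x2 = x3 * s].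
  by split; rewrite mulrC divfK.
have x33 := expf_neq0 3 x30.
have G0 : S4f0 e y0 y1 s 1 = 0.
  by apply: (mulfI x33); rewrite mulr0 -[RHS]F0 E0 E1 E2 /S4f0; ring.
have G2 : S4f2 e y0 y1 s 1 = 0.
  by apply: (mulfI x33); rewrite mulr0 -[RHS]F2 E0 E1 E2 /S4f2; ring.
have Sy : S4f e y0 y1 s 1 = 0.
  by apply: (mulfI (expf_neq0 4 x30)); rewrite mulr0 -S4f_scale -E0 -E1 -E2 mulr1.
suff [sg [sE y0E y1E]] : exists sg, [/\ s = 3 * sg - sg ^+ 3, y0 = 2 * e * (1 - sg ^+ 2)
    & y1 = e * (sg ^+ 3 - sg)].
  exists sg, 1, x3; split=> //; first by case=> _ /eqP; rewrite oner_eq0.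
  by rewrite /double_point ptZ E0 E1 E2 sE y0E y1E; congr (pt B _ _ _ _); ring.
have [r [sE y0E]] : exists r, s = 3 * r - r ^+ 3 /\ y0 = r * y1 - e * (r ^+ 2 - 1) * (r ^+ 2 - 4).
  have [r1 [r2 [R sE]]] := cubic_roots s.
  have sr r : r ^+ 3 - 3 * r + s = 0 -> s = 3 * r - r ^+ 3.
    by move=> E; apply: subr0_eq; rewrite -[RHS]E; ring.
  have := S4f_factor y0 y1 R; rewrite -sE Sy => /esym /eqP.
  rewrite !mulf_eq0 => /orP [/orP []|] /eqP E.
  - exists r1; split; first by apply: sr; rewrite sE (cubic_factor _ R); ring.
    by apply: subr0_eq; rewrite -[RHS]E; ring.
  - exists r2; split; first by apply: sr; rewrite sE (cubic_factor _ R); ring.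
    by apply: subr0_eq; rewrite -[RHS]E; ring.
  - exists (- (r1 + r2)); split; first by apply: sr; rewrite sE (cubic_factor _ R); ring.
    by apply: subr0_eq; rewrite -[RHS]E; ring.
have [r1|r1] := eqVneq (r ^+ 2 - 1) 0.
  have r2 : r ^+ 2 = 1 by apply/eqP; rewrite -subr_eq0 r1.
  have {}sE : s = 2 * r by rewrite sE exprS r2; ring.
  have {}y0E : y0 = r * y1 by rewrite y0E r2; ring.
  have : y1 * (y1 + 6 * e * r) ^+ 2 = 0.
    rewrite -[RHS]G2 /S4f2 y0E sE.
    transitivity (y1 ^+ 3 + 12 * e * r * y1 ^+ 2 + 36 * e ^+ 2 * r ^+ 2 * y1); first by ring.
    rewrite r2; transitivity (y1 ^+ 3 + 12 * e * r * y1 ^+ 2 + (12 * e ^+ 2 * r ^+ 2 + 24 * e ^+ 2 * r ^+ 2) * y1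
      + (3 * e ^+ 2 * y1 + 8 * e ^+ 3 * r) * (4 * r ^+ 2 - 4)); first by rewrite r2; ring.
    by ring.
  move/eqP; rewrite mulf_eq0 expf_eq0 /= addr_eq0 => /orP [/eqP y10|/eqP y1E].
    by exists r; rewrite sE y0E y10 exprS r2; split; ring.
  exists (- (2 * r)); rewrite sE y0E y1E exprNn !exprMn (_ : r ^+ 3 = r); last by rewrite exprS r2 mulr1.
  by split; rewrite ?sqrrN ?exprMn ?r2; [ring | | ring];
     transitivity (- (6 * e * r ^+ 2)); [ring | rewrite r2; ring].
pose sg := (y1 / e - r ^+ 3 + 3 * r) / 2.
have y1E : y1 = e * (2 * sg + r ^+ 3 - 3 * r) by rewrite /sg; field; rewrite e0 char2.
have Q : sg ^+ 2 + r * sg + r ^+ 2 - 3 = 0.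
  have k0 : 3%:R * (r ^+ 2 - 1) * (2%:R * 2%:R * e ^+ 2) != 0.
    by rewrite !mulf_neq0 // expf_neq0.
  apply: (mulfI k0); rewrite mulr0 -[RHS]G0 /S4f0 y0E y1E sE; ring.
have sgE : sg ^+ 3 = 3 * sg + r ^+ 3 - 3 * r.
  apply: subr0_eq.
  transitivity ((sg - r) * (sg ^+ 2 + r * sg + r ^+ 2 - 3)); [by ring | by rewrite Q mulr0].
exists sg; split.
- by rewrite sgE sE; ring.
- rewrite y0E y1E; apply: subr0_eq.
  transitivity (2 * e * (sg ^+ 2 + r * sg + r ^+ 2 - 3)); [by ring | by rewrite Q mulr0].
- by rewrite y1E sgE; ring.
Qed.

Lemma sing_e0 x0 x1 x2 x3 : e = 0 -> sing_point S (pt B x0 x1 x2 x3) <->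
  (x0, x1, x2, x3) <> (0, 0, 0, 0) /\ x0 = 0 /\ x1 = 0.
Proof.
move=> e0; split=> [/sing_S4 [xn _ [_ _ F2 F3]]|[xn [x00 x10]]]; last first.
  apply/sing_S4; split=> //; rewrite x00 x10 e0 /S4f /S4f0 /S4f1 /S4f2 /S4f3; first by ring.
  by split; ring.
have x10 : x1 = 0.
  move/eqP: F2; rewrite /S4f2 e0 [X in X == 0](_ : _ = x1 ^+ 3); last by ring.
  by rewrite expf_eq0 /= => /eqP.
have x00 : x0 = 0.
  move/eqP: F3; rewrite /S4f3 e0 x10 [X in X == 0](_ : _ = x0 ^+ 3); last by ring.
  by rewrite expf_eq0 /= => /eqP.
by [].
Qed.

End RuledQuarticGeometry.

(** ** Irreducibility and the double curve *)

Section RuledQuarticIrreducible.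
Variable K : closedFieldType.
Notation vec := 'rV[K]_4.
Notation form := {mpoly K[4]}.
Hypotheses (char2 : 2%:R != 0 :> K) (char3 : 3%:R != 0 :> K).
Variables (e : K) (B : 'M[K]_4) (S : form).
Hypothesis Bu : B \in unitmx.
Hypothesis SE : forall x0 x1 x2 x3, evalv S (pt B x0 x1 x2 x3) = S4f e x0 x1 x2 x3.

Lemma S4_zero_at_0 : evalv S 0 = 0.
Proof. by rewrite -(pt0 B) SE /S4f; ring. Qed.

(** The points of the ruled quartic are the values of a polynomial map, so one
    of two factors of the equation vanishes on all of them. *)
Lemma S4_factor_vanishes (a b : form) : S = a * b ->
  (forall v, evalv S v = 0 -> evalv a v = 0) \/ (forall v, evalv S v = 0 -> evalv b v = 0).
Proof.
move=> E.
pose A : form := 'X_o0; pose D : form := 'X_o1; pose k : form := 'X_o2; pose m : form := 'X_o3.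
pose x0 := k * A - m * ((4 * e)%:MP * D ^+ 3).
pose x1 := k * D + m * (e%:MP * (A ^+ 3 - 5%:R * A * D ^+ 2)).
pose x2 := - (m * (A ^+ 3 - 3%:R * A * D ^+ 2)).
pose x3 := m * D ^+ 3.
pose s := [tuple x0 * (B o0 i)%:MP + x1 * (B o1 i)%:MP + x2 * (B o2 i)%:MP + x3 * (B o3 i)%:MP | i < 4].
have sE (h : form) (y : vec) : evalv (h \mPo s) y =
    evalv h (y ord0 o2 *: pt B (y ord0 o0) (y ord0 o1) 0 0
      + y ord0 o3 *: second_point e B (y ord0 o0) (y ord0 o1)).
  have XE i : evalv 'X_i y = y ord0 i by rewrite /evalv mevalXU.
  rewrite {1}/evalv comp_mpoly_meval /evalv; apply: meval_eq => i.
  rewrite rulingE tnth_mktuple -/(evalv _ _) 3!evalvD 4!evalvM 4!evalvC.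
  have -> : evalv x0 y = y ord0 o2 * y ord0 o0 - y ord0 o3 * (4 * e * y ord0 o1 ^+ 3).
    by rewrite /x0 evalvB 3!evalvM evalvC evalvX !XE.
  have -> : evalv x1 y = y ord0 o2 * y ord0 o1 + y ord0 o3 * (e * (y ord0 o0 ^+ 3 - 5%:R * y ord0 o0 * y ord0 o1 ^+ 2)).
    by rewrite /x1 evalvD 3!evalvM evalvC evalvB evalvX 2!evalvM evalvX evalv_nat !XE.
  have -> : evalv x2 y = - (y ord0 o3 * (y ord0 o0 ^+ 3 - 3%:R * y ord0 o0 * y ord0 o1 ^+ 2)).
    by rewrite /x2 evalvN evalvM evalvB evalvX 2!evalvM evalvX evalv_nat !XE.
  have -> : evalv x3 y = y ord0 o3 * y ord0 o1 ^+ 3 by rewrite /x3 evalvM evalvX !XE.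
  by rewrite /pt mxE big_ord4 !mxE.
have van (h : form) : h \mPo s = 0 -> forall v, evalv S v = 0 -> evalv h v = 0.
  move=> h0 v Sv; have val A' D' k' m' :
      evalv h (k' *: pt B A' D' 0 0 + m' *: second_point e B A' D') = 0.
    have := sE h (row4 A' D' k' m'); rewrite h0 !mxE /= => <-.
    by rewrite /evalv meval0.
  have [->|v0] := eqVneq v 0.
    by have := val 0 0 0 0; rewrite !scale0r addr0.
  have [a' [d' [_ /mem_span2 [k' [m' ->]]]]] := S4_cover char3 Bu SE (elimN eqP v0) Sv.
  exact: val.
have : (a \mPo s) * (b \mPo s) = 0.
  rewrite -rmorphM -E /=; apply: evalv_fun_eq => y.
  by rewrite sE rulingE SE S4f_ruling /evalv meval0.
move/eqP; rewrite mulf_eq0 => /orP [] /eqP H; [left | right]; exact: van H.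
Qed.

(** A cubic that contains the projection of the singular points from the point
    (1 : 0 : 0 : 0). *)
Definition sing_projection x1 x2 x3 : K :=
  (x1 + e * x2) ^+ 3 - 12 * e ^+ 2 * x3 ^+ 2 * (x1 + e * x2) + 8 * e ^+ 3 * x3 ^+ 2 * x2.

Lemma sing_projection_eq0 x0 x1 x2 x3 : sing_point S (pt B x0 x1 x2 x3) ->
  sing_projection x1 x2 x3 = 0.
Proof.
have [e0|e0] := eqVneq e 0.
  move=> /(sing_e0 Bu SE _ _ _ _ e0) [_ [_ x10]].
  by rewrite /sing_projection x10 e0; ring.
move=> /(sing_is_double_point char2 char3 Bu SE e0) [a [d [k [_ _]]]].
rewrite /double_point ptZ => /(pt_inj Bu) [_ -> -> ->].
by rewrite /sing_projection; ring.
Qed.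

Lemma polyC_of_no_root (P : {poly K}) : (forall x, P.[x] != 0) -> forall x, P.[x] = P.[0].
Proof.
move=> nr x; have [/closed_rootP [y /rootP y0]|/negPn /eqP sz] := boolP (size P != 1%N).
  by have := nr y; rewrite y0 eqxx.
by rewrite (size1_polyC (eq_leq sz)) !hornerC.
Qed.

Lemma nowhere_zero_unit (b : form) : (forall v, evalv b v != 0) -> b \is a GRing.unit.
Proof.
move=> b0; have bc : b = (evalv b 0)%:MP.
  apply: evalv_fun_eq => v; rewrite evalvC.
  have := @polyC_of_no_root (restr b 0 v) _ 1.
  by rewrite !restr_horner scale1r scale0r add0r addr0; apply=> x; rewrite restr_horner.
rewrite bc; apply/unitrP; exists (evalv b 0)^-1%:MP.
by rewrite -!mpolyCM mulVf ?mulfV ?b0.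
Qed.

(** If one factor vanishes on the whole surface, then the surface is singular in
    the zeros of the other one.  So the other factor has no zeros on a general
    line in the direction of the first coordinate; it does not depend on this
    coordinate, and then a zero would give a line of singular points that does
    not exist. *)
Lemma S4_cofactor_unit (a b : form) : S = a * b ->
  (forall v, evalv S v = 0 -> evalv a v = 0) -> b \is a GRing.unit.
Proof.
move=> E va.
have bsing v : evalv b v = 0 -> evalv a v = 0 by move=> bv; apply: va; rewrite E evalvM bv mulr0.
have bs v : v <> 0 -> evalv b v = 0 -> sing_point S v.
  move=> v0 bv; apply/sing_pointP; split=> // [|w]; first by rewrite E evalvM bv mulr0.
  by rewrite E dirdM bv (bsing _ bv) mulr0 mul0r addr0.
have [N _ NE] : form_fun 3 (fun v => sing_projection (evalv (X B o1) v) (evalv (X B o2) v) (evalv (X B o3) v)).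
  by rewrite /sing_projection; by_degree.
have gen x0 x1 x2 x3 : sing_projection x1 x2 x3 != 0 ->
    evalv b (pt B x0 x1 x2 x3) = evalv b (pt B 0 x1 x2 x3).
  move=> N0; pose P := restr b (pt B 0 x1 x2 x3) (pt B 1 0 0 0).
  have PE x : P.[x] = evalv b (pt B x x1 x2 x3).
    by rewrite restr_horner ptZ ptD !mulr0 !addr0 add0r mulr1.
  rewrite -!PE; apply: polyC_of_no_root => x; rewrite PE.
  apply/eqP => bx; have x0n : pt B x x1 x2 x3 <> 0.
    move=> /(pt_eq0 Bu) [_ x10 x20 x30]; move: N0; rewrite x10 x20 x30 /sing_projection.
    by rewrite (_ : _ + _ = 0) ?eqxx //; ring.
  by move: N0; rewrite (sing_projection_eq0 (bs _ x0n bx)) eqxx.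
pose b' : form := b \mPo [tuple 'X_i - B o0 i *: X B o0 | i < 4].
have b'E x0 x1 x2 x3 : evalv b' (pt B x0 x1 x2 x3) = evalv b (pt B 0 x1 x2 x3).
  rewrite /evalv comp_mpoly_meval; apply: meval_eq => i.
  rewrite tnth_mktuple -/(evalv _ _) evalvB evalvZ (X0_pt Bu) {1}/evalv mevalXU.
  by rewrite /pt !mxE !big_ord4 !mxE /=; ring.
have bb' : b = b'.
  apply: subr0_eq.
  have N0 : N != 0.
    apply/eqP => N0; have := NE (pt B 0 1 0 0); rewrite !(Xpt Bu) N0 /evalv meval0 /sing_projection.
    by move=> /eqP; rewrite (_ : _ + _ = 1) ?(eq_sym 0) ?oner_eq0 //; ring.
  apply: (mulfI N0); rewrite mulr0; apply: evalv_fun_eq => v.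
  have [x0 [x1 [x2 [x3 ->]]]] := ptE Bu v.
  rewrite evalvM evalvB b'E NE !(Xpt Bu) [RHS]/evalv meval0.
  have [->|/(gen x0) ->] := eqVneq (sing_projection x1 x2 x3) 0; first by rewrite mul0r.
  by rewrite subrr mulr0.
have bx x0 x1 x2 x3 : evalv b (pt B x0 x1 x2 x3) = evalv b (pt B 0 x1 x2 x3).
  by rewrite {1}bb' b'E.
apply: nowhere_zero_unit => v; have [x0 [x1 [x2 [x3 ->]]]] := ptE Bu v.
rewrite bx; apply/eqP => b0.
have sing y : y != 0 -> sing_point S (pt B y x1 x2 x3).
  move=> y0; apply: bs; last by rewrite bx.
  by move=> /(pt_eq0 Bu) [y0']; rewrite y0' eqxx in y0.
have F y : y != 0 -> S4f0 e y x1 x2 x3 = 0 /\ S4f3 e y x1 x2 x3 = 0.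
  by move=> /sing /(sing_S4 Bu SE) [_ _ [? _ _ ?]].
have c3 : forall i, nth 0 [:: 3 * x3 * (e ^+ 2 * (x2 ^+ 2 - 4 * x3 ^+ 2) - x1 ^+ 2); 0; 3 * x3] i = 0.
  apply: (@coefs_fun_eq0 _ [:: 0; 1]) => [|y]; first by exists 1; rewrite /= !mul0r add0r mulr1 addr0 oner_eq0.
  rewrite /= mul0r add0r mul1r addr0 => /F [E0 _]; rewrite -[RHS]E0 /S4f0; ring.
have x30 : x3 = 0 by have /eqP := c3 2%N; rewrite /= mulf_eq0 (negbTE char3) => /eqP.
have /(_ 3%N) /eqP : forall i, nth 0 [:: 0; - (3 * x1 ^+ 2) + 3 * e ^+ 2 * x2 ^+ 2; 0; 1] i = 0 :> K.
  apply: (@coefs_fun_eq0 _ [:: 0; 1]) => [|y]; first by exists 1; rewrite /= !mul0r add0r mulr1 addr0 oner_eq0.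
  rewrite /= mul0r add0r mul1r addr0 => /F [_ E3]; rewrite -[RHS]E3 /S4f3 x30; ring.
by rewrite /= oner_eq0.
Qed.

Lemma S4_irreducible : irreducible_form S.
Proof.
split.
- apply/eqP => S0; have E x0 x1 x2 x3 : S4f e x0 x1 x2 x3 = 0.
    by rewrite -SE S0 /evalv meval0.
  have /(_ 3%N) /eqP : forall i, nth 0 [:: 16 * e ^+ 3; - (12 * e ^+ 2); 0; 1] i = 0 :> K.
    apply: (@coefs_fun_eq0 _ [:: 1]) => [|y _]; first by exists 0; rewrite /= mulr0 add0r oner_eq0.
    by rewrite -[RHS](E y 0 0 1) /S4f /=; ring.
  by rewrite /= oner_eq0.
- apply/negP => /unitrP [t [tS _]]; have := congr1 (fun h : form => evalv h 0) tS.
  by rewrite /= evalvM S4_zero_at_0 mulr0 /evalv meval1 => /eqP; rewrite eq_sym oner_eq0.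
move=> a b E; have [va|vb] := S4_factor_vanishes E; last left; first right.
  exact: S4_cofactor_unit E va.
by apply: (@S4_cofactor_unit b a) => //; rewrite mulrC.
Qed.

(** The tangent planes along [l] show that a vertex would be on [l]; then the
    surface would lie in the tangent plane of its vertex. *)
Lemma S4_not_cone : ~ cone_over_planar_curve S.
Proof.
move=> [v [u [n [c [uv _ coneS]]]]].
have line x : x <> 0 -> evalv S x = 0 -> forall k, evalv S (v + k *: x) = 0 /\ evalv S (x + k *: v) = 0.
  move=> x0 /(coneS _ x0) [q [q0 uq cq xq]] k.
  have inc y : y \in (<[v]> + <[q]>)%VS -> evalv S y = 0.
    move=> yq; have [->|y0] := eqVneq y 0; first exact: S4_zero_at_0.
    by apply/coneS; [exact/eqP | exists q].
  have vq : v \in (<[v]> + <[q]>)%VS by by exact: span2_left.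
  by split; apply: inc; [apply: rpredD => //; apply: rpredZ | apply: rpredD => //; apply: rpredZ].
have [y0 [y1 [y2 [y3 Ev]]]] := ptE Bu v.
have SE0 x0 x1 x2 x3 : evalv S (pt B x0 x1 x2 x3) = S4f e x0 x1 x2 x3 + gform (fun=> 0) x2 x3.
  by rewrite SE /gform; ring.
have g0E s t : (gform2 (fun=> 0) s t = 0 :> K) * (gform3 (fun=> 0) s t = 0 :> K).
  by rewrite /gform2 /gform3; split; ring.
have dv x : x <> 0 -> evalv S x = 0 -> dird S x v = 0 /\ dird S v x = 0.
  move=> x0 Sx; rewrite /dird !(@coef_restr _ _ _ _ [::]) // => k.
    by case: (line x x0 Sx k).
  by case: (line x x0 Sx k).
have onl a d : (a, d) <> (0, 0) -> d ^+ 3 * y2 + (a ^+ 3 - 3 * a * d ^+ 2) * y3 = 0.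
  move=> ad; have [||E _] := dv (pt B a d 0 0); first exact: (pt_ad_neq0 Bu).
    by rewrite SE /S4f; ring.
  by rewrite -[RHS]E Ev (dird_S4f SE0) !g0E /S4f0 /S4f1 /S4f2 /S4f3; ring.
have y30 : y3 = 0.
  by rewrite -[RHS](onl 1 0); [ring | case=> /eqP; rewrite oner_eq0].
have y20 : y2 = 0.
  by rewrite -[RHS](onl 0 1); [ring | case=> /eqP; rewrite oner_eq0].
have sec a d : (a, d) <> (0, 0) -> - (a ^+ 3 - 3 * a * d ^+ 2) * y1 ^+ 3
    + d ^+ 3 * (y0 ^+ 3 - 3 * y0 * y1 ^+ 2) = 0.
  move=> ad; have [||_ E] := dv (second_point e B a d).
  - by move=> E; have := second_point_neq e Bu ad; rewrite E mem0v.
  - by apply: (ruling_in_surface SE (a := a) (d := d)); exact: span2_right.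
  rewrite -[RHS]E Ev y20 y30 (dird_S4f SE0) !g0E /S4f0 /S4f1 /S4f2 /S4f3; ring.
have y10 : y1 = 0.
  have : - (y1 ^+ 3) = 0 by rewrite -[RHS](sec 1 0); [ring | case=> /eqP; rewrite oner_eq0].
  by move/eqP; rewrite oppr_eq0 expf_eq0 /= => /eqP.
have y00 : y0 = 0.
  have : y0 ^+ 3 = 0 by rewrite -[RHS](sec 0 1); [rewrite y10; ring | case=> /eqP; rewrite oner_eq0].
  by move/eqP; rewrite expf_eq0 /= => /eqP.
by apply: uv; rewrite Ev y00 y10 y20 y30 pt0 evalv_lform0.
Qed.

Lemma S4_ruled : ruled_surface S.
Proof.
split; [exact: S4_irreducible | | exact: S4_not_cone] => v v0 Sv.
have [a [d [ad vr]]] := S4_cover char3 Bu SE v0 Sv.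
by exists (ruling e B a d); split=> //; [exact: ruling_line | exact: ruling_in_surface].
Qed.

(** The four cubics that parametrize the double points are linearly independent for
    [e != 0]. *)
Lemma sing_S4_twisted : e != 0 -> is_twisted_cubic (sing_point S).
Proof.
move=> e0; have [|M Mu ME] := @basis_chart _ (pt B 0 e (- 1) 0) (pt B (- (2 * e)) 0 0 0)
   (pt B 0 (- e) 3 0) (pt B (2 * e) 0 0 1).
  move=> v; have [x0 [x1 [x2 [x3 ->]]]] := ptE Bu v.
  pose y2 := (x2 + x1 / e) / 2.
  exists (y2 + x1 / e), (x3 - x0 / (2 * e)), y2, x3.
  by rewrite !ptZ !ptD /y2; congr (pt B _ _ _ _); field; rewrite ?e0 ?char2.
have ME' a d : (\row_(j < 4) (a ^+ (3 - j) * d ^+ j)) *m M = double_point e B a d.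
  have -> : (\row_(j < 4) (a ^+ (3 - j) * d ^+ j)) = row4 (a ^+ 3) (a ^+ 2 * d) (a * d ^+ 2) (d ^+ 3).
    by apply/rowP; apply: ord4P; rewrite !mxE /= ?subn0 ?subnn ?expr0 ?expr1 ?mulr1 ?mul1r.
  rewrite -/(pt M _ _ _ _) ME !ptZ !ptD /double_point; congr (pt B _ _ _ _); ring.
have dp0 a d : (a, d) <> (0, 0) -> double_point e B a d <> 0.
  by move=> ad; have := double_point_sing Bu SE (oner_neq0 _) ad; rewrite scale1r => -[].
exists M => // v v0; split=> [|[a [d [ad]]]].
  have [x0 [x1 [x2 [x3 ->]]]] := ptE Bu v.
  move=> /(sing_is_double_point char2 char3 Bu SE e0) [a [d [k [ad k0 E]]]].
  by exists a, d; split=> //; rewrite ME' E; apply/vline_eqP; [exact: dp0 | exists k].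
by rewrite ME' => /(vline_eqP _ (dp0 _ _ ad)) [k k0 ->]; apply: double_point_sing.
Qed.

Lemma sing_S4_line : e = 0 -> is_line_set (sing_point S).
Proof.
move=> e0; exists (<[pt B 0 0 1 0]> + <[pt B 0 0 0 1]>)%VS.
  apply: span2_line.
    by case/(pt_eq0 Bu) => _ _ /eqP; rewrite oner_eq0.
  apply/negP => /vlineP [k]; rewrite ptZ => /(pt_inj Bu) [_ _ _ /eqP].
  by rewrite mulr0 oner_eq0.
move=> v v0; have [x0 [x1 [x2 [x3 Ev]]]] := ptE Bu v.
have comb k m : k *: pt B 0 0 1 0 + m *: pt B 0 0 0 1 = pt B 0 0 k m.
  by rewrite !ptZ ptD !mulr0 !mulr1 !addr0 add0r.
split=> [|/mem_span2 [k [m E]]].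
  rewrite Ev => /(sing_e0 Bu SE _ _ _ _ e0) [_ [-> ->]].
  by apply/mem_span2; exists x2, x3.
rewrite E comb; apply/(sing_e0 Bu SE _ _ _ _ e0); split=> // -[k0 m0].
by apply: v0; rewrite E comb k0 m0 pt0.
Qed.

(** Three of the points of a twisted cubic are not collinear. *)
Lemma twisted_cubic_not_line (A : vec -> Prop) : is_twisted_cubic A -> ~ is_line_set A.
Proof.
move=> [M Mu MA] [m dm mA].
have on a d x : (a, d) <> (0, 0) -> x = pt M (a ^+ 3) (a ^+ 2 * d) (a * d ^+ 2) (d ^+ 3) ->
    x <> 0 -> x \in m.
  move=> ad xE x0; apply/mA => //; apply/MA => //; exists a, d; split=> //.
  rewrite xE /pt; congr (<[_ *m _]>)%VS.
  by apply/rowP; apply: ord4P; rewrite !mxE /= ?subn0 ?subnn ?expr0 ?expr1 ?mulr1 ?mul1r.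
have n1 : (1 : K) <> 0 by apply/eqP; rewrite oner_eq0.
have p0 : pt M 1 0 0 0 \in m.
  apply: (on 1 0); [by case | by rewrite !expr1n !expr0n /= !mulr0 | by case/(pt_eq0 Mu)].
have p1 : pt M 0 0 0 1 \in m.
  apply: (on 0 1); [by case | by rewrite !expr1n !expr0n /= !mul0r | by case/(pt_eq0 Mu)].
have p2 : pt M 1 1 1 1 \in m.
  apply: (on 1 1); [by case | by rewrite !expr1n !mulr1 | by case/(pt_eq0 Mu)].
have q0 : pt M 1 0 0 0 <> 0 by case/(pt_eq0 Mu).
have q1 : pt M 0 0 0 1 \notin <[pt M 1 0 0 0]>%VS.
  apply/negP => /vlineP [k]; rewrite ptZ => /(pt_inj Mu) [_ _ _].
  by rewrite mulr0.
move: p2; rewrite (line_eq_span2 dm q0 q1 p0 p1) => /mem_span2 [k [k']].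
by rewrite !ptZ ptD !mulr0 !addr0 => /(pt_inj Mu) [].
Qed.

End RuledQuarticIrreducible.

(** * Quartics in Segre's form *)

Section SegreForm.
Variable K : closedFieldType.
Notation vec := 'rV[K]_4.
Notation form := {mpoly K[4]}.
Hypotheses (char2 : 2%:R != 0 :> K) (char3 : 3%:R != 0 :> K).
Variables (e : K) (h : nat -> K) (l : {vspace vec}) (B : 'M[K]_4) (f : form).
Hypothesis lB : chart_of l B.
Hypothesis fh : forall x0 x1 x2 x3,
  evalv f (pt B x0 x1 x2 x3) = quartic (nq 0 e) (nr 0 e) h x0 x1 x2 x3.

Let Bu : B \in unitmx := proj1 lB.

(** The coefficients of the difference of [f] and the ruled quartic. *)
Definition rest : nat -> K := fun i => h i - nth 0 [:: e ^+ 3; 0; - (8 * e ^+ 3); 0; 16 * e ^+ 3] i.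

Lemma gform_rest s t : gform rest s t = gform h s t - e ^+ 3 * (s ^+ 2 - 4 * t ^+ 2) ^+ 2.
Proof. by rewrite /gform /rest /=; ring. Qed.

Lemma fE x0 x1 x2 x3 : evalv f (pt B x0 x1 x2 x3) = S4f e x0 x1 x2 x3 + gform rest x2 x3.
Proof. by rewrite fh quartic_S4f gform_rest. Qed.

Lemma plane_inj s t s' t' : plane B s t = plane B s' t' -> s = s' /\ t = t'.
Proof.
move=> E; have H a d : t * a - s * d = t' * a - s' * d.
  by rewrite -(evalv_plane lB s t 0 0) E (evalv_plane lB).
split; last by have := H 1 0; rewrite !mulr1 !mulr0 !subr0.
by have := H 0 1; rewrite !mulr1 !mulr0 !sub0r => /oppr_inj.
Qed.

Lemma planeZ k s t : k *: plane B s t = plane B (k * s) (k * t).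
Proof. by rewrite /plane scalerBr !scalerA. Qed.

(** The residual cubic for [b = 0], with its derivatives. *)
Definition cub s t x0 x1 z : K :=
  s * x1 ^+ 3 + t * (x0 ^+ 3 - 3 * x0 * x1 ^+ 2) + 3 * e * (s ^+ 2 - 4 * t ^+ 2) * x1 ^+ 2 * z
  + 3 * e ^+ 2 * (s ^+ 2 - 4 * t ^+ 2) * (t * x0 + s * x1) * z ^+ 2
  + (e ^+ 3 * (s ^+ 2 - 4 * t ^+ 2) ^+ 2 + gform rest s t) * z ^+ 3.
Definition cub0 s t x0 x1 z : K :=
  3 * t * (x0 ^+ 2 - x1 ^+ 2 + e ^+ 2 * (s ^+ 2 - 4 * t ^+ 2) * z ^+ 2).
Definition cub1 s t x0 x1 z : K :=
  3 * s * x1 ^+ 2 - 6 * t * x0 * x1 + 6 * e * (s ^+ 2 - 4 * t ^+ 2) * x1 * z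
  + 3 * e ^+ 2 * (s ^+ 2 - 4 * t ^+ 2) * s * z ^+ 2.
Definition cubz s t x0 x1 z : K :=
  3 * e * (s ^+ 2 - 4 * t ^+ 2) * x1 ^+ 2
  + 6 * e ^+ 2 * (s ^+ 2 - 4 * t ^+ 2) * (t * x0 + s * x1) * z
  + 3 * (e ^+ 3 * (s ^+ 2 - 4 * t ^+ 2) ^+ 2 + gform rest s t) * z ^+ 2.

Lemma fibc_cub s t x0 x1 z : fibc (nq 0 e) (nr 0 e) h s t x0 x1 z = cub s t x0 x1 z.
Proof. by rewrite /cub gform_rest /fibc /qform /rform /nq /nr /=; ring. Qed.
Lemma fib0_cub s t x0 x1 z : fib0 (nq 0 e) (nr 0 e) s t x0 x1 z = cub0 s t x0 x1 z.
Proof. by rewrite /cub0 /fib0 /qform0 /rform /nq /nr /=; ring. Qed.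
Lemma fib1_cub s t x0 x1 z : fib1 (nq 0 e) (nr 0 e) s t x0 x1 z = cub1 s t x0 x1 z.
Proof. by rewrite /cub1 /fib1 /qform1 /rform /nq /nr /=; ring. Qed.
Lemma fibz_cub s t x0 x1 z : fibz (nq 0 e) (nr 0 e) h s t x0 x1 z = cubz s t x0 x1 z.
Proof. by rewrite /cubz gform_rest /fibz /qform /rform /nq /nr /=; ring. Qed.

Definition cubd s t x0 x1 z y0 y1 w : K :=
  cub0 s t x0 x1 z * y0 + cub1 s t x0 x1 z * y1 + cubz s t x0 x1 z * w.

Lemma fibd_cub s t x0 x1 z y0 y1 w :
  fibd (nq 0 e) (nr 0 e) h s t x0 x1 z y0 y1 w = cubd s t x0 x1 z y0 y1 w.
Proof. by rewrite /fibd fib0_cub fib1_cub fibz_cub. Qed.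

Definition is_fiber_eq s t (c : form) : Prop :=
  exists2 k, k != 0 & forall x0 x1 z, evalv c (pt B x0 x1 (z * s) (z * t)) = k * cub s t x0 x1 z.

Lemma fiber_cub u c : fiber f l u c ->
  exists s t, [/\ (s, t) <> (0, 0), u = plane B s t & is_fiber_eq s t c].
Proof.
move=> /(fiber_elim lB fh) [s [t [k [st k0 uE cE]]]]; exists s, t; split=> //.
by exists k => // x0 x1 z; rewrite cE fibc_cub.
Qed.

Lemma fiber_plane_cub s t c : fiber f l (plane B s t) c -> (s, t) <> (0, 0) /\ is_fiber_eq s t c.
Proof. by move=> /fiber_cub [s' [t' [st /plane_inj [-> ->] cE]]]. Qed.

Lemma fiber_plane_exists s t : (s, t) <> (0, 0) -> exists2 c, fiber f l (plane B s t) c & is_fiber_eq s t c.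
Proof.
move=> st; have [c fc] := fiber_exists lB fh erefl st.
by exists c => //; case: (fiber_plane_cub fc).
Qed.

Lemma fiber_eq_restr s t c k :
    (forall x0 x1 z, evalv c (pt B x0 x1 (z * s) (z * t)) = k * cub s t x0 x1 z) ->
  forall x0 x1 z y0 y1 w i,
  (restr c (pt B x0 x1 (z * s) (z * t)) (pt B y0 y1 (w * s) (w * t)))`_i =
  k * nth 0 [:: cub s t x0 x1 z; cubd s t x0 x1 z y0 y1 w;
             cubd s t y0 y1 w x0 x1 z; cub s t y0 y1 w] i.
Proof.
move=> cE x0 x1 z y0 y1 w i.
rewrite (@fiber_restr _ B (nq 0 e) (nr 0 e) h c s t k).
  by rewrite !fibc_cub !fibd_cub.
by move=> *; rewrite cE fibc_cub.
Qed.

Lemma l_ptE p : p \in l -> exists a d, p = pt B a d 0 0.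
Proof.
have [x0 [x1 [x2 [x3 ->]]]] := ptE Bu p.
by move=> /(proj2 lB) [-> ->]; exists x0, x1.
Qed.

Lemma pt_in_l a d : pt B a d 0 0 \in l.
Proof. by apply/(proj2 lB). Qed.

Lemma tangent_plane_l a d :
  tangent_plane f (pt B a d 0 0) = plane B (- (a ^+ 3 - 3 * a * d ^+ 2)) (d ^+ 3).
Proof.
apply: lform_inj => v; have [y0 [y1 [y2 [y3 ->]]]] := ptE Bu v.
rewrite tangent_planeE (evalv_plane lB) (dird_S4f fE).
by rewrite /S4f0 /S4f1 /S4f2 /S4f3 /gform2 /gform3; ring.
Qed.

Lemma tangent_st_neq0 (a d : K) : (a, d) <> (0, 0) -> (- (a ^+ 3 - 3 * a * d ^+ 2), d ^+ 3) <> (0, 0).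
Proof.
move=> ad [/eqP E /eqP]; rewrite expf_eq0 /= => /eqP d0; apply: ad; rewrite d0.
move: E; rewrite d0 [X in X == 0](_ : _ = - (a ^+ 3)); last by ring.
by rewrite oppr_eq0 expf_eq0 /= => /eqP ->.
Qed.

(** ** The surface of inflection tangents *)

(** The three zeros are the ramification points. *)
Definition ramified (a d : K) : bool := d * (a ^+ 2 - d ^+ 2) == 0.

Lemma ramified_singular a d : ramified a d ->
  let s := - (a ^+ 3 - 3 * a * d ^+ 2) in let t := d ^+ 3 in
  [/\ cub s t a d 0 = 0, cub0 s t a d 0 = 0, cub1 s t a d 0 = 0 & cubz s t a d 0 = 0].
Proof.
move=> /eqP r0 s t; split.
- by rewrite /cub /s /t; ring.
- transitivity (3 * d ^+ 2 * (d * (a ^+ 2 - d ^+ 2))); last by rewrite r0 mulr0.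
  by rewrite /cub0 /t; ring.
- transitivity (- 3 * a * d * (d * (a ^+ 2 - d ^+ 2))); last by rewrite r0 mulr0.
  by rewrite /cub1 /s /t; ring.
- transitivity (3 * e * (a ^+ 2 - d ^+ 2) * (a ^+ 2 - 4 * d ^+ 2) * d * (d * (a ^+ 2 - d ^+ 2)));
    last by rewrite r0 mulr0.
  by rewrite /cubz /s /t; ring.
Qed.

(** The fiber is smooth at an unramified point, and its tangent there is the line of
    the ruling. *)
Lemma frakS_unramified m a d : (a, d) <> (0, 0) -> ~~ ramified a d -> is_line m ->
  (in_plane m (tangent_plane f (pt B a d 0 0)) /\
   exists2 c, fiber_at f l (pt B a d 0 0) c & imult_ge c m (pt B a d 0 0) 2) <->
  m = ruling e B a d.
Proof.
move=> ad nr dm; set p := pt B a d 0 0.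
pose s := - (a ^+ 3 - 3 * a * d ^+ 2); pose t := d ^+ 3.
have st : (s, t) <> (0, 0) := tangent_st_neq0 ad.
have TE : tangent_plane f p = plane B s t by exact: tangent_plane_l.
have pE : p = pt B a d (0 * s) (0 * t) by rewrite !mul0r.
have r0 : 3%:R * d * (d * (a ^+ 2 - d ^+ 2)) != 0.
  by apply: mulf_neq0 => //; apply: mulf_neq0 => //; apply: contra nr; rewrite /ramified => /eqP ->; rewrite mul0r.
have D y0 y1 w : cubd s t a d 0 y0 y1 w =
    3%:R * d * (d * (a ^+ 2 - d ^+ 2)) * (d * y0 - a * y1 + e * (a ^+ 2 - d ^+ 2) * (a ^+ 2 - 4%:R * d ^+ 2) * w).
  by rewrite /cubd /cub0 /cub1 /cubz /s /t; ring.
have secE : second_point e B a d = pt B (- (4%:R * e * d ^+ 3)) (e * (a ^+ 3 - 5%:R * a * d ^+ 2)) (1 * s) (1 * t).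
  by rewrite /second_point !mul1r.
have d0 : d != 0 by apply: contra nr => /eqP ->; rewrite /ramified mul0r.
split=> [[mT [c fc im]]|->].
  have [pm {}im] := im isT.
  move: fc; rewrite /fiber_at TE => /fiber_plane_cub [_ [k k0 cE]].
  have sub q : q \in m -> q \in ruling e B a d.
    move=> qm; have := mT _ qm; rewrite TE => /(in_planeE lB st) [y0 [y1 [w Eq]]].
    have /dvdXn_coef /(_ 1%N isT) := im _ qm.
    rewrite pE Eq (fiber_eq_restr cE) /= => /eqP; rewrite mulf_eq0 (negbTE k0) /= D mulf_eq0 (negbTE r0) /=.
    move=> /eqP E; apply/mem_span2.
    exists ((y1 - w * (e * (a ^+ 3 - 5%:R * a * d ^+ 2))) / d), w.
    rewrite rulingE; congr (pt B _ _ _ _).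
    - apply: (mulfI d0); apply/eqP; rewrite -subr_eq0 -[X in _ == X]E; apply/eqP; field; exact: d0.
    - by field.
    - by rewrite /s; ring.
  apply/eqP; rewrite eqEdim; apply/andP; split; first by apply/subvP => q; apply: sub.
  by rewrite dm (ruling_line e Bu ad).
have [c fc cE] := fiber_plane_exists st.
have inpl q : q \in ruling e B a d -> exists y0 y1 w, q = pt B y0 y1 (w * s) (w * t) /\
     d * y0 - a * y1 + e * (a ^+ 2 - d ^+ 2) * (a ^+ 2 - 4%:R * d ^+ 2) * w = 0.
  move=> /mem_span2 [k [w ->]]; rewrite rulingE.
  exists (k * a - w * (4%:R * e * d ^+ 3)), (k * d + w * (e * (a ^+ 3 - 5%:R * a * d ^+ 2))), w.
  by split; [congr (pt B _ _ _ _); rewrite /s; ring | ring].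
split.
  move=> q /inpl [y0 [y1 [w [-> _]]]]; rewrite TE (evalv_plane lB); ring.
exists c; first by rewrite /fiber_at TE.
move=> _; split; first exact: span2_left.
move=> q /inpl [y0 [y1 [w [-> E]]]]; apply/dvdXn_coef => i i2.
have [k k0 {}cE] := cE; rewrite pE (fiber_eq_restr cE).
case: i i2 => [|[|//]] _ /=; last by rewrite D E !mulr0.
by rewrite (_ : cub _ _ _ _ _ = 0) ?mulr0 // /cub /s /t; ring.
Qed.

(** At a ramification point the fiber is singular, so every line of the tangent plane
    through the point has multiplicity at least 2. *)
Lemma frakS_ramified m a d : (a, d) <> (0, 0) -> ramified a d -> is_line m ->
  pt B a d 0 0 \in m -> in_plane m (tangent_plane f (pt B a d 0 0)) -> frakS f l m.
Proof.
move=> ad r0 dm pm mT; split=> //.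
have [C0 F0 F1 Fz] := ramified_singular r0; cbv zeta in C0, F0, F1, Fz.
have [c fc [k k0 cE]] := fiber_plane_exists (tangent_st_neq0 ad).
exists (pt B a d 0 0), c; split=> //; [exact: (pt_ad_neq0 Bu) | exact: pt_in_l | split].
  by rewrite /fiber_at tangent_plane_l.
move=> _; split=> // q qm; apply/dvdXn_coef => i i2.
have := mT _ qm; rewrite tangent_plane_l => /(in_planeE lB (tangent_st_neq0 ad)) [y0 [y1 [w ->]]].
set s := - _ in C0 F0 F1 Fz cE *; set t := d ^+ 3 in C0 F0 F1 Fz cE *.
have -> : pt B a d 0 0 = pt B a d (0 * s) (0 * t) by rewrite !mul0r.
rewrite (fiber_eq_restr cE).
by case: i i2 => [|[|//]] _ /=; rewrite ?C0 ?mulr0 // /cubd F0 F1 Fz; ring.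
Qed.

Variable S : form.
Hypothesis SE : forall x0 x1 x2 x3, evalv S (pt B x0 x1 x2 x3) = S4f e x0 x1 x2 x3.

Lemma S8_zeros v : v <> 0 ->
  S8 f l v <-> (exists a d, [/\ (a, d) <> (0, 0), ramified a d
                   & evalv (lform (tangent_plane f (pt B a d 0 0))) v = 0]) \/ evalv S v = 0.
Proof.
move=> v0; split=> [[m [dm [p [c [p0 pl mT [fc im]]]]] vm]|].
  have [a [d Ep]] := l_ptE pl; have ad : (a, d) <> (0, 0).
    by case=> a0 d0; apply: p0; rewrite Ep a0 d0 pt0.
  have [r0|r0] := boolP (ramified a d).
    by left; exists a, d; split=> //; rewrite -Ep; apply: mT.
  right; apply: (ruling_in_surface SE (a := a) (d := d)).
  suff <- : m = ruling e B a d by [].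
  apply/(frakS_unramified ad r0 dm); rewrite -Ep; split=> //; by exists c.
have ram a d : (a, d) <> (0, 0) -> ramified a d ->
    evalv (lform (tangent_plane f (pt B a d 0 0))) v = 0 -> S8 f l v.
  move=> ad r0 Tv; set p := pt B a d 0 0 in Tv.
  have p0 : p <> 0 by exact: (pt_ad_neq0 Bu).
  have pT : evalv (lform (tangent_plane f p)) p = 0.
    by rewrite tangent_plane_l (evalv_plane lB); ring.
  have [vp|vp] := boolP (v \in <[p]>%VS).
    have [q ql qp] : exists2 q, evalv (lform (tangent_plane f p)) q = 0 & q \notin <[p]>%VS.
      have [|q ql qp] := @line_other_point _ (ruling e B a d) p (ruling_line e Bu ad).
        exact: span2_left.
      exists q => //; move: ql => /mem_span2 [k [m' ->]].
      by rewrite tangent_plane_l rulingE (evalv_plane lB); ring.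
    exists (<[p]> + <[q]>)%VS; last by rewrite -[v]addr0 memv_add // mem0v.
    apply: (frakS_ramified ad r0 (span2_line p0 qp)).
      exact: span2_left.
    by move=> x /mem_span2 [k [k' ->]]; rewrite evalv_lformD !evalv_lformZ pT ql !mulr0 addr0.
  exists (<[p]> + <[v]>)%VS; last exact: span2_right.
  apply: (frakS_ramified ad r0 (span2_line p0 vp)).
    exact: span2_left.
  by move=> x /mem_span2 [k [k' ->]]; rewrite evalv_lformD !evalv_lformZ pT Tv !mulr0 addr0.
case=> [[a [d [ad r0 Tv]]]|Sv]; first exact: ram Tv.
have [a [d [ad vr]]] := S4_cover char3 Bu SE v0 Sv.
have [r0|r0] := boolP (ramified a d).
  apply: (ram a d ad r0); move: vr => /mem_span2 [k [m' ->]].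
  by rewrite tangent_plane_l rulingE (evalv_plane lB); ring.
exists (ruling e B a d) => //; split; first exact: (ruling_line e Bu ad).
have [_ /(_ erefl) [mT [c fc im]]] := frakS_unramified ad r0 (ruling_line e Bu ad).
by exists (pt B a d 0 0), c; split=> //; [exact: (pt_ad_neq0 Bu) | exact: pt_in_l].
Qed.

(** The four factors are irreducible and pairwise not proportional. *)
Lemma S8_equation (k1 k2 k3 : K) (P1 P2 P3 : vec) : k1 != 0 -> k2 != 0 -> k3 != 0 ->
  P1 = k1 *: pt B 1 0 0 0 -> P2 = k2 *: pt B 1 1 0 0 -> P3 = k3 *: pt B (-1) 1 0 0 ->
  reduced_equation (S8 f l) (lform (tangent_plane f P1) * lform (tangent_plane f P2)
     * lform (tangent_plane f P3) * S).
Proof.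
move=> k10 k20 k30 E1 E2 E3.
have T1E : tangent_plane f P1 = k1 ^+ 3 *: plane B (- 1) 0.
  by rewrite E1 ptZ !mulr0 tangent_plane_l planeZ; congr plane; ring.
have T2E : tangent_plane f P2 = k2 ^+ 3 *: plane B 2 1.
  by rewrite E2 ptZ !mulr0 tangent_plane_l planeZ; congr plane; ring.
have T3E : tangent_plane f P3 = k3 ^+ 3 *: plane B (- 2) 1.
  by rewrite E3 ptZ !mulr0 tangent_plane_l planeZ; congr plane; ring.
have n1 : (1 : K) <> 0 by apply/eqP; rewrite oner_eq0.
have pn s t : (s, t) <> (0, 0) -> plane B s t != 0.
  by move=> st; apply/eqP => /(plane_eq0 lB) [s0 t0]; apply: st; rewrite s0 t0.
have p1 : plane B (- 1) 0 != 0.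
  by apply: pn => -[] /eqP; rewrite oppr_eq0 oner_eq0.
have p2 : plane B 2 1 != 0 by apply: pn => -[].
have p3 : plane B (- 2) 1 != 0 by apply: pn => -[].
have lfn u : u != 0 -> lform u != 0 :> form.
  apply: contra => /eqP u0; apply/eqP/lform_inj => v.
  by rewrite u0 lform0.
split.
- rewrite T1E T2E T3E !lformZ !mulf_neq0 ?scaler_eq0 ?negb_or ?expf_neq0 ?lfn //.
  by case: (S4_irreducible char2 char3 Bu SE).
- move=> a b.
  rewrite T1E T2E T3E !lformZ -!scalerAl -!scalerAr -?scalerAl !scalerA.
  set k := _ * _ => E.
  have k0 : k != 0 by rewrite /k !mulf_neq0 ?expf_neq0.
  have {E} [b' E] : exists b', lform (plane B (- 1) 0) * (lform (plane B 2 1) * (lform (plane B (- 2) 1) * S)) = a ^+ 2 * b'.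
    by exists (k^-1 *: b); rewrite -scalerAr -E scalerA mulVf // scale1r !mulrA.
  (* The square of [a] is prime to each plane, as some point of the plane is not on
     the other factors; so the plane can be cancelled. *)
  have cancel s t (R : form) (c : form) v : plane B s t != 0 ->
      evalv (lform (plane B s t)) v = 0 -> evalv R v != 0 ->
      lform (plane B s t) * R = a ^+ 2 * c -> exists c', R = a ^+ 2 * c'.
    move=> st sv Rv Ec.
    have nd : forall q, a <> lform (plane B s t) * q.
      move=> q aE; have ER : lform (plane B s t) * R = lform (plane B s t) * (lform (plane B s t) * (q ^+ 2 * c)).
        by rewrite Ec aE; ring.
      by move: Rv; rewrite (mulfI (lfn _ st) ER) evalvM sv mul0r eqxx.
    case: (lform_prime st (esym Ec)) => [[q aE]|[q cE]].
      case: (lform_prime st (etrans (esym (expr2 a)) aE)) => [[q' aE']|[q' aE']]; by case: (nd q').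
    exists q; apply: (mulfI (lfn _ st)); rewrite Ec cE; ring.
  have ev s t x0 x1 x2 x3 := evalv_plane lB s t x0 x1 x2 x3.
  have n4 : 4%:R != 0 :> K by rewrite (natrM _ 2 2) mulf_neq0.
  have [|| b2 {}E] := cancel _ _ _ _ (pt B 0 (1 - e) 1 0) p1 _ _ E.
  + by rewrite ev; ring.
  + rewrite !evalvM !ev SE [X in X != 0](_ : _ = 1) ?oner_eq0 // /S4f; ring.
  have [|| b3 {}E] := cancel _ _ _ _ (pt B 1 0 2 1) p2 _ _ E.
  + by rewrite ev; ring.
  + rewrite !evalvM !ev SE [X in X != 0](_ : _ = 4%:R) // /S4f; ring.
  have [|| b4 {}E] := cancel _ _ _ _ (pt B 1 0 (- 2) 1) p3 _ _ E.
  + by rewrite ev; ring.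
  + rewrite SE [X in X != 0](_ : _ = 1) ?oner_eq0 // /S4f; ring.
  have [_ _ irr] := S4_irreducible char2 char3 Bu SE.
  have [//|] : a \is a GRing.unit \/ a * b4 \is a GRing.unit.
    by apply: irr; rewrite mulrA -expr2.
  by rewrite unitrM => /andP [].
- move=> v v0; rewrite !evalvM T1E T2E T3E !lformZ !evalvZ.
  have k1n : k1 ^+ 3 != 0 by rewrite expf_neq0.
  have k2n : k2 ^+ 3 != 0 by rewrite expf_neq0.
  have k3n : k3 ^+ 3 != 0 by rewrite expf_neq0.
  move: (k1 ^+ 3) (k2 ^+ 3) (k3 ^+ 3) k1n k2n k3n => c1 c2 c3 k1n k2n k3n.
  have tE a d s t : - (a ^+ 3 - 3 * a * d ^+ 2) = s -> d ^+ 3 = t ->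
      tangent_plane f (pt B a d 0 0) = plane B s t by move=> <- <-; exact: tangent_plane_l.
  have t1 : tangent_plane f (pt B 1 0 0 0) = plane B (- 1) 0 by apply: tE; ring.
  have t2 : tangent_plane f (pt B 1 1 0 0) = plane B 2 1 by apply: tE; ring.
  have t3 : tangent_plane f (pt B (- 1) 1 0 0) = plane B (- 2) 1 by apply: tE; ring.
  rewrite S8_zeros //; split=> [/eqP|[[a [d [ad r0 Tv]]]|->]]; last by rewrite mulr0.
    rewrite !mulf_eq0 (negbTE k1n) (negbTE k2n) (negbTE k3n) /=.
    case/orP=> [/orP [/orP []|]|] /eqP E; last by right.
    + left; exists 1, 0; split; rewrite ?t1 //; first by case.
      by rewrite /ramified mul0r.
    + left; exists 1, 1; split; rewrite ?t2 //; first by case.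
      by rewrite /ramified subrr mulr0.
    + left; exists (- 1), 1; split; rewrite ?t3 //; first by case.
      by rewrite /ramified sqrrN subrr mulr0.
  move: Tv; rewrite tangent_plane_l => Tv.
  move: r0; rewrite /ramified mulf_eq0 subr_eq0 eqf_sqr.
  have scale s t s' t' k : k != 0 -> plane B s t = k *: plane B s' t' ->
      evalv (lform (plane B s t)) v = 0 -> evalv (lform (plane B s' t')) v = 0.
    move=> k0 ->; rewrite lformZ evalvZ => /eqP; rewrite mulf_eq0 (negbTE k0) /=.
    by move/eqP.
  have dn (x : K) : x <> 0 -> x ^+ 3 != 0 by move/eqP => xn; rewrite expf_neq0.
  case/or3P => /eqP E.
  + have a0 : a <> 0 by move=> a0; apply: ad; rewrite a0 E.
    rewrite (scale _ _ _ _ _ (dn _ a0) _ Tv) ?mulr0 ?mul0r //.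
    by rewrite planeZ E; congr plane; ring.
  + have d0 : d <> 0 by move=> d0; apply: ad; rewrite E d0.
    rewrite (scale _ _ 2 1 _ (dn _ d0) _ Tv) ?mulr0 ?mul0r //.
    by rewrite planeZ E; congr plane; ring.
  + have d0 : d <> 0 by move=> d0; apply: ad; rewrite E d0 oppr0.
    rewrite (scale _ _ (- 2) 1 _ (dn _ d0) _ Tv) ?mulr0 ?mul0r //.
    by rewrite planeZ E; congr plane; ring.
Qed.

End SegreForm.

(** ** Triplets of coplanar lines *)

Section Triplets.
Variable K : closedFieldType.
Notation vec := 'rV[K]_4.
Notation form := {mpoly K[4]}.
Hypotheses (char2 : 2%:R != 0 :> K) (char3 : 3%:R != 0 :> K).
Variables (e : K) (h : nat -> K) (l : {vspace vec}) (B : 'M[K]_4) (f : form).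
Hypothesis lB : chart_of l B.
Hypothesis fh : forall x0 x1 x2 x3,
  evalv f (pt B x0 x1 x2 x3) = quartic (nq 0 e) (nr 0 e) h x0 x1 x2 x3.
Hypothesis lline : is_line l.
Hypothesis fsmooth : smooth_surface f.

Let Bu : B \in unitmx := proj1 lB.
Let g := rest e h.
Let fE := fE fh.

Lemma plane_unique m q (u u' : vec) : is_line m -> q \notin m -> u <> 0 ->
  in_plane m u -> in_plane m u' -> evalv (lform u) q = 0 -> evalv (lform u') q = 0 ->
  exists k, u' = k *: u.
Proof.
move=> dm qm u0 mu mu' uq uq'.
have [p [p0 pm]] : exists p, p <> 0 /\ p \in m.
  exists (vpick m); split; last exact: memv_pick.
  by apply/eqP; rewrite vpick0 -dimv_eq0 dm.
have [p' pm' pp'] := line_other_point dm pm.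
have [B' [lB' _ _]] := chart_of_line dm p0 pp' pm pm'.
have [s [t uE]] := in_plane_lP lB' mu; have [s' [t' uE']] := in_plane_lP lB' mu'.
have st : (s, t) <> (0, 0).
  by case=> s0 t0; apply: u0; rewrite uE; apply/(plane_eq0 lB').
move: uq uq'; rewrite uE => /(in_planeE lB' st) [x0 [x1 [z Eq]]].
have z0 : z != 0.
  by apply: contra qm => /eqP z0; rewrite Eq z0 !mul0r; apply/(proj2 lB').
rewrite uE' Eq (evalv_plane lB') => E.
have {}E : t' * s - s' * t = 0.
  by apply: (mulfI z0); rewrite mulr0 -[RHS]E; ring.
have [t0|t0] := eqVneq t 0.
  have s0 : s != 0 by apply/eqP => s0; apply: st; rewrite s0 t0.
  exists (s' / s); rewrite planeZ t0 mulr0 divfK //; congr plane.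
  by move/eqP: E; rewrite t0 mulr0 subr0 mulf_eq0 (negbTE s0) orbF => /eqP.
exists (t' / t); rewrite planeZ divfK //; congr plane.
apply: (mulfI t0); rewrite mulrA mulrCA divff // mulr1.
by apply/eqP; rewrite -subr_eq0 -oppr_eq0 -[X in _ == X]E; apply/eqP; ring.
Qed.

(** The lines through the doubly ramified point in its tangent plane. *)
Definition apex_line y : {vspace vec} := (<[pt B 1 0 0 0]> + <[pt B 0 y 1 0]>)%VS.

Let n1 : (1 : K) <> 0.
Proof. by apply/eqP; rewrite oner_eq0. Qed.

Lemma apex_lineE k m y : k *: pt B 1 0 0 0 + m *: pt B 0 y 1 0 = pt B k (m * y) m 0.
Proof. by rewrite !ptZ ptD; congr (pt B _ _ _ _); ring. Qed.

Lemma apex_line_line y : is_line (apex_line y).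
Proof.
apply: span2_line; first by case/(pt_eq0 Bu).
apply/negP => /vlineP [k]; rewrite ptZ => /(pt_inj Bu) [_ _].
by rewrite mulr0.
Qed.

(** A line of the quartic that meets [l] is a component of the residual cubic in its
    plane.  It lies in the tangent plane at the common point and is a tangent of the
    cubic there, so that off the ramification points it is a line of the ruling.
    The difference of the two quartics vanishes on it, hence on its plane. *)
Lemma line_meeting_l m : is_line m -> in_surface m f -> meets m l ->
  (exists y, (y + e) ^+ 3 + g 0%N = 0 /\ m = apex_line y) \/
  (exists rho, gform g (3 * rho - rho ^+ 3) 1 = 0 /\ m = ruling e B rho 1).
Proof.
move=> dm mf ml; have [p [p0 pm pl]] := meets_point ml.
have [a [d Ep]] := l_ptE lB pl.
have [q qm ql] := line_other_line_point dm lline (proj1 ml).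
have [y0 [y1 [s [t Eq]]]] := ptE Bu q.
have st : (s, t) <> (0, 0).
  by case=> s0 t0; case/negP: ql; rewrite Eq s0 t0; apply/(proj2 lB).
have fm k k' : evalv f (k *: p + k' *: q) = 0 by apply: mf; rewrite rpredD // rpredZ.
have cm k : cub e h s t (k * a + y0) (k * d + y1) 1 = 0.
  have := fm k 1; rewrite Ep Eq !ptZ ptD fh !mulr0 !add0r => <-.
  by rewrite !mul1r -(fibc_cub e h) -{2}(mul1r s) -{2}(mul1r t) quartic_fibc mul1r.
have H : forall i, nth 0 [:: cub e h s t a d 0; cubd e h s t a d 0 y0 y1 1;
    cubd e h s t y0 y1 1 a d 0; cub e h s t y0 y1 1] i = 0.
  apply: (@coefs_fun_eq0 _ [:: 0; 1]) => [|k]; first by exists 1; rewrite /= !mul0r add0r mulr1 addr0 oner_eq0.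
  rewrite /= mul0r add0r mul1r addr0 => k0.
  have := fibc_taylor (nq 0 e) (nr 0 e) h s t y0 y1 1 a d 0 k^-1.
  rewrite mulr0 addr0 !fibc_cub !fibd_cub ![_ + k^-1 * _]addrC cm => E.
  apply: (mulfI (expf_neq0 3 (_ : k^-1 != 0))); first by rewrite invr_eq0.
  by rewrite mulr0 [RHS]E; field; exact: k0.
have C0 := H 0%N; have D0 := H 1%N; rewrite /= in C0 D0.
have pn0 := p0; rewrite Ep in pn0.
have [t0|t0] := eqVneq t 0.
  have s0 : s != 0 by apply/eqP => s0; apply: st; rewrite s0 t0.
  have d0 : d = 0.
    move/eqP: C0; rewrite /cub t0 [X in X == 0](_ : _ = s * d ^+ 3); last by ring.
    by rewrite mulf_eq0 (negbTE s0) expf_eq0 /= => /eqP.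
  have a0 : a != 0 by apply/eqP => a0; apply: pn0; rewrite a0 d0 pt0.
  left; exists (y1 / s); split.
    apply: (mulfI (expf_neq0 4 s0)); rewrite mulr0 -[RHS](H 3%N) /= /cub t0 -/g.
    by rewrite /gform; field.
  apply: (line_eq_span2 dm); first by case/(pt_eq0 Bu).
  + apply/negP => /vlineP [k]; rewrite ptZ => /(pt_inj Bu) [_ _].
    by rewrite mulr0.
  + suff -> : pt B 1 0 0 0 = a^-1 *: p by rewrite rpredZ.
    by rewrite Ep d0 ptZ !mulr0 mulVf.
  + suff -> : pt B 0 (y1 / s) 1 0 = s^-1 *: (q - (y0 / a) *: p).
      by rewrite rpredZ // rpredB // rpredZ.
    rewrite Ep Eq -scaleNr !ptZ ptD ptZ d0 t0; congr (pt B _ _ _ _); field; rewrite ?a0 ?s0 //.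
have d0 : d != 0.
  apply/eqP => d0; move/eqP: C0; rewrite /cub d0 [X in X == 0](_ : _ = t * a ^+ 3); last by ring.
  rewrite mulf_eq0 (negbTE t0) expf_eq0 /= => /eqP a0.
  by apply: pn0; rewrite a0 d0 pt0.
pose rho := a / d; pose z0 := y0 / t; pose z1 := y1 / t.
have aE : a = rho * d by rewrite /rho divfK.
have [y0E y1E] : y0 = z0 * t /\ y1 = z1 * t by rewrite /z0 /z1 !divfK.
have sE : s = t * (3 * rho - rho ^+ 3).
  apply: (mulfI (expf_neq0 3 d0)); apply: subr0_eq.
  by rewrite -[RHS]C0 /cub aE; ring.
have qE : t^-1 *: q = pt B z0 z1 (3 * rho - rho ^+ 3) 1.
  by rewrite Eq ptZ sE y0E y1E; congr (pt B _ _ _ _); field.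
have pE : d^-1 *: p = pt B rho 1 0 0.
  by rewrite Ep ptZ aE; congr (pt B _ _ _ _); field.
have E1 : 3 * (rho ^+ 2 - 1) * (z0 - rho * z1 + e * (rho ^+ 2 - 1) * (rho ^+ 2 - 4)) = 0.
  apply: (mulfI (mulf_neq0 (expf_neq0 2 d0) (expf_neq0 2 t0))).
  rewrite mulr0 -[RHS]D0 /cubd /cub0 /cub1 /cubz aE sE y0E y1E; ring.
have [r1|r1] := eqVneq (rho ^+ 2 - 1) 0.
  have r2 : rho ^+ 2 = 1 by apply/eqP; rewrite -subr_eq0 r1.
  have r3 : 3 * rho - rho ^+ 3 = 2 * rho by rewrite exprS r2; ring.
  pose w := z0 - rho * z1.
  have F x : w ^+ 2 * (3 * rho * x + w) + gform g (2 * rho) 1 = 0.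
    have := fm ((x - z1) / d) t^-1; rewrite -scalerA pE qE ptZ ptD fE r3 mulr0 mulr1 !add0r.
    have -> : (x - z1) * rho + z0 = rho * x + w by rewrite /w; ring.
    rewrite subrK /g => E2; rewrite -[RHS]E2; congr (_ + _).
    apply: subr0_eq.
    transitivity ((1 - rho ^+ 2) * (rho * x ^+ 3 + 3 * w * x ^+ 2 + 4 * (3 * e * x ^+ 2
       + 3 * e ^+ 2 * (3 * rho * x + w) + 4 * e ^+ 3 * (rho ^+ 2 - 1)))).
      by rewrite /S4f; ring.
    by rewrite r2 subrr mul0r.
  have rn : rho != 0 by apply: contra_eq_neq r2 => ->; rewrite expr0n eq_sym oner_eq0.
  have w0 : w = 0.
    have : 3%:R * rho * w ^+ 2 = 0.
      by rewrite -[RHS](subrr 0) -[X in X - _](F 1) -[X in _ - X](F 0); ring.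
    by move/eqP; rewrite mulf_eq0 (negbTE (mulf_neq0 char3 rn)) expf_eq0 /= => /eqP.
  have := smooth_ramified Bu fE fsmooth r2; rewrite -/g.
  by have := F 0; rewrite w0 expr0n /= mul0r add0r => ->; rewrite eqxx.
have zE : z0 = rho * z1 - e * (rho ^+ 2 - 1) * (rho ^+ 2 - 4).
  move/eqP: E1; rewrite mulf_eq0 (negbTE (mulf_neq0 char3 r1)) /= => /eqP E1.
  by apply: subr0_eq; rewrite -[RHS]E1; ring.
right; exists rho.
have qr : pt B z0 z1 (3 * rho - rho ^+ 3) 1 \in ruling e B rho 1.
  apply/mem_span2; exists (z1 - e * (rho ^+ 3 - 5 * rho)), 1.
  by rewrite rulingE zE; congr (pt B _ _ _ _); ring.
split.
  have := fm 0 t^-1; rewrite scale0r add0r qE fE => E2; rewrite -[RHS]E2 /g zE.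
  by rewrite -[LHS]add0r; congr (_ + _); rewrite /S4f; ring.
have rdn : (rho, 1 : K) <> (0, 0) by move=> /(congr1 snd) /= /n1.
apply/eqP; rewrite eqEdim dm (ruling_line e Bu rdn) andbT.
have -> : m = (<[p]> + <[q]>)%VS.
  by apply: (line_eq_span2 dm) => //; apply: contra ql => /vlineP [k ->]; rewrite rpredZ.
have pr : pt B rho 1 0 0 \in ruling e B rho 1.
  exact: span2_left.
rewrite subv_add -!memvE; apply/andP; split.
  have -> : p = d *: (d^-1 *: p) by rewrite scalerA mulfV // scale1r.
  by rewrite pE rpredZ.
have -> : q = t *: (t^-1 *: q) by rewrite scalerA mulfV // scale1r.
by rewrite qE rpredZ.
Qed.

(** The planes whose residual cubic consists of three lines. *)
Definition special s t : Prop := t = 0 \/ gform g s t = 0.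

Lemma meets_not_in (m : {vspace vec}) (q p : vec) : q \in m -> q \notin l -> p <> 0 -> p \in m -> p \in l -> meets m l.
Proof. by move=> qm ql p0 pm pl; apply: (point_meets _ p0 pm pl) => E; rewrite -E qm in ql. Qed.

Lemma apex_line_meets y : meets (apex_line y) l.
Proof.
apply: (@meets_not_in _ (pt B 0 y 1 0) (pt B 1 0 0 0)).
- exact: span2_right.
- by apply/negP => /(proj2 lB) [].
- by case/(pt_eq0 Bu).
- exact: span2_left.
- exact: pt_in_l.
Qed.

Lemma ruling_meets rho : meets (ruling e B rho 1) l.
Proof.
apply: (@meets_not_in _ (second_point e B rho 1) (pt B rho 1 0 0)).
- exact: span2_right.
- by apply/negP => /(proj2 lB) [_]; rewrite expr1n => /n1.
- by case/(pt_eq0 Bu).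
- exact: span2_left.
- exact: pt_in_l.
Qed.

Lemma apex_line_in_surface y : (y + e) ^+ 3 + g 0%N = 0 -> in_surface (apex_line y) f.
Proof.
move=> y3 v /mem_span2 [k [m ->]]; rewrite apex_lineE fE -/g.
transitivity (m ^+ 4 * ((y + e) ^+ 3 + g 0%N)); last by rewrite y3 mulr0.
by rewrite /S4f /gform; ring.
Qed.

Lemma ruling_in_quartic rho : gform g (3 * rho - rho ^+ 3) 1 = 0 -> in_surface (ruling e B rho 1) f.
Proof.
move=> g0 v /mem_span2 [k [m ->]]; rewrite rulingE fE S4f_ruling add0r -/g.
transitivity (m ^+ 4 * gform g (3 * rho - rho ^+ 3) 1); last by rewrite g0 mulr0.
by rewrite /gform; ring.
Qed.

Lemma apex_line_inj y y' : apex_line y = apex_line y' -> y = y'.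
Proof.
move=> E; have : pt B 0 y 1 0 \in apex_line y'.
  by rewrite -E; exact: span2_right.
move=> /mem_span2 [k [m]]; rewrite apex_lineE => /(pt_inj Bu) [_ yE mE _].
by rewrite yE -mE mul1r.
Qed.

Lemma ruling_inj rho rho' : ruling e B rho 1 = ruling e B rho' 1 -> rho = rho'.
Proof.
move=> E; have : pt B rho 1 0 0 \in ruling e B rho' 1.
  by rewrite -E; exact: span2_left.
move=> /mem_span2 [k [m]]; rewrite rulingE => /(pt_inj Bu) [E0 E1 _ /esym /eqP].
rewrite expr1n mulr1 => /eqP m0; move: E0 E1; rewrite m0 !mul0r subr0 addr0 mulr1 => -> <-.
by rewrite mul1r.
Qed.

Lemma cube_roots : exists w1 w2 w3, [/\ w1 != w2, w1 != w3, w2 != w3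
  & forall x, x ^+ 3 + g 0%N = (x - w1) * (x - w2) * (x - w3)].
Proof.
have g0 := smooth_g0 Bu fE fsmooth; rewrite -/g in g0.
have [_ [w1 E1]] := exists_monic_root 0 0 (g 0%N).
have [[w2 E2] _] := exists_monic_root 0 w1 (w1 ^+ 2).
have g0E : g 0%N = - w1 ^+ 3 by apply/eqP; rewrite -addr_eq0 -[X in _ == X]E1; apply/eqP; ring.
have w10 : w1 != 0 by apply: contraNneq g0 => w0; rewrite g0E w0 expr0n oppr0.
have sq (x : K) : 3%:R * x ^+ 2 = 0 -> x = 0.
  by move/eqP; rewrite mulf_eq0 (negbTE char3) expf_eq0 /= => /eqP.
have w20 : w2 != 0.
  by apply: contra_neq w10 => w20; apply: sq; rewrite -[RHS](mulr0 3%:R) -[X in _ = _ * X]E2 w20; ring.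
exists w1, w2, (- (w1 + w2)); split.
- by apply: contra_neq w10 => w12; apply: sq; rewrite -[RHS]E2 -w12; ring.
- apply: contra_neq w10 => w13; apply: sq; have w2E : w2 = - (2 * w1).
    by apply/eqP; rewrite -addr_eq0 [X in X == 0](_ : _ = w1 - - (w1 + w2)); [rewrite subr_eq0 {1}w13 | ring].
  by rewrite -[RHS]E2 w2E; ring.
- apply: contra_neq w20 => w23; apply: sq; have w1E : w1 = - (2 * w2).
    by apply/eqP; rewrite -addr_eq0 [X in X == 0](_ : _ = w2 - - (w1 + w2)); [rewrite subr_eq0 {1}w23 | ring].
  by rewrite -[RHS]E2 w1E; ring.
move=> x; rewrite g0E.
transitivity ((x - w1) * (x - w2) * (x - - (w1 + w2)) + (x - w1) * (w2 ^+ 2 + w1 * w2 + w1 ^+ 2)).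
  by ring.
by rewrite E2 mulr0 addr0.
Qed.

(** The roots of [x^3 - 3 x + s] only coincide for [s^2 = 4], which is excluded by
    [smooth_ramified]. *)
Lemma distinct_roots r1 r2 : r1 ^+ 2 + r1 * r2 + r2 ^+ 2 = 3 ->
    gform g (r1 * r2 * (r1 + r2)) 1 = 0 -> [/\ r1 != r2, r1 != - (r1 + r2) & r2 != - (r1 + r2)].
Proof.
move=> R g0.
have key r : r1 * r2 * (r1 + r2) = 2 * r ^+ 3 -> 3%:R * r ^+ 2 = 3%:R -> False.
  move=> E r2E; have r1' : r ^+ 2 = 1 by apply: (mulfI char3); rewrite r2E mulr1.
  have := smooth_ramified Bu fE fsmooth r1'; rewrite -/g.
  have -> : 2 * r = r1 * r2 * (r1 + r2) by rewrite E exprS r1'; ring.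
  by rewrite g0 eqxx.
split; apply/eqP => E.
- by apply: (key r1); [rewrite -E; ring | rewrite -[RHS]R -E; ring].
- have r2E : r2 = - (2 * r1).
    by apply/eqP; rewrite -addr_eq0 [X in X == 0](_ : _ = r1 - - (r1 + r2)); [rewrite subr_eq0 {1}E | ring].
  by apply: (key r1); [rewrite r2E; ring | rewrite -[RHS]R r2E; ring].
- have r1E : r1 = - (2 * r2).
    by apply/eqP; rewrite -addr_eq0 [X in X == 0](_ : _ = r2 - - (r1 + r2)); [rewrite subr_eq0 {1}E | ring].
  by apply: (key r2); [rewrite r1E; ring | rewrite -[RHS]R r1E; ring].
Qed.

Definition line_of_plane (u : vec) m : Prop :=
  [/\ is_line m, in_surface m f, meets m l & in_plane m u].

Lemma apex_line_in_plane y s t : in_plane (apex_line y) (plane B s t) <-> t = 0.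
Proof.
split=> [H|-> v /mem_span2 [k [m ->]]]; last by rewrite apex_lineE (evalv_plane lB); ring.
have := H (pt B 0 y 1 0); rewrite (evalv_plane lB) mulr0 subr0 mulr1; apply.
exact: span2_right.
Qed.

Lemma ruling_in_plane rho s t : in_plane (ruling e B rho 1) (plane B s t) <->
  s = t * (3 * rho - rho ^+ 3).
Proof.
split=> [H|-> v /mem_span2 [k [m ->]]]; last by rewrite rulingE (evalv_plane lB); ring.
have := H (second_point e B rho 1); rewrite (evalv_plane lB) => E.
apply/eqP; rewrite -subr_eq0 -oppr_eq0; apply/eqP; rewrite -[RHS]E; first by ring.
exact: span2_right.
Qed.

(** In the tangent plane at the doubly ramified point the lines correspond to the
    roots of [x^3 + g 0], in the other planes to those of [x^3 - 3 x + s / t]. *)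
Lemma special_triple s t : (s, t) <> (0, 0) -> special s t -> exists t3 : {fset {vspace vec}},
  #|` t3|%fset = 3%N /\ forall m, m \in t3 <-> line_of_plane (plane B s t) m.
Proof.
move=> st sp.
have fs3 (m1 m2 m3 : {vspace vec}) : m1 != m2 -> m1 != m3 -> m2 != m3 ->
    exists2 t3 : {fset {vspace vec}}, #|` t3|%fset = 3%N &
      forall m, m \in t3 <-> [\/ m = m1, m = m2 | m = m3].
  move=> n12 n13 n23; exists [fset x in [:: m1; m2; m3]]%fset.
    rewrite card_fseq undup_id //= !inE negb_or n12 n13 n23 //.
  move=> m; rewrite !inE orbF; split=> [/or3P [] /eqP ->|[] ->];
    [exact: Or31 | exact: Or32 | exact: Or33 | | |]; by rewrite eqxx ?orbT.
have [t0|t0] := eqVneq t 0.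
  have s0 : s != 0 by apply/eqP => s0; apply: st; rewrite s0 t0.
  have [w1 [w2 [w3 [n12 n13 n23 wE]]]] := cube_roots.
  have nE w w' : w != w' -> apex_line (w - e) != apex_line (w' - e).
    by apply: contra_neq => /apex_line_inj /(addIr _).
  have [t3 c3 t3E] := fs3 _ _ _ (nE _ _ n12) (nE _ _ n13) (nE _ _ n23).
  exists t3; split=> // m; rewrite t3E.
  have ok w : w ^+ 3 + g 0%N = 0 -> line_of_plane (plane B s t) (apex_line (w - e)).
    move=> w3E; split; [exact: apex_line_line | | exact: apex_line_meets | exact/apex_line_in_plane].
    by apply: apex_line_in_surface; rewrite subrK.
  split=> [[] ->|[dm mf ml mu]].
  - by apply: ok; rewrite wE; ring.
  - by apply: ok; rewrite wE; ring.
  - by apply: ok; rewrite wE; ring.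
  case: (line_meeting_l dm mf ml) => [[y [y3 mE]]|[rho [_ mE]]]; last first.
    by move: mu; rewrite mE => /ruling_in_plane /eqP; rewrite t0 mul0r (negbTE s0).
  move: y3; rewrite wE mE => /eqP; rewrite !mulf_eq0 !subr_eq0 => /orP [/orP []|] /eqP <-;
    rewrite addrK; [exact: Or31 | exact: Or32 | exact: Or33].
have g0 : gform g s t = 0 by case: sp => // t0'; rewrite t0' eqxx in t0.
have [r1 [r2 [R sE]]] := cubic_roots (s / t).
have g1 : gform g (s / t) 1 = 0.
  by apply: (mulfI (expf_neq0 4 t0)); rewrite mulr0 -[RHS]g0 /gform; field.
have [n12 n13 n23] : [/\ r1 != r2, r1 != - (r1 + r2) & r2 != - (r1 + r2)].
  by apply: distinct_roots; rewrite -?sE.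
have nE r r' : r != r' -> ruling e B r 1 != ruling e B r' 1.
  by apply: contra_neq => /ruling_inj.
have [t3 c3 t3E] := fs3 _ _ _ (nE _ _ n12) (nE _ _ n13) (nE _ _ n23).
exists t3; split=> // m; rewrite t3E.
have ok r : r ^+ 3 - 3 * r + s / t = 0 -> line_of_plane (plane B s t) (ruling e B r 1).
  move=> Er; have stE : s / t = 3 * r - r ^+ 3.
    by apply: subr0_eq; rewrite -[RHS]Er; ring.
  split; [| | exact: ruling_meets | ].
  - by apply: ruling_line => //; case.
  - by apply: ruling_in_quartic; rewrite -stE.
  - by apply/ruling_in_plane; rewrite -stE mulrC divfK.
split=> [[] ->|[dm mf ml mu]].
- by apply: ok; rewrite sE (cubic_factor _ R); ring.
- by apply: ok; rewrite sE (cubic_factor _ R); ring.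
- by apply: ok; rewrite sE (cubic_factor _ R); ring.
case: (line_meeting_l dm mf ml) => [[y [_ mE]]|[rho [_ mE]]].
  by move: mu; rewrite mE => /apex_line_in_plane E; rewrite E eqxx in t0.
move: mu; rewrite mE => /ruling_in_plane sE'.
have : (rho - r1) * (rho - r2) * (rho - - (r1 + r2)) = 0.
  rewrite opprK -(cubic_factor _ R) -sE sE'; field; exact: t0.
move=> /eqP; rewrite !mulf_eq0 !subr_eq0 => /orP [/orP []|] /eqP ->;
  [exact: Or31 | exact: Or32 | exact: Or33].
Qed.

(** A plane that contains three of the lines also contains [l]: otherwise the lines
    would be concurrent in a point of [l], and so lie in its tangent plane. *)
Lemma coplanar_triplet_special t3 : coplanar_triplet f l t3 ->
  exists s t, [/\ (s, t) <> (0, 0), special s t & forall m, m \in t3 -> in_plane m (plane B s t)].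
Proof.
move=> [c3 tl [u u0 tu]].
have [m1 m1t] : exists m1, m1 \in t3.
  by apply/fset0Pn; rewrite -cardfs_gt0 c3.
have [m2 m2t m12] : exists2 m2, m2 \in t3 & m2 <> m1.
  have /fset0Pn [m2] : (t3 `\ m1)%fset != fset0.
    by rewrite -cardfs_gt0; move: c3; rewrite (cardfsD1 m1) m1t => /eqP; rewrite add1n eqSS => /eqP ->.
  by rewrite !inE => /andP [/eqP m21 m2t]; exists m2.
have [dm1 mf1 ml1] := tl _ m1t; have [dm2 mf2 ml2] := tl _ m2t.
have lu : in_plane l u.
  have [p1 [p10 p1m p1l]] := meets_point ml1; have [p2 [p20 p2m p2l]] := meets_point ml2.
  have up1 := tu _ m1t _ p1m; have up2 := tu _ m2t _ p2m.
  have [p21|p21] := boolP (p2 \in <[p1]>%VS); last first.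
    move=> v; rewrite (line_eq_span2 lline p10 p21 p1l p2l) => /mem_span2 [k [k' ->]].
    by rewrite evalv_lformD !evalv_lformZ up1 up2 !mulr0 addr0.
  have p1m2 : p1 \in m2.
    move: p21 => /vlineP [k E]; have k0 : k != 0 by apply/eqP => k0; apply: p20; rewrite E k0 scale0r.
    have -> : p1 = k^-1 *: p2 by rewrite E scalerA mulVf // scale1r.
    by rewrite rpredZ.
  have [a [d Ep]] := l_ptE lB p1l.
  have ad : (a, d) <> (0, 0) by case=> a0 d0; apply: p10; rewrite Ep a0 d0 pt0.
  have TE := tangent_plane_l lB fh a d; rewrite -Ep in TE.
  have T0 : tangent_plane f p1 <> 0.
    by rewrite TE => /(plane_eq0 lB) [s0 t0]; apply: (tangent_st_neq0 ad); rewrite s0 t0.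
  have mT (m : {vspace vec}) : p1 \in m -> in_surface m f -> in_plane m (tangent_plane f p1).
    move=> pm mf q qm; rewrite tangent_planeE /dird (@coef_restr _ _ _ _ [::]) // => k.
    by apply: mf; rewrite rpredD // rpredZ.
  have [q qm2 qm1] := line_other_line_point dm2 dm1 m12.
  have [k uE] := plane_unique dm1 qm1 T0 (mT _ p1m mf1) (tu _ m1t) (mT _ p1m2 mf2 _ qm2) (tu _ m2t _ qm2).
  move=> v vl; rewrite uE lformZ evalvZ TE.
  by rewrite (in_plane_l lB _ _ vl) mulr0.
have [s [t uE]] := in_plane_lP lB lu; rewrite uE in u0 tu.
have st : (s, t) <> (0, 0) by case=> s0 t0; apply: u0; rewrite s0 t0; apply/(plane_eq0 lB).
exists s, t; split=> //; have := tu _ m1t.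
case: (line_meeting_l dm1 mf1 ml1) => [[y [_ ->]] /apex_line_in_plane|[rho [g0 ->]] /ruling_in_plane sE].
  by left.
right; rewrite sE; transitivity (t ^+ 4 * gform g (3 * rho - rho ^+ 3) 1); last by rewrite g0 mulr0.
by rewrite /gform; ring.
Qed.

(** A triplet determines its plane, which is spanned by [l] and a point of one of the
    lines; so there are as many triplets as planes. *)
Lemma triplets (us : seq vec) : size us = 5%N -> uniq [seq <[u]>%VS | u <- us] ->
    (forall u, u \in us -> exists s t, [/\ (s, t) <> (0, 0), special s t & u = plane B s t]) ->
    (forall s t, (s, t) <> (0, 0) -> special s t ->
       exists2 u, u \in us & <[u]>%VS = <[plane B s t]>%VS) ->
  exists T : {fset {fset {vspace vec}}},
    [/\ #|` T|%fset = 5%N, forall t, t \in T <-> coplanar_triplet f l t,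
        forall t, t \in T -> exists2 u, u \in us & forall m, m \in t -> in_plane m u
      & forall u, u \in us -> exists2 t, t \in T & forall m, m \in t -> in_plane m u].
Proof.
move=> s5 uniq_us us_sp sp_us.
have H (i : 'I_5) : exists t3 : {fset {vspace vec}},
    #|` t3|%fset = 3%N /\ forall m, m \in t3 <-> line_of_plane (nth 0 us i) m.
  have /us_sp [s [t [st sp ->]]] : nth 0 us i \in us by rewrite mem_nth // s5.
  exact: special_triple.
have [T3 T3E] := fin_all_exists H.
have T3_card i := proj1 (T3E i); have T3_mem i := proj2 (T3E i).
have T3_inj : injective T3.
  move=> i j Eij; apply: val_inj; apply/eqP.
  rewrite -(nth_uniq <[0 : vec]>%VS _ _ uniq_us) ?size_map ?s5 //; [|exact: ltn_ord|exact: ltn_ord].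
  rewrite !(nth_map (0 : vec)) ?s5 //; [|exact: ltn_ord|exact: ltn_ord].
  have [m mi] : exists m, m \in T3 i by apply/fset0Pn; rewrite -cardfs_gt0 T3_card.
  have /T3_mem [dm mf ml mui] := mi; have := mi; rewrite Eij => /T3_mem [_ _ _ muj].
  have [q qm ql] := line_other_line_point dm lline (proj1 ml).
  have usE k : exists s t, (s, t) <> (0, 0) /\ nth 0 us (k : 'I_5) = plane B s t.
    have /us_sp [s [t [st sp ->]]] : nth 0 us k \in us by rewrite mem_nth // s5.
    by exists s, t.
  have [si [ti [sti uiE]]] := usE i; have [sj [tj [stj ujE]]] := usE j.
  have n0 s t : (s, t) <> (0, 0) -> plane B s t <> 0.
    by move=> st /(plane_eq0 lB) [s0 t0]; apply: st; rewrite s0 t0.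
  rewrite uiE ujE in mui muj *.
  have [k Ek] := plane_unique lline ql (n0 _ _ sti) (in_plane_l lB si ti) (in_plane_l lB sj tj)
     (mui _ qm) (muj _ qm).
  apply/eqP/esym/vline_eqP; first exact: n0.
  exists k => //; apply/eqP => k0; apply: (n0 _ _ stj); by rewrite Ek k0 scale0r.
pose T := [fset x in map T3 (enum 'I_5)]%fset.
have memT t : t \in T <-> exists i, t = T3 i.
  rewrite !inE; split=> [/mapP [i _ ->]|[i ->]]; first by exists i.
  by apply: map_f; rewrite mem_enum.
exists T; split.
- rewrite card_fseq undup_id ?(map_inj_uniq T3_inj) ?enum_uniq //.
  by rewrite size_map size_enum_ord.
- move=> t; rewrite memT; split=> [[i ->]|ct].
    split=> // [m /T3_mem [dm mf ml _] //|].
    have /us_sp [s [t' [st sp uE]]] : nth 0 us i \in us by rewrite mem_nth // s5.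
    exists (nth 0 us i); last by move=> m /T3_mem [].
    by rewrite uE => /(plane_eq0 lB) [s0 t0]; apply: st; rewrite s0 t0.
  have [s [t' [st sp tp]]] := coplanar_triplet_special ct.
  have [u uus uE] := sp_us _ _ st sp.
  have iP : (index u us < 5)%N by rewrite -s5 index_mem.
  exists (Ordinal iP); case: ct => c3 tl _.
  apply/eqP; rewrite eqEfcard T3_card c3 leqnn andbT; apply/fsubsetP => m mt.
  apply/T3_mem; have [dm mf ml] := tl _ mt; split=> //.
  rewrite /= nth_index // => v vm; have := tp _ mt v vm.
  have := memv_line u; rewrite uE => /vlineP [k ->].
  by rewrite lformZ evalvZ => ->; rewrite mulr0.
- move=> t /memT [i ->]; exists (nth 0 us i); first by rewrite mem_nth // s5.
  by move=> m /T3_mem [].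
- move=> u uus; have iP : (index u us < 5)%N by rewrite -s5 index_mem.
  exists (T3 (Ordinal iP)); first by apply/memT; exists (Ordinal iP).
  by move=> m /T3_mem []; rewrite /= nth_index.
Qed.

End Triplets.

(** ** The Segre decomposition *)

Section SegreDecompositions.
Variable K : closedFieldType.
Notation vec := 'rV[K]_4.
Notation form := {mpoly K[4]}.
Hypotheses (char2 : 2%:R != 0 :> K) (char3 : 3%:R != 0 :> K).
Variables (e : K) (h : nat -> K) (l : {vspace vec}) (B : 'M[K]_4) (f : form).
Hypothesis lB : chart_of l B.
Hypothesis fh : forall x0 x1 x2 x3,
  evalv f (pt B x0 x1 x2 x3) = quartic (nq 0 e) (nr 0 e) h x0 x1 x2 x3.
Hypothesis lline : is_line l.
Hypothesis fsmooth : smooth_surface f.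

Let Bu : B \in unitmx := proj1 lB.
Let g := rest e h.
Let fE := fE fh.

Lemma S4_exists : exists2 S : form, S \is 4.-homog &
  forall x0 x1 x2 x3, evalv S (pt B x0 x1 x2 x3) = S4f e x0 x1 x2 x3.
Proof.
have [S Sh SE] : form_fun 4 (fun v => S4f e (evalv (X B o0) v) (evalv (X B o1) v)
    (evalv (X B o2) v) (evalv (X B o3) v)).
  by rewrite /S4f; by_degree.
by exists S => // x0 x1 x2 x3; rewrite SE !(Xpt Bu).
Qed.

Lemma rest_roots : exists r : seq K, [/\ size r = 4%N, uniq r
    & forall s t, gform g s t = g 0%N * \prod_(x <- r) (s - x * t)].
Proof.
apply: gform_roots; first exact: smooth_g0 Bu fE fsmooth.
by move=> s; apply: (smooth_simple_root Bu fE fsmooth).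
Qed.

Lemma plane1_neq0 x : plane B x 1 <> 0.
Proof. by move=> /(plane_eq0 lB) [_ /eqP]; rewrite oner_eq0. Qed.

Lemma plane1_inj x y : <[plane B x 1]>%VS = <[plane B y 1]>%VS -> x = y.
Proof.
move=> /(vline_eqP _ (@plane1_neq0 y)) [k _]; rewrite planeZ => /(plane_inj lB) [-> ].
by rewrite mulr1 => <-; rewrite mul1r.
Qed.

Variables (S : form) (r : seq K).
Hypothesis Sh : S \is 4.-homog.
Hypothesis SE : forall x0 x1 x2 x3, evalv S (pt B x0 x1 x2 x3) = S4f e x0 x1 x2 x3.
Hypotheses (r4 : size r = 4%N) (runiq : uniq r).
Hypothesis gr : forall s t, gform g s t = g 0%N * \prod_(x <- r) (s - x * t).

Definition planes : seq vec := [seq plane B x 1 | x <- r].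

Fact planes_size : size planes == 4%N.
Proof. by rewrite size_map r4. Qed.
Definition planes4 : 4.-tuple vec := Tuple planes_size.

(** The product of these planes is the difference of the two quartics, up to a scalar. *)
Lemma planes_prod x0 x1 x2 x3 :
  g 0%N * evalv (\prod_(u <- planes4) lform u) (pt B x0 x1 x2 x3) = gform g x2 x3.
Proof.
rewrite gr evalv_prod big_map; congr (_ * _); apply: eq_bigr => x _.
by rewrite (evalv_plane lB) mul1r.
Qed.

Lemma planes_uniq : uniq [seq <[u]>%VS | u <- planes].
Proof.
rewrite -map_comp map_inj_in_uniq // => x y _ _ /=; exact: plane1_inj.
Qed.

Lemma ruling_meets_l a d : (a, d) <> (0, 0) -> meets (ruling e B a d) l.
Proof.
move=> ad; apply: (@meets_not_in _ l _ (second_point e B a d) (pt B a d 0 0)).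
- exact: span2_right.
- apply/negP => /(proj2 lB) [/eqP + /eqP]; rewrite expf_eq0 oppr_eq0 /= => + /eqP d0.
  rewrite d0 [X in X == 0](_ : _ = a ^+ 3); last by ring.
  by rewrite expf_eq0 /= => /eqP a0; apply: ad; rewrite a0 d0.
- exact: (pt_ad_neq0 Bu).
- exact: span2_left.
- exact: pt_in_l.
Qed.

Lemma segre_exists : segre_decomposition f l ((g 0%N)^-1 *: S) planes4.
Proof.
have g0 : g 0%N != 0 := smooth_g0 Bu fE fsmooth.
have S0 : S != 0 by case: (S4_irreducible char2 char3 Bu SE).
split.
- by split; [rewrite scaler_eq0 negb_or invr_eq0 g0 S0 | rewrite rpredZ].
- move=> v v0; rewrite evalvZ => /eqP; rewrite mulf_eq0 invr_eq0 (negbTE g0) /= => /eqP Sv.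
  have [a [d [ad vr]]] := S4_cover char3 Bu SE v0 Sv.
  exists (ruling e B a d); split=> //; [exact: ruling_line | | exact: ruling_meets_l].
  by move=> w wr; rewrite evalvZ (ruling_in_surface SE wr) mulr0.
- move=> i; have /mapP [x _ ->] : tnth planes4 i \in planes by rewrite mem_tnth.
  exact: plane1_neq0.
- move=> v; split=> [vl i|H].
    have /mapP [x _ ->] : tnth planes4 i \in planes by rewrite mem_tnth.
    exact: (in_plane_l lB).
  have Hx x : x \in r -> evalv (lform (plane B x 1)) v = 0.
    move=> xr; have : plane B x 1 \in planes4 by apply: map_f.
    by case/tnthP => i ->; apply: H.
  have [x0 [x1 [x2 [x3 Ev]]]] := ptE Bu v.
  move: Hx (runiq) (r4); rewrite Ev; case: r => [//|x [//|y r']] Hx /=.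
  rewrite inE negb_or -andbA => /and3P [xy _ _] _.
  have := Hx x (mem_head _ _); have := Hx y; rewrite !inE eqxx orbT !(evalv_plane lB) !mul1r => /(_ erefl) Hy Hx'.
  have x30 : x3 = 0.
    apply: (mulfI (_ : x - y != 0)); first by rewrite subr_eq0.
    transitivity ((x2 - y * x3) - (x2 - x * x3)); first by ring.
    by rewrite mulr0 Hy Hx' subrr.
  apply/(proj2 lB); split=> //; rewrite -[RHS]Hx' x30; ring.
exists (g 0%N) => //; apply: (form_chart_eq lB) => x0 x1 x2 x3.
by rewrite evalvZ evalvD mulrDr planes_prod evalvZ mulrA mulfV // mul1r SE fE.
Qed.

(** Both decompositions have the same quartic by [segre_unique]; so the products of
    planes agree, and a plane of one of them vanishes where the other product does. *)
Lemma segre_decomposition_unique S' (L' : 4.-tuple vec) : segre_decomposition f l S' L' ->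
  (exists2 c : K, c != 0 & S' = c *: S) /\
  perm_eq [seq <[u]>%VS | u <- L'] [seq <[u]>%VS | u <- planes4].
Proof.
move=> dec; have [c [h' [c0 SE' LE']]] := segre_quartic lB fh dec.
have [_ Sl L0 _ _] := dec.
have hE := segre_unique char3 lB c0 SE' Sl.
have h'E s t : gform h' s t = gform g s t.
  rewrite gform_rest -hE /gform; ring.
split.
  exists c^-1; first by rewrite invr_eq0.
  apply: (form_chart_eq lB) => x0 x1 x2 x3.
  apply: (mulfI c0); rewrite evalvZ mulrA mulfV // mul1r SE' SE quartic_S4f hE; ring.
have [a [d LE]] := segre_planes lB dec.
have sub : {subset [seq <[u]>%VS | u <- planes4] <= [seq <[u]>%VS | u <- L']}.
  move=> _ /mapP [_ /mapP [x xr ->] ->].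
  have : c * evalv (\prod_(u <- L') lform u) (pt B 0 0 x 1) = 0.
    rewrite LE' h'E gr (big_rem x) //= mulr1 subrr mul0r mulr0 //.
  move/eqP; rewrite mulf_eq0 (negbTE c0) /= prod4_tuple !mulf_eq0 => H.
  have [i Ei] : exists i, evalv (lform (tnth L' i)) (pt B 0 0 x 1) = 0.
    by case/orP: H => [/orP [/orP [] /eqP H|/eqP H]|/eqP H];
      [exists o0 | exists o1 | exists o2 | exists o3].
  apply/mapP; exists (tnth L' i); first exact: mem_tnth.
  move: Ei (L0 i); rewrite LE (evalv_plane lB) mulr1 => /eqP; rewrite subr_eq0 => /eqP <- n0.
  apply/esym/(vline_eqP _ (@plane1_neq0 x)); exists (d i); last by rewrite planeZ mulr1.
  by apply/eqP => d0; apply: n0; rewrite d0 mul0r; apply/(plane_eq0 lB).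
have szE : size [seq <[u]>%VS | u <- L'] = size [seq <[u]>%VS | u <- planes4].
  by rewrite !size_map size_tuple r4.
have uL : uniq [seq <[u]>%VS | u <- planes4] := planes_uniq.
have [_ memE] := uniq_min_size uL sub (eq_leq szE).
rewrite perm_sym; apply: uniq_perm => //.
by apply: (leq_size_uniq uL sub); rewrite szE.
Qed.

End SegreDecompositions.

(** * The singular fibers *)

Section ThreeLines.
Variable K : closedFieldType.
Notation vec := 'rV[K]_4.
Notation form := {mpoly K[4]}.

(** A triangular system of values shows the independence. *)
Lemma free3_witness (u a d p1 p2 : vec) : u != 0 ->
  evalv (lform u) p1 = 0 -> evalv (lform u) p2 = 0 -> evalv (lform a) p1 != 0 ->
  evalv (lform a) p2 = 0 -> evalv (lform d) p2 != 0 -> free [:: u; a; d].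
Proof.
move=> u0 u1 u2 a1 a2 d2; have [i ui] := rV0Pn _ u0.
have ev (w x : vec) k : evalv (lform (k *: w)) x = k * evalv (lform w) x by rewrite lformZ evalvZ.
rewrite !free_cons nil_free andbT span_cons span_seq1 span_nil memv0; apply/and3P; split.
- apply/negP => /mem_span2 [k [k' E]].
  have k'0 : k' = 0.
    apply: (mulIf d2); rewrite mul0r -[RHS]u2 E lformD !lformZ evalvD !evalvZ a2; ring.
  have k0 : k = 0.
    by apply: (mulIf a1); rewrite mul0r -[RHS]u1 E k'0 scale0r addr0 ev.
  by move: u0; rewrite E k0 k'0 !scale0r addr0 eqxx.
- apply/negP => /vlineP [k E]; have k0 : k = 0.
    by apply: (mulIf d2); rewrite mul0r -[RHS]a2 E ev.
  by move: a1; rewrite E k0 scale0r lform0 /evalv meval0 eqxx.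
- by apply: contraNneq d2 => ->; rewrite lform0 /evalv meval0.
Qed.

(** The scalar is absorbed in the first line. *)
Lemma three_lines_intro (u : vec) (c : form) k (a : 'I_3 -> vec) : u != 0 -> k != 0 ->
    (forall v, evalv (lform u) v = 0 -> evalv c v = k * \prod_(i < 3) evalv (lform (a i)) v) ->
    (forall i j, i != j -> exists p1 p2, [/\ evalv (lform u) p1 = 0, evalv (lform u) p2 = 0,
        evalv (lform (a i)) p1 != 0, evalv (lform (a i)) p2 = 0 & evalv (lform (a j)) p2 != 0]) ->
  exists a', three_lines u c a' /\ (concurrent u a <-> concurrent u a').
Proof.
move=> u0 k0 cE fr; pose s (i : 'I_3) : K := if i == ord0 then k else 1.
have s0 i : s i != 0 by rewrite /s; case: ifP => _; rewrite ?oner_eq0.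
have aE i v : evalv (lform (s i *: a i)) v = s i * evalv (lform (a i)) v.
  by rewrite lformZ evalvZ.
exists (fun i => s i *: a i); split; last first.
  split=> [[v [v0 uv av]]|[v [v0 uv av]]]; exists v; split=> // i.
    by rewrite aE av mulr0.
  by apply: (mulfI (s0 i)); rewrite -aE av mulr0.
split=> [|i j ij].
  have [|q E] := @lform_dvd _ u (c - \prod_(i < 3) lform (s i *: a i)) u0.
    move=> v uv; rewrite evalvB cE // evalv_prod; under [X in _ - X]eq_bigr do rewrite aE.
    by rewrite !big_ord_recl !big_ord0 /s /=; ring.
  by exists q; rewrite -E addrC subrK.
have [p1 [p2 [u1 u2 a1 a2 a3]]] := fr _ _ ij.
by apply: (free3_witness u0 u1 u2); rewrite aE ?a2 ?mulr0 // mulf_neq0.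
Qed.

Lemma ord3P (P : 'I_3 -> Prop) : P ord0 -> P (lift ord0 ord0) -> P (lift ord0 (lift ord0 ord0)) ->
  forall i, P i.
Proof.
move=> P0 P1 P2 [[|[|[|i]]] lt] //.
- by rewrite (_ : Ordinal lt = ord0) //; apply: val_inj.
- by rewrite (_ : Ordinal lt = lift ord0 ord0) //; apply: val_inj.
- by rewrite (_ : Ordinal lt = lift ord0 (lift ord0 ord0)) //; apply: val_inj.
Qed.

End ThreeLines.

Section SingularFibers.
Variable K : closedFieldType.
Notation vec := 'rV[K]_4.
Notation form := {mpoly K[4]}.
Hypotheses (char2 : 2%:R != 0 :> K) (char3 : 3%:R != 0 :> K).
Variables (e : K) (h : nat -> K) (l : {vspace vec}) (B : 'M[K]_4) (f : form).
Hypothesis lB : chart_of l B.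
Hypothesis fh : forall x0 x1 x2 x3,
  evalv f (pt B x0 x1 x2 x3) = quartic (nq 0 e) (nr 0 e) h x0 x1 x2 x3.
Hypothesis lline : is_line l.
Hypothesis fsmooth : smooth_surface f.

Let Bu : B \in unitmx := proj1 lB.
Let g := rest e h.
Let fE := fE fh.
Let n1 : (1 : K) <> 0.
Proof. by apply/eqP; rewrite oner_eq0. Qed.

Local Notation cub := (cub e h).
Local Notation cub0 := (cub0 e).
Local Notation cub1 := (cub1 e).
Local Notation cubz := (cubz e h).
Local Notation cubd := (cubd e h).
Local Notation is_fiber_eq := (is_fiber_eq e h B).

Lemma fiber_singE s t c x0 x1 z : (s, t) <> (0, 0) -> is_fiber_eq s t c ->
  curve_sing (plane B s t) c (pt B x0 x1 (z * s) (z * t)) <->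
  [/\ (x0, x1, z) <> (0, 0, 0), cub s t x0 x1 z = 0, cub0 s t x0 x1 z = 0,
      cub1 s t x0 x1 z = 0 & cubz s t x0 x1 z = 0].
Proof.
move=> st [k k0 cE].
have cE' y0 y1 w : evalv c (pt B y0 y1 (w * s) (w * t)) =
    k * fibc (nq 0 e) (nr 0 e) h s t y0 y1 w by rewrite fibc_cub.
rewrite (curve_singE lB x0 x1 z st k0 cE').
by rewrite fibc_cub fib0_cub fib1_cub fibz_cub.
Qed.

(** The points with coordinates [y0], [y1], [w] separate the lines; this proves their
    independence modulo the equation of the plane. *)
Lemma chart_three_lines s t c o (a b m y0 y1 w : 'I_3 -> K) :
    (s, t) <> (0, 0) -> is_fiber_eq s t c ->
    (forall x0 x1 z, evalv (X B o) (pt B x0 x1 (z * s) (z * t)) = z) ->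
    (forall x0 x1 z, cub s t x0 x1 z = \prod_(i < 3) (a i * x0 + b i * x1 + m i * z)) ->
    (forall i, a i * y0 i + b i * y1 i + m i * w i = 0) ->
    (forall i j, i != j -> a i * y0 j + b i * y1 j + m i * w j != 0) ->
  exists a', three_lines (plane B s t) c a' /\
    (concurrent (plane B s t) a' <-> exists x0 x1 z, (x0, x1, z) <> (0, 0, 0) /\
       forall i, a i * x0 + b i * x1 + m i * z = 0).
Proof.
move=> st [k k0 cE] oE fac y0E yN.
have u0 : plane B s t != 0.
  by apply/eqP => /(plane_eq0 lB) [s0 t0]; apply: st; rewrite s0 t0.
pose A i := a i *: covec B o0 + b i *: covec B o1 + m i *: covec B o.
have AE i x0 x1 z : evalv (lform (A i)) (pt B x0 x1 (z * s) (z * t)) = a i * x0 + b i * x1 + m i * z.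
  rewrite !lformD !lformZ !evalvD !evalvZ -!/(X _ _) oE !(Xpt Bu) //.
have inpl x0 x1 z : evalv (lform (plane B s t)) (pt B x0 x1 (z * s) (z * t)) = 0.
  by rewrite (evalv_plane lB); ring.
have [v uv|i j ij|a' [tl cc]] := @three_lines_intro _ (plane B s t) c k A u0 k0.
- have [x0 [x1 [z ->]]] := in_planeE lB st uv.
  by rewrite cE fac; congr (_ * _); apply: eq_bigr => i _; rewrite AE.
- exists (pt B (y0 j) (y1 j) (w j * s) (w j * t)), (pt B (y0 i) (y1 i) (w i * s) (w i * t)).
  by rewrite !inpl !AE !y0E !yN // eq_sym.
exists a'; split=> //; split=> [/cc [v [v0 uv Av]]|[x0 [x1 [z [n0 Ax]]]]].
  have [x0 [x1 [z E]]] := in_planeE lB st uv; rewrite {}E in v0 Av.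
  exists x0, x1, z; split=> [[E0 E1 E2]|i]; last by rewrite -AE.
  by apply: v0; rewrite E0 E1 E2 !mul0r pt0.
apply/cc; exists (pt B x0 x1 (z * s) (z * t)); split=> [/(plane_pt_eq0 lB x0 x1 z st) /n0 //||i].
  exact: inpl.
by rewrite AE.
Qed.

(** In the tangent plane of the double ramification point the cubic is
    [(x1 + e z)^3 + G z^3]. *)
Lemma fiber_at_P1 c : is_fiber_eq 1 0 c ->
  kodaira_cubic IV (plane B 1 0) c /\ curve_sing (plane B 1 0) c (pt B 1 0 (0 * 1) (0 * 0)).
Proof.
move=> fc; have st : (1 : K, 0 : K) <> (0, 0) by case.
split; last first.
  apply/(fiber_singE _ _ _ st fc); split; first by case.
  - by rewrite /cub; ring.
  - by rewrite /cub0; ring.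
  - by rewrite /cub1; ring.
  - by rewrite /cubz; ring.
have [w1 [w2 [w3 [n12 n13 n23 wE]]]] := cube_roots char3 lB fh fsmooth.
pose w (i : 'I_3) := nth 0 [:: w1; w2; w3] i.
have wN i j : i != j -> w j - w i != 0.
  by elim/ord3P: i; elim/ord3P: j; rewrite ?eqxx //= subr_eq0 // eq_sym.
have [|x0 x1 z|i|i j|a [tl cc]] := @chart_three_lines 1 0 c o2 (fun=> 0) (fun=> 1) (fun i => e - w i)
  (fun=> 0) (fun i => w i - e) (fun=> 1) st fc.
- by move=> x0 x1 z; rewrite (Xpt Bu) /= mulr1.
- rewrite !big_ord_recl big_ord0 /w /= mulr1.
  have [->|z0] := eqVneq z 0; first by rewrite /cub; ring.
  have := wE (x1 / z + e); rewrite -/g => E.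
  transitivity (z ^+ 3 * ((x1 / z + e) ^+ 3 + g 0%N)).
    by rewrite /cub /gform -/g; field.
  by rewrite E; field.
- ring.
- move=> /wN; rewrite [X in _ -> X != 0](_ : _ = w j - w i) //; ring.
exists a; split=> //; apply/cc; exists 1, 0, 0; split=> [[] //|i]; ring.
Qed.

Lemma neq01 (s : K) : (s, 1 : K) <> (0, 0).
Proof. by case=> _ /n1. Qed.

(** By [S4f_factor] the cubic splits into three lines.  With the roots [r] of
    [x^3 - 3 x + s] a common point satisfies [x1 = e z (2 r - s)] for all of them, so
    that [e z = 0].  For [e = 0] they pass through (0 : 0 : s : 1). *)
Lemma fiber_at_root s c : gform g s 1 = 0 -> is_fiber_eq s 1 c ->
  kodaira_cubic (if e == 0 then IV else I3) (plane B s 1) c.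
Proof.
move=> g0 fc; have st := @neq01 s.
have [r1 [r2 [R sE]]] := cubic_roots s.
have [n12 n13 n23] : [/\ r1 != r2, r1 != - (r1 + r2) & r2 != - (r1 + r2)].
  by apply: (distinct_roots char3 lB fh fsmooth R); rewrite -sE.
pose r (i : 'I_3) := nth 0 [:: r1; r2; - (r1 + r2)] i.
have rN i j : i != j -> r j - r i != 0.
  by elim/ord3P: i; elim/ord3P: j; rewrite ?eqxx //= subr_eq0 // eq_sym.
pose m i := e * (r i ^+ 2 - 1) * (r i ^+ 2 - 4).
have [|x0 x1 z|i|i j|a [tl cc]] := @chart_three_lines s 1 c o3 (fun=> 1) (fun i => - r i) m
  r (fun=> 1) (fun=> 0) st fc.
- by move=> x0 x1 z; rewrite (Xpt Bu) /= mulr1.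
- rewrite !big_ord_recl big_ord0 /m /r /= mulr1.
  transitivity (S4f (e * z) x0 x1 (r1 * r2 * (r1 + r2)) 1).
    by rewrite -sE /cub -/g g0 /S4f; ring.
  by rewrite S4f_factor //; ring.
- ring.
- by move=> /rN; rewrite [X in _ -> X != 0](_ : _ = r j - r i) //; ring.
have mE i : m i = e * (4 - s * r i - 2 * r i ^+ 2).
  have r3 : r i ^+ 3 = 3 * r i - s.
    have cf := cubic_factor (r i) R; rewrite -sE in cf.
    apply: subr0_eq.
    transitivity (r i ^+ 3 - 3 * r i + s); first by ring.
    by rewrite cf; elim/ord3P: (i); rewrite /r /=; ring.
  transitivity (e * (r i * r i ^+ 3 - 5 * r i ^+ 2 + 4)); first by rewrite /m; ring.
  by rewrite r3; ring.
have [e0|e0] := eqVneq e 0; exists a; split=> //; apply/cc.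
  exists 0, 0, 1; split=> [[] //|i]; rewrite mE e0; ring.
move=> [x0 [x1 [z [n0 Ex]]]]; apply: n0.
have key i j k : i != j -> r k = - (r i + r j) -> x1 = e * z * (2 * r k - s).
  move=> ij rk; apply: (mulfI (rN _ _ ij)); apply: subr0_eq.
  transitivity ((1 * x0 + (- r i) * x1 + m i * z) - (1 * x0 + (- r j) * x1 + m j * z)).
    by rewrite !mE rk; ring.
  by rewrite !Ex subrr.
have K3 := key ord0 (lift ord0 ord0) (lift ord0 (lift ord0 ord0)) isT erefl.
have K2 := key ord0 (lift ord0 (lift ord0 ord0)) (lift ord0 ord0) isT.
have K1 := key (lift ord0 ord0) (lift ord0 (lift ord0 ord0)) ord0 isT.
have z0 : z = 0.
  apply/eqP; have : e * z * 2 * (r2 - r1) == 0.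
    rewrite [X in X == 0](_ : _ = e * z * (2 * r2 - s) - e * z * (2 * r1 - s)); last by ring.
    by rewrite -K1 -?K2 ?subrr //= /r /=; ring.
  by rewrite !mulf_eq0 (negbTE e0) (negbTE char2) subr_eq0 [r2 == r1]eq_sym (negbTE n12) !orbF.
have x10 : x1 = 0 by rewrite K3 z0; ring.
by have := Ex ord0; rewrite z0 x10 mulr0 mulr0 mul1r !addr0 => ->.
Qed.

(** A linear factor would give a line of the quartic that meets [l], in a plane
    excluded by [line_meeting_l]. *)
Lemma fiber_irreducible s c : gform g s 1 != 0 -> is_fiber_eq s 1 c ->
  irreducible_plane_curve 3 (plane B s 1) c.
Proof.
move=> gs [k k0 cE] d1 d2 a b q + + d3.
wlog d11 : a b d1 d2 d3 / d1 = 1%N.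
  move=> H d10 d20 ah bh E.
  have [d1E|d2E] : d1 = 1%N \/ d2 = 1%N.
    case: d1 d3 d10 {H ah} => [//|[|[|d1]]]; first by left.
      by rewrite !addSn add0n => -[->]; right.
    rewrite !addSn => -[/eqP]; rewrite addn_eq0 => /andP [_ /eqP E0].
    by rewrite E0 in d20.
  - exact: (H a b d1 d2).
  - by apply: (H b a d2 d1) => //; rewrite 1?addnC // mulrC.
rewrite d11 => _ _ ah bh E.
have [co aE] := expand1 Bu ah.
pose ga := co 2%N * s + co 3%N.
have aE' x0 x1 z : evalv a (pt B x0 x1 (z * s) (z * 1)) = co 0%N * x0 + co 1%N * x1 + ga * z.
  by rewrite aE /ga; ring.
have a0cub x0 x1 z : co 0%N * x0 + co 1%N * x1 + ga * z = 0 -> cub s 1 x0 x1 z = 0.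
  move=> La; apply: (mulfI k0); rewrite mulr0 -cE E evalvD !evalvM aE' La (evalv_plane lB); ring.
have al0 : co 0%N != 0.
  apply/eqP => al0; apply: n1; rewrite -[RHS](a0cub 1 0 0) /cub ?al0; ring.
pose p := pt B (- co 1%N) (co 0%N) 0 0.
pose p' := pt B (- ga) 0 (co 0%N * s) (co 0%N * 1).
have p0 : p <> 0 by case/(pt_eq0 Bu) => _ /eqP; rewrite (negbTE al0).
have pp' : p' \notin <[p]>%VS.
  apply/negP => /vlineP [y]; rewrite ptZ => /(pt_inj Bu) [_ _ _ /eqP].
  by rewrite mulr1 mulr0 (negbTE al0).
pose m := (<[p]> + <[p']>)%VS.
have p'm : p' \in m by exact: span2_right.
have pm : p \in m by exact: span2_left.
have mpt v : v \in m -> exists x0 x1 z, v = pt B x0 x1 (z * s) z /\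
    co 0%N * x0 + co 1%N * x1 + ga * z = 0.
  move=> /mem_span2 [y [y' ->]]; rewrite !ptZ ptD.
  eexists; eexists; exists (y' * co 0%N); split; last first.
    2: by congr pt; rewrite ?mulr0 ?add0r ?mulr1 // mulrA.
  by ring.
have dm : is_line m by apply: span2_line.
have mf : in_surface m f.
  move=> v /mpt [x0 [x1 [z [-> La]]]]; rewrite fE.
  transitivity (z * cub s 1 x0 x1 z); last by rewrite a0cub // mulr0.
  by rewrite /cub -/g /S4f /gform; ring.
have ml : meets m l.
  apply: (meets_not_in p'm _ p0 pm); last exact: pt_in_l.
  by apply/negP => /(proj2 lB) [_ /eqP]; rewrite mulr1 (negbTE al0).
have mu : in_plane m (plane B s 1).
  by move=> v /mpt [x0 [x1 [z [-> La]]]]; rewrite (evalv_plane lB); ring.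
case: (line_meeting_l char3 lB fh lline fsmooth dm mf ml) => [[y [_ mE]]|[rho [g0 mE]]].
  by move: mu; rewrite mE => /(apex_line_in_plane lB) /n1.
move: mu; rewrite mE => /(ruling_in_plane e lB) sE.
by move/eqP: gs; apply; rewrite sE mul1r.
Qed.

Lemma ord2P (P : 'I_2 -> Prop) : P ord0 -> P ord_max -> forall i, P i.
Proof.
by move=> P0 P1 [[|[|i]] lt] //; [rewrite (_ : Ordinal lt = ord0) | rewrite (_ : Ordinal lt = ord_max)] => //;
  apply: val_inj.
Qed.

(** At a double point whose quadratic part splits, the tangents join the point
    to the zeros of the factors. *)
Lemma tangent_atE s t c x0 x1 z k (la : 'I_2 -> K -> K -> K -> K) (y0 y1 w : 'I_2 -> K) :
  let v := pt B x0 x1 (z * s) (z * t) in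
  let m i := (<[v]> + <[pt B (y0 i) (y1 i) (w i * s) (w i * t)]>)%VS in
  (s, t) <> (0, 0) -> is_fiber_eq s t c -> k != 0 ->
  curve_sing (plane B s t) c v ->
  (forall a0 a1 a, cubd s t a0 a1 a x0 x1 z = k * la ord0 a0 a1 a * la ord_max a0 a1 a) ->
  (forall i, pt B (y0 i) (y1 i) (w i * s) (w i * t) \notin <[v]>%VS) ->
  (forall i a0 a1 a, pt B a0 a1 (a * s) (a * t) \in m i <-> la i a0 a1 a = 0) ->
  forall n, tangent_at (plane B s t) c v n <-> n = m ord0 \/ n = m ord_max.
Proof.
move=> v m st fc k0 sing dE yv mP n; have [k' k'0 cE] := fc.
have inpl a0 a1 a : evalv (lform (plane B s t)) (pt B a0 a1 (a * s) (a * t)) = 0.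
  by rewrite (evalv_plane lB); ring.
have v0 : v <> 0 by case: sing => [[]].
have dm i : is_line (m i) by apply: span2_line.
have vm i : v \in m i by exact: span2_left.
have RE a0 a1 a := fiber_eq_restr cE x0 x1 z a0 a1 a.
split=> [[dn nu /(_ isT) [vn nX]]|].
  have [q qn qv] := line_other_point dn vn.
  have [a0 [a1 [a Eq]]] := in_planeE lB st (nu _ qn).
  have /dvdXn_coef /(_ 2%N isT) := nX _ qn; rewrite Eq RE /= dE => /eqP.
  rewrite 2!mulf_eq0 (negbTE k'0) /= mulf_eq0 (negbTE k0) /=.
  have nE i : la i a0 a1 a = 0 -> n = m i.
    move=> /mP; rewrite -Eq => qm.
    by rewrite (line_eq_span2 dn v0 qv vn qn) -(line_eq_span2 (dm i) v0 qv (vm i) qm).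
  by case/orP => /eqP /nE ->; [left | right].
have tan i : tangent_at (plane B s t) c v (m i).
  have mu : in_plane (m i) (plane B s t).
    move=> q /mem_span2 [a [a' ->]].
    by rewrite evalv_lformD !evalv_lformZ !inpl !mulr0 addr0.
  split=> // _; split=> // q qm.
  have [a0 [a1 [a Eq]]] := in_planeE lB st (mu _ qm).
  move: qm; rewrite Eq => /mP la0.
  apply/dvdXn_coef => j j3; rewrite RE.
  have /(fiber_singE _ _ _ st fc) [_ c0 d0 d1 dz] := sing.
  have d2 : cubd s t a0 a1 a x0 x1 z = 0.
    by rewrite dE; elim/ord2P: i {mu} la0 => ->; ring.
  by case: j j3 => [|[|[|j]]] // _ /=; rewrite ?c0 ?d2 /cubd ?d0 ?d1 ?dz; ring.
by case=> ->.
Qed.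

Lemma ramified_gform s t : (s, t) <> (0, 0) -> s ^+ 2 = 4 * t ^+ 2 -> gform g s t != 0.
Proof.
move=> st D; have t0 : t != 0.
  apply/eqP => t0; apply: st; move/eqP: D; rewrite t0 expr0n mulr0 expf_eq0 /= => /eqP ->.
  by [].
pose y := s / (2 * t); have sE : s = t * (2 * y) by rewrite /y; field; rewrite t0 char2.
have y2 : y ^+ 2 = 1.
  apply: (mulfI (mulf_neq0 (mulf_neq0 char2 char2) (expf_neq0 2 t0))).
  rewrite mulr1 [RHS](_ : _ = 4 * t ^+ 2); last by ring.
  by rewrite -D sE; ring.
have := smooth_ramified Bu fE fsmooth y2; rewrite -/g.
apply: contra_neq => gst; apply: (mulfI (expf_neq0 4 t0)).
by rewrite mulr0 -[RHS]gst sE /gform; ring.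
Qed.

(** In the planes of the simple ramification points the cubic is
    [(x0 - eps x1)^2 (x0 + 2 eps x1) + G z^3], a cusp. *)
Lemma fiber_at_ramified eps c : eps ^+ 2 = 1 -> is_fiber_eq (2 * eps) 1 c ->
  kodaira_cubic II (plane B (2 * eps) 1) c.
Proof.
move=> eps2 fc; have st := @neq01 (2 * eps).
have D0 : (2 * eps) ^+ 2 - 4 * 1 ^+ 2 = 0 by rewrite exprMn eps2; ring.
have eps0 : eps != 0 by apply/eqP => E; apply: n1; rewrite -eps2 E expr0n.
have G0 : gform g (2 * eps) 1 != 0 by apply: ramified_gform st _; rewrite exprMn eps2; ring.
have sing : curve_sing (plane B (2 * eps) 1) c (pt B eps 1 (0 * (2 * eps)) (0 * 1)).
  apply/(fiber_singE _ _ _ st fc); split; first by case=> _ /n1.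
  - rewrite /cub D0 [RHS](_ : _ = eps * (eps ^+ 2 - 1)); last by rewrite eps2 subrr mulr0.
    by ring.
  - by rewrite /cub0 D0 eps2; ring.
  - by rewrite /cub1 D0; ring.
  - by rewrite /cubz D0; ring.
split; first exact: (fiber_irreducible G0 fc).
pose v := pt B eps 1 (0 * (2 * eps)) (0 * 1).
pose la (_ : 'I_2) (a0 a1 _ : K) := a0 - eps * a1.
have dE a0 a1 a : cubd (2 * eps) 1 a0 a1 a eps 1 0 = 3 * eps * la ord0 a0 a1 a * la ord_max a0 a1 a.
  rewrite /la /cubd /cub0 /cub1 /cubz D0.
  transitivity (3 * eps * (a0 - eps * a1) * (a0 - eps * a1) + 3 * (1 - eps ^+ 2) * (eps * a1 ^+ 2 - 2 * a0 * a1)).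
    ring.
  by rewrite eps2 subrr mulr0 mul0r addr0.
have yv (i : 'I_2) : pt B 0 0 (1 * (2 * eps)) (1 * 1) \notin <[v]>%VS.
  by apply/negP => /vlineP [y]; rewrite ptZ => /(pt_inj Bu) [_ _ _]; rewrite !mul0r mulr0 mulr1 => /n1.
have mP (i : 'I_2) a0 a1 a : pt B a0 a1 (a * (2 * eps)) (a * 1)
    \in (<[v]> + <[pt B 0 0 (1 * (2 * eps)) (1 * 1)]>)%VS <-> la i a0 a1 a = 0.
  split=> [/mem_span2 [y [y' ]]|/subr0_eq ->].
    by rewrite /la !ptZ ptD => /(pt_inj Bu) [-> -> _ _]; ring.
  by apply/mem_span2; exists a1, a; rewrite !ptZ ptD; congr (pt B _ _ _ _); ring.
have H := tangent_atE st fc (mulf_neq0 char3 eps0) sing dE yv mP.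
exists v, (<[v]> + <[pt B 0 0 (1 * (2 * eps)) (1 * 1)]>)%VS; split=> // m.
by apply: iff_trans (H m) _; split=> [[]|->] //; left.
Qed.

(** The node is the point of the plane on the line of [nodal].  Its tangents are the
    factors of [Y0^2 - s Y0 Y1 + Y1^2] in the coordinates centered at the node; they
    are distinct for [s^2 != 4]. *)
Lemma fiber_at_nodal s c : e != 0 -> gform (nodal e g) s 1 = 0 -> is_fiber_eq s 1 c ->
  kodaira_cubic I1 (plane B s 1) c.
Proof.
move=> e0 H0 fc; have st := @neq01 s.
have GE : gform g s 1 = 8 * e ^+ 3 * (s ^+ 2 - 4 * 1 ^+ 2).
  apply: subr0_eq; rewrite -[RHS]H0 /gform /nodal /=; ring.
have D0 : s ^+ 2 - 4 * 1 ^+ 2 != 0.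
  apply/negP => /eqP D0; have := @ramified_gform s 1 st.
  by rewrite GE D0 mulr0 eqxx => /(_ (subr0_eq D0)).
have G0 : gform g s 1 != 0.
  rewrite GE mulf_neq0 // mulf_neq0 ?expf_neq0 // [X in X != 0](_ : _ = 2 ^+ 3) ?expf_neq0 //; ring.
split; first exact: (fiber_irreducible G0 fc).
have [[y Ey] _] := exists_monic_root 0 (- s) 1.
have yE : s * y = y ^+ 2 + 1 by apply/eqP; rewrite -subr_eq0 -oppr_eq0 -[X in _ == X]Ey; apply/eqP; ring.
have y2 : y * (s - y) = 1 by rewrite mulrBr mulrC yE; ring.
have yy : y != s - y.
  apply: contra_neq D0 => E; have sE : s = 2 * y by rewrite -[LHS](subrK y) -E; ring.
  move: y2; rewrite -E -expr2 => y2.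
  rewrite sE exprMn y2; ring.
pose v := pt B (- (2 * e)) (- (e * s)) (1 * s) (1 * 1).
have sing : curve_sing (plane B s 1) c v.
  apply/(fiber_singE _ _ _ st fc); rewrite /cub /cub0 /cub1 /cubz -/g GE; split; try ring.
  by case=> _ _ /n1.
pose ro (i : 'I_2) := if i == ord0 then y else s - y.
pose la i (a0 a1 a : K) := (a0 + 2 * e * a) - ro i * (a1 + e * s * a).
have char6 : - (6 * e) != 0.
  rewrite oppr_eq0 mulf_neq0 // [X in X != 0](_ : _ = 2 * 3) ?mulf_neq0 //; ring.
have dE a0 a1 a : cubd s 1 a0 a1 a (- (2 * e)) (- (e * s)) 1 =
    - (6 * e) * la ord0 a0 a1 a * la ord_max a0 a1 a.
  rewrite /cubd /cub0 /cub1 /cubz -/g GE /la /ro /=.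
  set A0 := a0 + 2 * _ * _; set A1 := a1 + _.
  transitivity (- (6 * e) * (A0 ^+ 2 - s * A0 * A1 + 1 * A1 ^+ 2)); first by rewrite /A0 /A1; ring.
  by rewrite -y2; ring.
have yv (i : 'I_2) : pt B (ro i) 1 (0 * s) (0 * 1) \notin <[v]>%VS.
  apply/negP => /vlineP [k]; rewrite ptZ => /(pt_inj Bu) [_ + _].
  by rewrite mul0r !mulr1 => + k0; rewrite -k0 mul0r => /n1.
have mP (i : 'I_2) a0 a1 a : pt B a0 a1 (a * s) (a * 1)
    \in (<[v]> + <[pt B (ro i) 1 (0 * s) (0 * 1)]>)%VS <-> la i a0 a1 a = 0.
  split=> [/mem_span2 [k [k' ]]|E].
    by rewrite /la !ptZ ptD => /(pt_inj Bu) [-> -> _]; rewrite !mulr1 => ->; ring.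
  apply/mem_span2; exists a, (a1 + e * s * a); rewrite !ptZ ptD; congr (pt B _ _ _ _); try ring.
  by apply/eqP; rewrite -subr_eq0 -[X in _ == X]E /la; apply/eqP; ring.
have H := tangent_atE st fc char6 sing dE yv mP.
exists v; do 2 eexists; split; [exact: sing | | exact: H].
move=> E; have : pt B (ro ord0) 1 (0 * s) (0 * 1) \in (<[v]> + <[pt B (ro ord_max) 1 (0 * s) (0 * 1)]>)%VS.
  by rewrite -E; exact: span2_right.
move=> /mP /eqP; rewrite /la /ro /= [X in X == 0](_ : _ = y - (s - y)); last by ring.
by rewrite subr_eq0 (negbTE yy).
Qed.

(** Let [D = s^2 - 4].  At a singular point with [z = 1] the derivatives with respect
    to [x0], [x1] are multiples of [N0], [N1]; in the ideal of these the cubic is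
    [G + e D E], and [D E] times the differences to the node of [fiber_at_nodal]
    vanish.  So [D = 0], or [E = G = 0], or the point is that node. *)
Lemma singular_fiber s c : is_fiber_eq s 1 c -> (exists v, curve_sing (plane B s 1) c v) ->
  [\/ gform g s 1 = 0, s ^+ 2 = 4 | gform (nodal e g) s 1 = 0].
Proof.
move=> fc [v sv]; have st := @neq01 s.
have [x0 [x1 [z Ev]]] : exists x0 x1 z, v = pt B x0 x1 (z * s) (z * 1).
  by case: (sv) => [[_ uv _] _]; exact: (in_planeE lB st uv).
move: sv; rewrite Ev => /(fiber_singE _ _ _ st fc) [n0 c0 d0 d1 dz].
set D := s ^+ 2 - 4 * 1 ^+ 2; have [D0|D0] := eqVneq D 0.
  by apply: Or32; apply: subr0_eq; rewrite -[RHS]D0 /D; ring.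
have [z0|z0] := eqVneq z 0.
  case/eqP: D0; have x0E : x0 ^+ 2 = x1 ^+ 2.
    apply/eqP; rewrite -subr_eq0 -(mulrI_eq0 _ (mulfI char3)); apply/eqP.
    by rewrite -[RHS]d0 /cub0 z0; ring.
  have x10 : x1 != 0.
    apply/eqP => x10; apply: n0; move/eqP: x0E; rewrite x10 z0 [0 ^+ 2]expr0n expf_eq0 /= => /eqP ->.
    by [].
  have sx : s * x1 = 2 * x0.
    apply: (mulfI (mulf_neq0 char3 x10)); apply: subr0_eq.
    by rewrite -[RHS]d1 /cub1 z0; ring.
  apply: (mulIf (expf_neq0 2 x10)); rewrite mul0r.
  transitivity ((s * x1) ^+ 2 - 4 * x1 ^+ 2); first by rewrite /D; ring.
  by rewrite sx -x0E; ring.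
pose y0 := x0 / z; pose y1 := x1 / z.
have x0E : x0 = z * y0 by rewrite /y0 mulrC divfK.
have x1E : x1 = z * y1 by rewrite /y1 mulrC divfK.
pose N0 := y0 ^+ 2 - y1 ^+ 2 + e ^+ 2 * D.
pose N1 := s * y1 ^+ 2 - 2 * y0 * y1 + 2 * e * D * y1 + e ^+ 2 * D * s.
pose E := y1 ^+ 2 + 2 * e * (y0 + s * y1) + e ^+ 2 * D.
have z2 := mulf_neq0 char3 (expf_neq0 2 z0).
have N00 : N0 = 0.
  by apply: (mulfI z2); rewrite mulr0 -[RHS]d0 x0E x1E /N0 /cub0 -/D; ring.
have N10 : N1 = 0.
  by apply: (mulfI z2); rewrite mulr0 -[RHS]d1 x0E x1E /N1 /cub1 -/D; ring.
have GE : gform g s 1 = - (e * D * E).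
  apply: (mulfI (expf_neq0 3 z0)); apply: subr0_eq.
  transitivity (cub s 1 x0 x1 z - z ^+ 3 * (y0 * N0 + y1 * N1)).
    by rewrite x0E x1E /N0 /N1 /E /cub -/D -/g; ring.
  by rewrite c0 N00 N10; ring.
have [E0|E0] := eqVneq E 0; first by apply: Or31; rewrite GE E0; ring.
have y1E : y1 = - (e * s).
  apply: (mulfI (mulf_neq0 D0 E0)); apply: subr0_eq.
  transitivity (4 * y1 * N0 + (e * D + 2 * y0 + s * y1) * N1); last by rewrite N00 N10; ring.
  by rewrite /E /N0 /N1 /D; ring.
have y0E : y0 = - (2 * e).
  apply: (mulfI (mulf_neq0 D0 E0)); apply: subr0_eq.
  transitivity ((2 * e * D + 2 * s * y1) * N0 + (s * y0 + 2 * y1) * N1); last by rewrite N00 N10; ring.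
  by rewrite /E /N0 /N1 /D; ring.
apply: Or33; transitivity (gform g s 1 - 8 * e ^+ 3 * D); first by rewrite /gform /nodal /D /=; ring.
by rewrite GE /E y0E y1E /D; ring.
Qed.

Lemma plane_norm s t : t != 0 -> plane B s t = t *: plane B (s / t) 1.
Proof. by move=> t0; rewrite planeZ mulr1 mulrC divfK. Qed.

(** The identity of [concurrent_invariant] has only the zero solution for [t] and [e]
    nonzero. *)
Lemma IV_plane u c : e != 0 -> fiber f l u c -> kodaira_cubic IV u c -> <[u]>%VS = <[plane B 1 0]>%VS.
Proof.
move=> e0 fc IVc; have [s [t [st uE fE']]] := fiber_cub lB fh fc; have [k k0 cE] := fE'.
have cE' x0 x1 z : evalv c (pt B x0 x1 (z * s) (z * t)) =
    k * fibc (nq 0 e) (nr 0 e) h s t x0 x1 z by rewrite fibc_cub.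
have [m0 [m1 [mz [n0 _ inv]]]] := concurrent_invariant lB st k0 uE cE' IVc.
have I x0 x1 z : cubd s t x0 x1 z m0 m1 mz = 0 by rewrite -fibd_cub.
have t0 : t = 0.
  apply/eqP; apply: contra_notT n0 => t0.
  have m00 : m0 = 0.
    by apply: (mulfI (mulf_neq0 char3 t0)); rewrite mulr0 -[RHS](I 1 0 0) /cubd /cub0 /cub1 /cubz; ring.
  have m10 : m1 = 0.
    apply: (mulfI (mulf_neq0 (mulf_neq0 char2 char3) t0)).
    transitivity (cubd s t 0 1 0 m0 m1 mz - cubd s t 1 1 0 m0 m1 mz).
      by rewrite m00 /cubd /cub0 /cub1 /cubz; ring.
    by rewrite !I; ring.
  rewrite m00 m10; congr (_, _, _); apply/eqP; apply: contraT => mz0.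
  have D0 : s ^+ 2 - 4 * t ^+ 2 = 0.
    apply: (mulfI (mulf_neq0 (mulf_neq0 char3 e0) mz0)).
    by rewrite mulr0 -[RHS](I 0 1 0) m00 m10 /cubd /cub0 /cub1 /cubz; ring.
  case/eqP: (ramified_gform st (subr0_eq D0)).
  apply: (mulfI (mulf_neq0 char3 mz0)).
  by rewrite mulr0 -[RHS](I 0 0 1) m00 m10 /cubd /cub0 /cub1 /cubz D0; ring.
have s0 : s != 0 by apply/eqP => s0; apply: st; rewrite s0 t0.
apply/(vline_eqP); first by move=> /(plane_eq0 lB) [/n1].
by exists s => //; rewrite uE t0 planeZ mulr1 mulr0.
Qed.

(** Three linear forms in four variables. *)
Lemma common_zero3 (u a b : vec) : exists v, [/\ v <> 0, evalv (lform u) v = 0,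
  evalv (lform a) v = 0 & evalv (lform b) v = 0].
Proof.
pose M : 'M[K]_(4, 3) := \matrix_(i, j) nth 0 [:: u ord0 i; a ord0 i; b ord0 i] j.
have : kermx M != 0.
  by rewrite -mxrank_eq0 mxrank_ker -lt0n subn_gt0 (leq_ltn_trans (rank_leq_col M)).
rewrite -nz_row_eq0 => v0; exists (nz_row (kermx M)).
have vM : nz_row (kermx M) *m M = 0 by apply/sub_kermxP; exact: nz_row_sub.
have H (j : 'I_3) : \sum_i nz_row (kermx M) ord0 i * M i j = 0.
  by have := congr1 (fun A : 'rV_3 => A ord0 j) vM; rewrite !mxE.
split; first exact/eqP.
- rewrite evalv_lform -[RHS](H ord0); apply: eq_bigr => i _; by rewrite mxE mulrC.
- rewrite evalv_lform -[RHS](H (lift ord0 ord0)); apply: eq_bigr => i _; by rewrite mxE mulrC.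
- rewrite evalv_lform -[RHS](H (lift ord0 (lift ord0 ord0))); apply: eq_bigr => i _; by rewrite mxE mulrC.
Qed.

(** For [e = 0] a fiber has at most one singular point, but three general lines
    have three. *)
Lemma I3_nodal u c : fiber f l u c -> kodaira_cubic I3 u c -> e != 0.
Proof.
move=> fc [a [[[q cE] fr] ncc]]; apply/eqP => e0; apply: ncc.
have [s [t [st uE fE']]] := fiber_cub lB fh fc.
have sing v (i j : 'I_3) : i != j -> v <> 0 -> evalv (lform u) v = 0 ->
    evalv (lform (a i)) v = 0 -> evalv (lform (a j)) v = 0 -> curve_sing u c v.
  move=> ij v0 uv ai aj.
  have cEij : c = lform (a i) * (lform (a j) * \prod_(k < 3 | (k != i) && (k != j)) lform (a k)) + lform u * q.
    by rewrite cE (bigD1 i) //= (bigD1 j) //= eq_sym.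
  split=> [|w uw]; first by split; rewrite // cEij evalvD !evalvM ai uv !mul0r addr0.
  rewrite dird_mderiv cEij dirdD !dirdM !dird_lform ai uw uv evalvM aj; ring.
have [n nP] : exists n : vec, forall v, curve_sing u c v -> v \in <[n]>%VS.
  have [k k0 _] := fE'.
  have singE v : curve_sing u c v -> exists x0 x1 z, [/\ v = pt B x0 x1 (z * s) (z * t),
      3 * t * (x0 ^+ 2 - x1 ^+ 2) = 0, 3 * x1 * (s * x1 - 2 * t * x0) = 0
      & 3 * gform g s t * z ^+ 2 = 0].
    move=> sv; have [[_ uv _] _] := sv; rewrite uE in sv uv.
    have [x0 [x1 [z Ev]]] := in_planeE lB st uv; exists x0, x1, z.
    move: sv; rewrite Ev => /(fiber_singE _ _ _ st fE') [_ _ d0 d1 dz]; split=> //.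
    - by rewrite -[RHS]d0 /cub0 e0; ring.
    - by rewrite -[RHS]d1 /cub1 e0; ring.
    - by rewrite -[RHS]dz /cubz -/g; move: (gform g s t) => G; rewrite e0; ring.
  have [t0|t0] := eqVneq t 0.
    have s0 : s != 0 by apply/eqP => s0; apply: st; rewrite s0 t0.
    exists (pt B 1 0 0 0) => v /singE [x0 [x1 [z [-> _ E1 E2]]]]; apply/vlineP; exists x0.
    have g0 : g 0%N != 0 := smooth_g0 Bu fE fsmooth.
    have x10 : x1 = 0.
      apply/eqP; rewrite -[_ == 0](expf_eq0 _ 2) -(mulrI_eq0 _ (mulfI (mulf_neq0 char3 s0))).
      by apply/eqP; rewrite -[RHS]E1 t0; ring.
    have z0 : z = 0.
      apply/eqP; rewrite -[_ == 0](expf_eq0 _ 2).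
      rewrite -(mulrI_eq0 _ (mulfI (mulf_neq0 (mulf_neq0 char3 g0) (expf_neq0 4 s0)))).
      by apply/eqP; rewrite -[RHS]E2 t0 /gform; ring.
    by rewrite ptZ x10 z0; congr (pt B _ _ _ _); ring.
  have x01 x0 x1 : 3 * t * (x0 ^+ 2 - x1 ^+ 2) = 0 -> x0 ^+ 2 = x1 ^+ 2.
    by move=> /eqP; rewrite mulf_eq0 (negbTE (mulf_neq0 char3 t0)) subr_eq0 => /eqP.
  have [G0|G0] := eqVneq (gform g s t) 0.
    exists (pt B 0 0 s t) => v /singE [x0 [x1 [z [-> /x01 E0 E1 _]]]]; apply/vlineP; exists z.
    have x10 : x1 = 0.
      apply/eqP; apply: contraT => x10.
      have sx : s * x1 = 2 * t * x0.
        apply: (mulfI (mulf_neq0 char3 x10)); apply: subr0_eq.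
        by rewrite -[RHS]E1; ring.
      suff /(ramified_gform st) : s ^+ 2 = 4 * t ^+ 2 by rewrite -/g G0 eqxx.
      apply: (mulIf (expf_neq0 2 x10)); transitivity ((s * x1) ^+ 2); first by ring.
      by rewrite sx -E0; ring.
    have x00 : x0 = 0 by apply/eqP; rewrite -[_ == 0](expf_eq0 _ 2) E0 x10 expr0n.
    by rewrite ptZ x10 x00 !mulr0.
  exists (pt B (s / (2 * t)) 1 0 0) => v /singE [x0 [x1 [z [-> /x01 E0 E1 E2]]]].
  apply/vlineP; exists x1.
  have z0 : z = 0.
    apply/eqP; rewrite -[_ == 0](expf_eq0 _ 2) -(mulrI_eq0 _ (mulfI (mulf_neq0 char3 G0))).
    exact/eqP.
  have x0E : x0 = x1 * (s / (2 * t)).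
    have [x10|x10] := eqVneq x1 0.
      by apply/eqP; rewrite x10 mul0r -[_ == 0](expf_eq0 _ 2) E0 x10 expr0n.
    apply: (mulfI (mulf_neq0 char3 x10)); apply: subr0_eq.
    transitivity (- (2 * t)^-1 * (3 * x1 * (s * x1 - 2 * t * x0))); last by rewrite E1 mulr0.
    by field; rewrite t0 char2.
  by rewrite ptZ z0 -x0E mulr1 !mul0r mulr0.
have [v [v0 uv v1 v2]] := common_zero3 u (a ord0) (a (lift ord0 ord0)).
have [w [w0 uw w1 w2]] := common_zero3 u (a ord0) (a (lift ord0 (lift ord0 ord0))).
have /vlineP [k Ek] := nP _ (sing _ ord0 (lift ord0 ord0) isT v0 uv v1 v2).
have /vlineP [k' Ek'] := nP _ (sing _ ord0 (lift ord0 (lift ord0 ord0)) isT w0 uw w1 w2).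
exists v; split=> //; elim/ord3P => //.
have k'0 : k' != 0 by apply/eqP => k'0; apply: w0; rewrite Ek' k'0 scale0r.
have -> : v = (k / k') *: w by rewrite Ek Ek' scalerA divfK.
by rewrite evalv_lformZ w2 mulr0.
Qed.

Definition fibers_of_type (R : seq K) (T : seq kodaira) : Prop :=
  size R = size T /\ forall i, (i < size T)%N ->
    forall c, is_fiber_eq R`_i 1 c -> kodaira_cubic (nth I1 T i) (plane B R`_i 1) c.

Lemma fibers_of_type_nseq k n (R : seq K) : size R = n ->
  (forall x, x \in R -> forall c, is_fiber_eq x 1 c -> kodaira_cubic k (plane B x 1) c) ->
  fibers_of_type R (nseq n k).
Proof.
move=> <- H; split=> [|i]; rewrite size_nseq // => iR c.
by rewrite nth_nseq iR; apply: H; rewrite mem_nth.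
Qed.

Lemma fibers_of_type_cat R R' T T' : fibers_of_type R T -> fibers_of_type R' T' -> fibers_of_type (R ++ R') (T ++ T').
Proof.
move=> [sR H] [sR' H']; split=> [|i]; first by rewrite !size_cat sR sR'.
rewrite size_cat => iT c; rewrite !nth_cat sR; case: ltnP => [iT'|iT']; first exact: H.
by apply: H'; rewrite ltn_subLR.
Qed.

(** The planes [(x : 1)] with [x] in [R], together with the plane of
    [fiber_at_P1], exhaust the singular fibers by [singular_fiber]. *)
Lemma fibration_type_intro R T : fibers_of_type R T -> uniq R ->
    (forall s, [\/ gform g s 1 = 0, s ^+ 2 = 4 | gform (nodal e g) s 1 = 0] -> s \in R) ->
  fibration_type f l (IV :: T).
Proof.
move=> [sR RT] uR Rc; exists (plane B 1 0 :: [seq plane B x 1 | x <- R]).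
have st : (1 : K, 0 : K) <> (0, 0) by case=> /n1.
split.
- by rewrite /= size_map sR.
- rewrite /= -map_comp map_inj_in_uniq ?uR ?andbT; last by move=> x y _ _ /(plane1_inj lB).
  apply/mapP => -[x _ /= /(vline_eqP _ (plane1_neq0 lB (x := x))) [k k0]].
  by rewrite planeZ mulr1 => /(plane_inj lB) [_ k00]; rewrite -k00 eqxx in k0.
- case=> [|i] iT /=.
    have [c fc ce] := fiber_plane_exists lB fh st.
    by exists c; split=> //; case: (fiber_at_P1 ce).
  rewrite (nth_map 0) ?sR //.
  have [c fc ce] := fiber_plane_exists lB fh (@neq01 R`_i).
  by exists c; split=> //; apply: RT.
move=> u c fc sing; have [s [t [st' uE [k k0 cE]]]] := fiber_cub lB fh fc.
rewrite uE inE; have [t0|t0] := eqVneq t 0.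
  have s0 : s != 0 by apply/eqP => s0; apply: st'; rewrite s0 t0.
  apply/orP; left; apply/eqP/vline_eqP; first by move=> /(plane_eq0 lB) [/n1].
  by exists s => //; rewrite t0 planeZ mulr1 mulr0.
apply/orP; right; apply/mapP; exists (plane B (s / t) 1); last first.
  by apply/(vline_eqP _ (plane1_neq0 lB (x := s / t))); exists t => //; rewrite -plane_norm.
apply: map_f; apply: Rc.
have ce : is_fiber_eq (s / t) 1 c.
  exists (k * t); first by rewrite mulf_neq0.
  move=> x0 x1 z.
  have -> : pt B x0 x1 (z * (s / t)) (z * 1) = pt B x0 x1 ((z / t) * s) ((z / t) * t).
    by congr (pt B _ _ _ _); field.
  by rewrite cE /cub /gform; field.
apply: (singular_fiber ce).
have [v [[v0 uv cv] dv]] := sing; exists v; split=> [|w uw].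
  by split=> //; apply: (mulfI t0); rewrite mulr0 -[RHS]uv uE (plane_norm s t0) lformZ evalvZ.
by apply: dv; rewrite uE (plane_norm s t0) lformZ evalvZ uw mulr0.
Qed.

Lemma prod_root_mem (y s : K) (R : seq K) : y != 0 ->
  (y * \prod_(x <- R) (s - x * 1) == 0) = (s \in R).
Proof.
move=> y0; rewrite mulf_eq0 (negbTE y0) /= prodf_seq_eq0 -has_pred1.
by apply: eq_has => x /=; rewrite mulr1 subr_eq0 eq_sym.
Qed.

Variable r : seq K.
Hypotheses (r4 : size r = 4%N) (runiq : uniq r).
Hypothesis gr : forall s t, gform g s t = g 0%N * \prod_(x <- r) (s - x * t).

Let root_mem s : (gform g s 1 == 0) = (s \in r).
Proof.
have g0 : g 0%N != 0 := smooth_g0 Bu fE fsmooth.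
by rewrite gr; apply: prod_root_mem.
Qed.

Let two_uniq : uniq [:: 2; - 2 : K].
Proof.
by rewrite /= inE andbT -subr_eq0 opprK [X in X != 0](_ : _ = 2 * 2) ?mulf_neq0 //; ring.
Qed.

Let ramified_root s : s ^+ 2 = 4 -> (s \in r) = false.
Proof.
move=> s2; rewrite -root_mem; apply/negbTE/(ramified_gform (@neq01 s)).
by rewrite s2; ring.
Qed.

Let ramified_planes : fibers_of_type [:: 2; - 2] (nseq 2 II).
Proof.
apply: fibers_of_type_nseq => // x x2 c.
have [eps eps2 ->] : exists2 eps : K, eps ^+ 2 = 1 & x = 2 * eps.
  by move: x2; rewrite !inE => /orP [] /eqP ->; [exists 1 | exists (- 1)]; ring.
exact: fiber_at_ramified.
Qed.

Let sqr4 (s : K) : s ^+ 2 = 4 -> s \in [:: 2; - 2].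
Proof.
move=> s2; have : (s - 2) * (s - - 2) == 0.
  by apply/eqP; transitivity (s ^+ 2 - 4); [ring | rewrite s2 subrr].
by rewrite mulf_eq0 !subr_eq0 !inE.
Qed.

Let mem_sqr4 (s : K) : s \in [:: 2; - 2] -> s ^+ 2 = 4.
Proof. by rewrite !inE => /orP [] /eqP ->; ring. Qed.

Let nodalE s : gform (nodal e g) s 1 = gform g s 1 - 8 * e ^+ 3 * (s ^+ 2 - 4).
Proof. by rewrite /gform /nodal /=; ring. Qed.

(** The quartics [g] and [nodal e g] differ by a multiple of [s^2 - 4], which does not
    vanish in the roots of [g]; so the ten values of [s] are distinct. *)
Lemma fibration_type_e_neq0 : e != 0 ->
  fibration_type f l (IV :: nseq 4 I3 ++ nseq 4 I1 ++ nseq 2 II).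
Proof.
move=> e0.
have g0 : nodal e g 0%N != 0.
  by rewrite /nodal /= subr0; apply: smooth_g0 Bu fE fsmooth.
have [n [n4 nuniq nE]] := gform_roots g0 (smooth_nodal_simple_root Bu fE fsmooth).
have n_mem s : (gform (nodal e g) s 1 == 0) = (s \in n).
  by rewrite nE; apply: prod_root_mem.
have char8 : 8 * e ^+ 3 != 0.
  by rewrite mulf_neq0 ?expf_neq0 // [X in X != 0](_ : _ = 2 ^+ 3) ?expf_neq0 //; ring.
apply: (@fibration_type_intro (r ++ n ++ [:: 2; - 2])).
- apply: fibers_of_type_cat; [|apply: fibers_of_type_cat => //]; apply: fibers_of_type_nseq => // x xr c fc.
    have := fiber_at_root _ fc; rewrite (negbTE e0); apply.
    by apply/eqP; rewrite -/g root_mem.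
  by apply: (fiber_at_nodal e0 _ fc); apply/eqP; rewrite -/g n_mem.
- rewrite !cat_uniq runiq nuniq two_uniq !andTb andbT; apply/andP; split.
  + apply/hasPn => x; rewrite mem_cat => /orP [|/mem_sqr4 /ramified_root -> //].
    rewrite -n_mem -root_mem nodalE => /eqP nx; apply/negP => /eqP gx.
    move/eqP: nx; rewrite gx sub0r oppr_eq0 mulf_eq0 (negbTE char8) subr_eq0 => /eqP.
    by move=> /ramified_root; rewrite -root_mem gx eqxx.
  + apply/hasPn => x /mem_sqr4 x2; apply/negP; rewrite /= -n_mem nodalE x2 subrr mulr0 subr0 root_mem.
    by rewrite ramified_root.
move=> s [] H; rewrite !mem_cat.
- by rewrite -root_mem H eqxx.
- by rewrite sqr4 // !orbT.
by rewrite -n_mem H eqxx orbT.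
Qed.

(** For [e = 0] the quartics [g] and [nodal e g] coincide. *)
Lemma fibration_type_e0 : e = 0 -> fibration_type f l (nseq 5 IV ++ nseq 2 II).
Proof.
move=> e0; apply: (@fibration_type_intro (r ++ [:: 2; - 2]) (nseq 4 IV ++ nseq 2 II)).
- apply: fibers_of_type_cat => //; apply: fibers_of_type_nseq => // x xr c fc.
  have := fiber_at_root _ fc; rewrite (introT eqP e0); apply.
  by apply/eqP; rewrite -/g root_mem.
- rewrite cat_uniq runiq two_uniq andbT; apply/hasPn => x /mem_sqr4 x2.
  by rewrite /= ramified_root.
move=> s [] H; rewrite mem_cat.
- by rewrite -root_mem H eqxx.
- by rewrite sqr4 // orbT.
have := H; rewrite nodalE; have -> : 8 * e ^+ 3 = 0 by rewrite e0; ring.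
by rewrite mul0r subr0 => /eqP; rewrite root_mem => ->.
Qed.

Lemma fibration_type_I3 T : fibration_type f l (IV :: I3 :: T) -> e != 0.
Proof.
move=> [us [_ _ /(_ 1%N isT) [c [fc I3c]] _]].
exact: (I3_nodal fc I3c).
Qed.

Lemma fibration_type_IV T : fibration_type f l (IV :: IV :: T) -> e = 0.
Proof.
move=> [us [us_size us_uniq H _]]; apply/eqP; apply: contraT => e0.
have [c0 [f0 t0]] := H 0%N isT; have [c1 [f1 t1]] := H 1%N isT.
have E0 := IV_plane e0 f0 t0.
have E1 := IV_plane e0 f1 t1.
move: us us_size us_uniq E0 E1 {H f0 f1 t0 t1} => [|u0 [|u1 us]] //= _ + E0 E1.
by rewrite E0 E1 inE eqxx.
Qed.

End SingularFibers.











(** * The normal form and the corollary *)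

Theorem corollary6p7 (K : closedFieldType)
  (char2 : 2%N \notin [pchar K]) (char3 : 3%N \notin [pchar K])
  (f : {mpoly K[4]}) (fhomog : f \is 4.-homog) (fsmooth : smooth_surface f)
  (l : {vspace 'rV[K]_4}) (lline : is_line l) (lX : in_surface l f)
  (l2 : second_kind f l)
  (P1 P2 P3 : 'rV[K]_4)
  (Pdistinct : uniq [:: <[P1]>%VS; <[P2]>%VS; <[P3]>%VS])
  (ramif : ramification_divisor f l [:: P1; P1; P2; P3]) :
  (segre_construction f l <-> through_singular_point_of_IV f l)
  /\
  (segre_construction f l ->
   exists (S4 : {mpoly K[4]}) (L : 4.-tuple 'rV[K]_4),
   let T1 := tangent_plane f P1 in
   let T2 := tangent_plane f P2 in
   let T3 := tangent_plane f P3 in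
   [/\
     (* (i) *)
     [/\ S4 \is 4.-homog, ruled_surface S4,
         lform T1 * lform T2 * lform T3 * S4 \is 7.-homog
       & reduced_equation (S8 f l) (lform T1 * lform T2 * lform T3 * S4)],
     (* (ii) *)
     (forall u, u \in (L : seq _) -> u <> 0) /\
     uniq [seq <[u]>%VS | u <- T1 :: L] /\
     (exists T : {fset {fset {vspace 'rV[K]_4}}},
       [/\ #|` T|%fset = 5%N,
           forall t, t \in T <-> coplanar_triplet f l t,
           forall t, t \in T ->
             exists2 u, u \in T1 :: L & forall m, m \in t -> in_plane m u
         & forall u, u \in T1 :: L ->
             exists2 t, t \in T & forall m, m \in t -> in_plane m u]),
     (* (iii) *)
     (exists2 lambda : K, lambda != 0 & segre_decomposition f l (lambda *: S4) L) /\
     (forall (S : {mpoly K[4]}) (L' : 4.-tuple 'rV[K]_4),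
        segre_decomposition f l S L' ->
        (exists2 c : K, c != 0 & S = c *: S4) /\
        perm_eq [seq <[u]>%VS | u <- L'] [seq <[u]>%VS | u <- L])
     (* (iv) *)
   & (fibration_type f l (IV :: nseq 4 I3 ++ nseq 4 I1 ++ nseq 2 II)
        <-> is_twisted_cubic (sing_point S4)) /\
     (fibration_type f l (nseq 5 IV ++ nseq 2 II)
        <-> is_line_set (sing_point S4))]).
Proof.
have c2 : 2%:R != 0 :> K by apply: contra char2; rewrite inE.
have c3 : 3%:R != 0 :> K by apply: contra char3; rewrite inE.
have [B [k1 [k2 [k3 [b [e [h [lB [k10 k20 k30] [P1E P2E P3E] fh]]]]]]]] :=
  normal_form c2 c3 fhomog lline lX l2 Pdistinct ramif.
have segre_b : segre_construction f l -> b = 0.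
  move=> [S [L dec]]; have [_ Sl _ _ _] := dec.
  have [c [h' [c0 SE' _]]] := segre_quartic lB fh dec.
  exact: (segre_b0 c3 lB c0 SE' Sl).
have IV_b : through_singular_point_of_IV f l -> b = 0 := IV_on_line_b0 c2 c3 lB fh.
have [b0|b0] := eqVneq b 0; last first.
  have nS : ~ segre_construction f l by move=> /segre_b /eqP; rewrite (negbTE b0).
  by split=> //; split=> // /IV_b /eqP; rewrite (negbTE b0).
move: fh; rewrite b0 => fh {segre_b IV_b b0}.
have [S Sh SE] := S4_exists e lB.
have [r [r4 runiq gr]] := rest_roots lB fh fsmooth.
have Bu := proj1 lB.
have seg := segre_exists c2 c3 lB fh fsmooth Sh SE r4 runiq gr.
(* From here on [b = 0], and the equivalent conditions hold. *)
have st1 : (1 : K, 0 : K) <> (0, 0) by case=> /eqP; rewrite oner_eq0.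
split.
  split=> _; last by eexists; eexists; exact: seg.
  have [c fc ce] := fiber_plane_exists lB fh st1.
  have [IVc sc] := fiber_at_P1 c3 lB fh fsmooth ce.
  exists (plane B 1 0), c, (pt B 1 0 (0 * 1) (0 * 0)); split=> //.
  by rewrite !mul0r; exact: pt_in_l.
move=> _; exists S, (planes4 B r4); cbv zeta.
have T1E : tangent_plane f P1 = plane B (- k1 ^+ 3) 0.
  rewrite P1E ptZ !mulr0 mulr1 (tangent_plane_l lB fh); congr plane; ring.
have k13 : - k1 ^+ 3 != 0 by rewrite oppr_eq0 expf_neq0.
have planesE u : u \in planes B r -> exists2 x, x \in r & u = plane B x 1 by case/mapP => x; exists x.
(* The special planes are [T1] and the four planes of the decomposition. *)
have usE u : u \in tangent_plane f P1 :: planes B r ->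
    exists s t, [/\ (s, t) <> (0, 0), special e h s t & u = plane B s t].
  rewrite inE => /orP [/eqP ->|/planesE [x xr ->]].
    exists (- k1 ^+ 3), 0; split=> //; last by left.
    by case=> /eqP; rewrite (negbTE k13).
  exists x, 1; split=> //; first exact: neq01.
  by right; rewrite gr (big_rem x) //= mulr1 subrr mul0r mulr0.
have us_uniq : uniq [seq <[u]>%VS | u <- tangent_plane f P1 :: planes B r].
  rewrite /= (planes_uniq lB runiq) andbT; apply/mapP => -[_ /planesE [x _ ->]].
  move=> /(vline_eqP _ (plane1_neq0 lB (x := x))) [k k0].
  by rewrite T1E planeZ mulr1 => /(plane_inj lB) [_ k00]; rewrite -k00 eqxx in k0.
split.
- split=> //; first exact: (S4_ruled c2 c3 Bu SE).
    apply: (dhomogM (d := 3) _ Sh); apply: (dhomogM (d := 2) _ (lform_homog _)).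
    exact: (dhomogM (lform_homog _) (lform_homog _)).
  exact: (S8_equation c2 c3 lB fh SE k10 k20 k30 P1E P2E P3E).
- split; [|split].
  + by move=> u /planesE [x _ ->]; exact: (plane1_neq0 lB (x := x)).
  + exact: us_uniq.
  apply: (triplets c3 lB fh lline fsmooth (us := tangent_plane f P1 :: planes B r)) => //=; first by rewrite size_map r4.
  move=> s t st [t0|].
    exists (tangent_plane f P1); first exact: mem_head.
    have s0 : s != 0 by apply/eqP => s0; apply: st; rewrite s0 t0.
    apply/vline_eqP; first by move=> /(plane_eq0 lB) [s0' _]; rewrite s0' eqxx in s0.
    exists (- k1 ^+ 3 / s); first by rewrite mulf_neq0 // invr_eq0.
    by rewrite T1E t0 planeZ divfK // mulr0.
  rewrite gr => /eqP; rewrite mulf_eq0 (negbTE (smooth_g0 Bu (fE fh) fsmooth)) /=.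
  rewrite prodf_seq_eq0 => /hasP [x xr]; rewrite /= subr_eq0 => /eqP sE.
  exists (plane B x 1); first by apply: mem_behead; apply: map_f.
  have t0 : t != 0 by apply/eqP => t0; apply: st; rewrite sE t0 mulr0.
  apply/vline_eqP; first by move=> /(plane_eq0 lB) [_ t0']; rewrite t0' eqxx in t0.
  exists t^-1; first by rewrite invr_eq0.
  by rewrite planeZ sE mulrCA mulVf // mulr1.
- split; first by exists (rest e h 0%N)^-1; [rewrite invr_eq0 (smooth_g0 Bu (fE fh) fsmooth) | exact: seg].
  by move=> S' L' dec; exact: (segre_decomposition_unique c3 lB fh SE r4 runiq gr dec).
split; split.
- move=> /(fibration_type_I3 c2 c3 lB fh fsmooth); exact: (sing_S4_twisted c2 c3 Bu SE).
- move=> tw; apply: (fibration_type_e_neq0 c2 c3 lB fh lline fsmooth r4 runiq gr).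
  apply/eqP => e0; exact: (twisted_cubic_not_line tw (sing_S4_line Bu SE e0)).
- move=> /(fibration_type_IV c2 c3 lB fh fsmooth); exact: (sing_S4_line Bu SE).
- move=> li; apply: (fibration_type_e0 c2 c3 lB fh lline fsmooth r4 runiq gr).
  apply/eqP; apply: contraT => e0.
  by case: (twisted_cubic_not_line (sing_S4_twisted c2 c3 Bu SE e0) li).
Qed.
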